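(* Let $p$ be a prime, $a\ge 0$ an integer and $G$ a ramification group at $p$. The symplectic realizations $(E,V)$ of $G$ of dimension $2a$ are in correspondence with families of homomorphisms $(p_\ell\colon G\to\operatorname{Sp}_{2a}(\mathbf{Q}_\ell))_{\ell\neq p}$, indexed by primes $\ell\neq p$, such that for every $g\in G$ the characteristic polynomial of $p_\ell(g)$ has integer coefficients independent of $\ell$. The correspondence is such that, for each $\ell\neq p$, $p_\ell$ coincides with the composition $G\to E\to\operatorname{End}_{\mathbf{Q}_\ell}V_\ell$ of the canonical map $G\to E$ with the action of $E$ on $V_\ell$, where $V_\ell$ is the rational $\mathbf{Q}_\ell$-representation of $E$ with $V_\ell\otimes_{\mathbf{Q}_\ell}\mathbf{C}\simeq V$.
   Context: A ramification group at $p$ is a finite group $\Gamma_p\rtimes\mathbf{Z}/n\mathbf{Z}$ with $\Gamma_p$ a $p$-group and $n$ prime to $p$. Fix embeddings $\mathbf{Q}_\ell\subset\mathbf{C}$. $\mathbf{Q}[G]$ carries the positive involution $g\mapsto g^{-1}$, inherited by its quotients $E$, which also come with the map $G\to E$. A $K$-representation ($K=\mathbf{C}$ or $\mathbf{Q}_\ell$) of a $\mathbf{Q}$-algebra $E$ is a $K$-vector space $V$ with a $\mathbf{Q}$-algebra map $\rho\colon E\to\operatorname{End}_K V$; it is rational if the characteristic polynomials of all $\rho(x)$ have coefficients in $\mathbf{Q}$; it is polarized if there is a nondegenerate alternating form $B$ on $V$ with $B(\rho(x)v,w)=B(v,\rho(x^* )w)$ for all $x,v,w$. A symplectic realization of $G$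 of dimension $2a$ is a pair $(E,V)$ with $E$ a quotient of $\mathbf{Q}[G]$ and $V$ a rational and polarized $\mathbf{C}$-representation of $E$ of dimension $2a$. (For such $E$, a rational $\mathbf{C}$-representation $V$ is of the form $V_\ell\otimes_{\mathbf{Q}_\ell}\mathbf{C}$ for a unique rational $\mathbf{Q}_\ell$-representation $V_\ell$.) *)

(* Defs.v *)
From HB Require Import structures.
From mathcomp Require Import all_boot all_order all_algebra all_fingroup.
From mathcomp Require Import all_solvable mxrepresentation.
From mathcomp Require Import complex reals.

Set Implicit Arguments.
Unset Strict Implicit.
Unset Printing Implicit Defensive.

Import Order.TTheory GRing.Theory Num.Theory.
Local Open Scope ring_scope.

(* Every finite group is the full group of its carrier type. *)
Definition ramification_group (p : nat) (gT : finGroupType) : Prop :=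
  exists P C : {group gT},
    [/\ P ><| C = [set: gT], p.-group P, cyclic C & coprime #|C| p]%g.

(* The alias hides the pointwise product carried by {ffun gT -> rat}. *)
Definition group_algebra (gT : finGroupType) : Type := {ffun gT -> rat}.

HB.instance Definition _ (gT : finGroupType) :=
  GRing.Zmodule.copy (group_algebra gT) {ffun gT -> rat}.

Section GroupAlgebra.
Variable gT : finGroupType.
Local Notation QG := (group_algebra gT).
Implicit Types (x y z : QG) (g h : gT).

Definition ga_of (g : gT) : QG := [ffun h => (h == g)%:R].

Definition ga_mul x y : QG := [ffun g => \sum_h x h * y (h^-1 * g)%g].

Lemma ga_mulA : associative ga_mul.
Proof.
move=> x y z; apply/ffunP=> g; rewrite !ffunE.
under eq_bigr => h _ do
  rewrite ffunE mulr_sumr (reindex_inj (mulgI h^-1%g)) /=.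
rewrite exchange_big /=; apply: eq_bigr => k _.
rewrite ffunE mulr_suml; apply: eq_bigr => h _.
by rewrite mulrA invMg invgK -mulgA mulKVg.
Qed.

Lemma ga_mul1x : left_id (ga_of 1%g) ga_mul.
Proof.
move=> x; apply/ffunP=> g; rewrite ffunE (bigD1 1%g) //= big1 => [|h h1].
  by rewrite ffunE eqxx mul1r invg1 mul1g addr0.
by rewrite ffunE (negPf h1) mul0r.
Qed.

Lemma ga_mulx1 : right_id (ga_of 1%g) ga_mul.
Proof.
move=> x; apply/ffunP=> g; rewrite ffunE (bigD1 g) //= big1 => [|h hg].
  by rewrite ffunE mulVg eqxx mulr1 addr0.
by rewrite ffunE -eq_mulVg1 (negPf hg) mulr0.
Qed.

Lemma ga_mulDl : left_distributive ga_mul +%R.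
Proof.
move=> x y z; apply/ffunP=> g; rewrite !ffunE -big_split.
by apply: eq_bigr => h _; rewrite ffunE mulrDl.
Qed.

Lemma ga_mulDr : right_distributive ga_mul +%R.
Proof.
move=> x y z; apply/ffunP=> g; rewrite !ffunE -big_split.
by apply: eq_bigr => h _; rewrite ffunE mulrDr.
Qed.

Lemma ga_1neq0 : ga_of 1%g != 0.
Proof. by apply/eqP=> /ffunP/(_ 1%g); rewrite !ffunE eqxx. Qed.

HB.instance Definition _ := GRing.Zmodule_isNzRing.Build QG
  ga_mulA ga_mul1x ga_mulx1 ga_mulDl ga_mulDr ga_1neq0.

Definition ga_star x : QG := [ffun g => x (g^-1)%g].

Let vec x : 'rV[rat]_#|gT| := \row_i x (enum_val i).
Let rmul x : 'M[rat]_#|gT| :=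
  \matrix_(i, j) x ((enum_val i)^-1 * enum_val j)%g.

Let vecM x y : vec (x * y) = vec x *m rmul y.
Proof.
apply/rowP=> j; rewrite !mxE ffunE (reindex (@enum_val gT gT)) /=; last first.
  by apply: onW_bij; exact: enum_val_bij.
by apply: eq_bigr => i _; rewrite !mxE.
Qed.

Let rmul_star x : rmul (ga_star x) = (rmul x)^T.
Proof. by apply/matrixP=> i j; rewrite !mxE ffunE invMg invgK. Qed.

Let vec_inj : injective vec.
Proof.
move=> x y /rowP xy; apply/ffunP=> g.
by have := xy (enum_rank g); rewrite !mxE enum_rankK.
Qed.

Let trmul_eq0 m n (A : 'M[rat]_(m, n)) : A^T *m A = 0 -> A = 0.
Proof.
move=> A0; apply/matrixP=> i j; rewrite mxE.
have /eqP := congr1 (fun M : 'M_n => M j j) A0; rewrite !mxE.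
under eq_bigr => k _ do rewrite mxE -expr2.
rewrite psumr_eq0 => [|k _]; last exact: sqr_ge0.
by move=> /allP/(_ i (mem_index_enum _)); rewrite sqrf_eq0 => /eqP.
Qed.

(* By positivity of the involution, the adjoint of x is a multiple of x. *)
Lemma ga_star_in_ideal x : exists w : QG, ga_star x = w * x * ga_star x.
Proof.
have /submxP[D defD] : ((rmul x)^T <= rmul x *m (rmul x)^T)%MS.
  rewrite submxE; set Z := cokermx _; apply/eqP/trmul_eq0.
  by rewrite trmx_mul trmxK -mulmxA (mulmxA (rmul x)) mulmx_coker mulmx0.
pose w : QG := [ffun g => (vec 1 *m D) 0 (enum_rank g)].
have vecw : vec w = vec 1 *m D by apply/rowP=> i; rewrite !mxE ffunE enum_valK mxE.
exists w; apply: vec_inj.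
by rewrite -[ga_star x in LHS]mul1r !vecM rmul_star vecw -!mulmxA -defD.
Qed.

End GroupAlgebra.

(* The target may be the zero ring.  It is a Q-algebra through Q[G]: the
   kernel of a ring morphism from Q[G] is stable under the central subfield Q. *)
Record ga_quotient (gT : finGroupType) := GaQuotient {
  quot_ring :> pzRingType;
  quot_map : {rmorphism group_algebra gT -> quot_ring};
  quot_surj : forall y : quot_ring, exists x, quot_map x == y
}.

Section Quotient.
Variables (gT : finGroupType) (E : ga_quotient gT).

Definition quot_star (y : E) : E :=
  quot_map E (ga_star (xchoose (quot_surj y))).

Lemma quot_star_map x : quot_star (quot_map E x) = quot_map E (ga_star x).
Proof.
have starB (u v : group_algebra gT) : ga_star (u - v) = ga_star u - ga_star v.
  by apply/ffunP=> g; rewrite !ffunE.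
apply/eqP; rewrite -subr_eq0 -rmorphB -starB.
set z := _ - x; have [w ->] := ga_star_in_ideal z.
rewrite !rmorphM rmorphB (eqP (xchooseP (quot_surj (quot_map E x)))).
by rewrite subrr mulr0 mul0r.
Qed.

Definition quot_of (g : gT) : E := quot_map E (ga_of g).

End Quotient.

Definition rational_poly (K : fieldType) (q : {poly K}) : Prop :=
  exists r : {poly rat}, q = map_poly ratr r.

Definition integral_poly (K : fieldType) (q : {poly K}) (r : {poly int}) : Prop :=
  q = map_poly intr r.

(* An n-dimensional K-representation of E is a ring morphism from E to 'M[K]_n,
   acting on column vectors; Q-linearity is automatic because a scalar of Q is a
   quotient of integers. *)
Section Representations.
Variables (gT : finGroupType) (E : ga_quotient gT).
Variables (K : fieldType) (n : nat).
Implicit Type rho : {rmorphism E -> 'M[K]_n}.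

Definition rational_repr rho : Prop :=
  forall x : E, rational_poly (char_poly (rho x)).

Definition polarized_repr rho : Prop :=
  exists B : {biscalar 'cV[K]_n},
    [/\ forall v, B v v = 0,
        forall v, (forall w, B v w = 0) -> v = 0
      & forall (x : E) v w, B (rho x *m v) w = B v (rho (quot_star x) *m w)].

End Representations.

Record symplectic_realization (gT : finGroupType) (C : fieldType) (a : nat) :=
  SymplecticRealization {
    real_alg : ga_quotient gT;
    real_repr : {rmorphism real_alg -> 'M[C]_(a + a)};
    real_rational : rational_repr real_repr;
    real_polarized : polarized_repr real_repr
  }.

(* This does not see through which quotient of Q[G] the group acts: when the
   action of E on V is not faithful, V alone does not determine E. *)
Definition real_equiv (gT : finGroupType) (C : fieldType) (a : nat)
    (S S' : symplectic_realization gT C a) : Prop :=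
  exists2 M : 'M[C]_(a + a), M \in unitmx &
    forall x : group_algebra gT,
      M *m real_repr S (quot_map _ x) = real_repr S' (quot_map _ x) *m M.

Definition real_iso (gT : finGroupType) (C : fieldType) (a : nat)
    (S S' : symplectic_realization gT C a) : Prop :=
  exists2 f : {rmorphism real_alg S -> real_alg S'},
    bijective f /\ (forall x, f (quot_map _ x) = quot_map _ x) &
    exists2 M : 'M[C]_(a + a), M \in unitmx &
      forall y, M *m real_repr S y = real_repr S' (f y) *m M.

Definition faithful_real (gT : finGroupType) (C : fieldType) (a : nat)
    (S : symplectic_realization gT C a) : Prop := injective (real_repr S).

Definition rat_padic_abs (l : nat) (q : rat) : rat :=
  if q == 0 then 0
  else l%:R ^ ((logn l `|denq q|)%:Z - (logn l `|numq q|)%:Z).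

(* The completion of Q for the l-adic absolute value; as l ^ Z is discrete, the
   absolute value of the completion still takes rational values. *)
Record padic_field (l : nat) := PadicField {
  padic_sort :> fieldType;
  padic_abs : padic_sort -> rat;
  padic_abs_ge0 : forall x, 0 <= padic_abs x;
  padic_abs_eq0 : forall x, padic_abs x = 0 -> x = 0;
  padic_absM : forall x y, padic_abs (x * y) = padic_abs x * padic_abs y;
  padic_absD : forall x y,
    padic_abs (x + y) <= Num.max (padic_abs x) (padic_abs y);
  padic_abs_ratr : forall q : rat, padic_abs (ratr q) = rat_padic_abs l q;
  padic_dense : forall (x : padic_sort) (e : rat), 0 < e ->
    exists q : rat, padic_abs (x - ratr q) < e;
  padic_complete : forall u : nat -> padic_sort,
    (forall e : rat, 0 < e -> exists N : nat, forall m n : nat,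
       (N <= m)%N -> (N <= n)%N -> padic_abs (u m - u n) < e) ->
    exists x : padic_sort, forall e : rat, 0 < e ->
      exists N : nat, forall n : nat, (N <= n)%N -> padic_abs (u n - x) < e
}.

Record prime_neq (p : nat) := PrimeNeq {
  prime_val :> nat;
  prime_valP : prime prime_val;
  prime_val_neq : prime_val != p
}.

Definition symplectic_form (K : fieldType) (a : nat) : 'M[K]_(a + a) :=
  block_mx 0 1%:M (- 1%:M) 0.

Definition Sp (K : fieldType) (a : nat) (M : 'M[K]_(a + a)) : Prop :=
  M^T *m symplectic_form K a *m M = symplectic_form K a.

Section Families.
Variables (p : nat) (gT : finGroupType) (a : nat).
Variable Ql : forall l : prime_neq p, padic_field l.

Record symplectic_family := SymplecticFamily {
  fam_repr :> forall l, mx_representation (Ql l) [set: gT] (a + a);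
  fam_Sp : forall l g, Sp (fam_repr l g);
  fam_compatible : forall g, exists r : {poly int},
    forall l, integral_poly (char_poly (fam_repr l g)) r
}.

(* Linear, not symplectic, equivalence: V only determines the underlying linear
   representations, since invariant symplectic forms need not be equivalent
   over Q_l. *)
Definition fam_equiv (F F' : symplectic_family) : Prop :=
  forall l, mx_rsim (F l) (F' l).

Variables (C : fieldType) (iota : forall l, {rmorphism Ql l -> C}).

(* [rho_l] is the Q_l-representation V_l of E with V_l (x) C isomorphic to V. *)
Definition corresponds (S : symplectic_realization gT C a)
    (F : symplectic_family) : Prop :=
  forall l, exists rho_l : {rmorphism real_alg S -> 'M[Ql l]_(a + a)},
    [/\ rational_repr rho_l,
        exists2 M : 'M[C]_(a + a), M \in unitmx &
          forall y, M *m map_mx (iota l) (rho_l y) = real_repr S y *m M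
      & forall g, F l g = rho_l (quot_of (real_alg S) g)].

End Families.

(* Main.v *)
(* Both directions rest on descending complex representations with rational
   characters to Q_l for l <> p, where no Schur index appears.  Such a group G
   has a normal subgroup N of order prime to l whose quotient is a cyclic
   l-group, generated by t.  In F_l[G], every proper two-sided ideal misses an
   idempotent f such that f F_l[G] f is spanned by the f gam^i for a single
   gam: the corner of a minimal idempotent e of F_l[N] is a finite field k by
   Wedderburn's theorem, e F_l[G] e is a crossed product of k by the powers of
   one element and, k being perfect, this crossed product splits.  Hence 1 is a
   sum of products a f b.  Lifting these f to Q_l gives idempotents e of Q_l[G] with
   commutative corners e Q_l[G] e and with 1 a sum of products a e b.

   Let V be a complex representation with character in Q_l.  Some such e acts
   nontrivially on V, and may be shrunk until its corner acts faithfully.  The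
   corner being commutative, a vector v of V e separates its elements, and
   x |-> v x embeds the right ideal e C[G], which is defined over Q_l, in V.  By
   Maschke's theorem and induction on the dimension, V is defined over Q_l.

   Invertible intertwiners and nondegenerate invariant alternating forms descend
   as well, since a determinant that does not vanish on the extension to C of a
   subspace of matrices over Q_l does not vanish on that subspace.

   From a family one gets E as the image of Q[G] in the complex matrices;
   Newton's identities make characteristic polynomials rational as soon as all
   traces are, and the roots of unity being integral, Gauss's lemma makes those
   of the elements of G integral. *)
From HB Require Import structures.
From mathcomp Require Import all_boot all_order all_algebra all_fingroup.
From mathcomp Require Import all_solvable all_field mxrepresentation character.
From mathcomp Require Import ring boolp complex reals.
Require Import Defs.

Set Implicit Arguments.
Unset Strict Implicit.
Unset Printing Implicit Defensive.

Import Order.TTheory GRing.Theory Num.Theory.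
Local Open Scope ring_scope.


(** * Group algebras *)

(** In a simple factor of Q_l[G] where an idempotent with commutative corner is nonzero, the
    underlying division algebra is a subquotient of that corner up to isomorphism, hence a field.
    When 1 is a sum of products [a * e * b], every factor is reached, so all Schur indices over Q_l
    are 1. The algebra is never decomposed, however: von Neumann regularity, [x * y * x = x], which
    comes from averaging over a group of invertible order, supplies the idempotents that are split
    off. The obstacle is the passage from characteristic l to characteristic 0. In general
    commutativity of a corner does not lift, since commutators are only known to vanish modulo l.
    Being spanned by the powers of one element does lift, because the same integer polynomials can
    be evaluated at a lift of that element. This is why the corners modulo l are asked to be
    generated by a single [gam], with integer coefficients. The restriction to l <> p is essential
    to this descent: the quaternion group of order 8 is a ramification group at 2, and its faithful
    character of degree 2 is rational but not afforded over Q_2. *)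

(* [galg rat gT] is convertible to [group_algebra gT], with the same operations. *)
Definition galg (R : comNzRingType) (gT : finGroupType) : Type :=
  {ffun gT -> R^o}.

HB.instance Definition _ (R : comNzRingType) (gT : finGroupType) :=
  GRing.Lmodule.copy (galg R gT) {ffun gT -> R^o}.

Section GroupAlgebra.
Variables (R : comNzRingType) (gT : finGroupType).
Local Notation A := (galg R gT).
Implicit Types (x y z : A) (g h : gT).

Definition gel (g : gT) : A := [ffun h => (h == g)%:R].

Definition galg_mul x y : A := [ffun g => \sum_h x h * y (h^-1 * g)%g].

Fact galg_mulA : associative galg_mul.
Proof.
move=> x y z; apply/ffunP=> g; rewrite !ffunE.
under eq_bigr => h _ do
  rewrite ffunE mulr_sumr (reindex_inj (mulgI h^-1%g)) /=.
rewrite exchange_big /=; apply: eq_bigr => k _.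
rewrite ffunE mulr_suml; apply: eq_bigr => h _.
by rewrite mulrA invMg invgK -mulgA mulKVg.
Qed.

Fact galg_mul1 : left_id (gel 1%g) galg_mul.
Proof.
move=> x; apply/ffunP=> g; rewrite ffunE (bigD1 1%g) //= big1 => [|h h1].
  by rewrite ffunE eqxx mul1r invg1 mul1g addr0.
by rewrite ffunE (negPf h1) mul0r.
Qed.

Fact galg_mulr1 : right_id (gel 1%g) galg_mul.
Proof.
move=> x; apply/ffunP=> g; rewrite ffunE (bigD1 g) //= big1 => [|h hg].
  by rewrite ffunE mulVg eqxx mulr1 addr0.
by rewrite ffunE -eq_mulVg1 (negPf hg) mulr0.
Qed.

Fact galg_mulDl : left_distributive galg_mul +%R.
Proof.
move=> x y z; apply/ffunP=> g; rewrite !ffunE -big_split.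
by apply: eq_bigr => h _; rewrite ffunE mulrDl.
Qed.

Fact galg_mulDr : right_distributive galg_mul +%R.
Proof.
move=> x y z; apply/ffunP=> g; rewrite !ffunE -big_split.
by apply: eq_bigr => h _; rewrite ffunE mulrDr.
Qed.

Fact galg_1neq0 : gel 1%g != 0.
Proof. by apply/eqP=> /ffunP/(_ 1%g)/eqP; rewrite !ffunE eqxx oner_eq0. Qed.

HB.instance Definition _ := GRing.Zmodule_isNzRing.Build A
  galg_mulA galg_mul1 galg_mulr1 galg_mulDl galg_mulDr galg_1neq0.

Lemma galgM x y g : (x * y) g = \sum_h x h * y (h^-1 * g)%g.
Proof. by rewrite ffunE. Qed.

Fact galg_scalerAl (a : R) x y : a *: (x * y) = a *: x * y.
Proof.
apply/ffunP=> g; rewrite !ffunE [LHS]mulr_sumr; apply: eq_bigr => h _.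
by rewrite !ffunE [in LHS]mulrA.
Qed.

HB.instance Definition _ :=
  GRing.Lmodule_isLalgebra.Build R A galg_scalerAl.

Fact galg_scalerAr (a : R) x y : a *: (x * y) = x * (a *: y).
Proof.
apply/ffunP=> g; rewrite !ffunE [LHS]mulr_sumr; apply: eq_bigr => h _.
by rewrite !ffunE mulrCA.
Qed.

HB.instance Definition _ :=
  GRing.Lalgebra_isAlgebra.Build R A galg_scalerAr.

Lemma galgZ (a : R) x g : (a *: x) g = a * x g.
Proof. by rewrite ffunE. Qed.

Lemma gel1 : gel 1%g = 1. Proof. by []. Qed.

Lemma gel_mull g y h : (gel g * y) h = y (g^-1 * h)%g.
Proof.
rewrite galgM (bigD1 g) //= big1 => [|k kg].
  by rewrite ffunE eqxx mul1r addr0.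
by rewrite ffunE (negPf kg) mul0r.
Qed.

Lemma gel_mulr g y h : (y * gel g) h = y (h * g^-1)%g.
Proof.
rewrite galgM (bigD1 (h * g^-1)%g) //= big1 => [|k kg].
  by rewrite ffunE invMg invgK mulgKV eqxx mulr1 addr0.
rewrite ffunE; case: eqP => [kh|]; last by rewrite mulr0.
by case/eqP: kg; rewrite -kh invMg invgK mulgA mulgV mul1g.
Qed.

Lemma gelM g h : gel (g * h) = gel g * gel h.
Proof.
by apply/ffunP=> k; rewrite gel_mull !ffunE -[in RHS](inj_eq (mulgI g)) mulKVg.
Qed.

Lemma gelX g n : gel (g ^+ n) = gel g ^+ n.
Proof. by elim: n => // n IHn; rewrite expgS exprS gelM IHn. Qed.

Lemma gelVK g : gel g^-1 * gel g = 1. Proof. by rewrite -gelM mulVg. Qed.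
Lemma gelKV g : gel g * gel g^-1 = 1. Proof. by rewrite -gelM mulgV. Qed.

Lemma galg_sum x : x = \sum_g x g *: gel g.
Proof.
apply/ffunP=> h; rewrite sum_ffunE (bigD1 h) //= big1 => [|k kh].
  by rewrite galgZ ffunE eqxx mulr1 addr0.
by rewrite galgZ ffunE eq_sym (negPf kh) mulr0.
Qed.

End GroupAlgebra.

Arguments gel {R gT} g.

HB.instance Definition _ (R : finComNzRingType) (gT : finGroupType) :=
  Finite.copy (galg R gT) {ffun gT -> R}.

Section GroupAlgebraMap.
Variables (R S : comNzRingType) (f : {rmorphism R -> S}) (gT : finGroupType).

Definition gmap (x : galg R gT) : galg S gT := [ffun g => f (x g)].

Lemma gmapE x g : gmap x g = f (x g). Proof. by rewrite ffunE. Qed.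

Fact gmap_is_zmod_morphism : zmod_morphism gmap.
Proof. by move=> x y; apply/ffunP=> g; rewrite !ffunE rmorphB. Qed.

Fact gmap_is_monoid_morphism : monoid_morphism gmap.
Proof.
split=> [|x y]; apply/ffunP=> g; first by rewrite !ffunE rmorph_nat.
rewrite !ffunE rmorph_sum; apply: eq_bigr => h _.
by rewrite rmorphM !ffunE.
Qed.

HB.instance Definition _ := GRing.isZmodMorphism.Build _ _ gmap
  gmap_is_zmod_morphism.
HB.instance Definition _ := GRing.isMonoidMorphism.Build _ _ gmap
  gmap_is_monoid_morphism.

Lemma gmap_gel g : gmap (gel g) = gel g.
Proof. by apply/ffunP=> h; rewrite !ffunE rmorph_nat. Qed.

End GroupAlgebraMap.

Section GroupAlgebraRepresentation.
Variables (F : fieldType) (gT : finGroupType) (n : nat).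
Variable rG : mx_representation F [set: gT] n.

Definition gmx (x : galg F gT) : 'M[F]_n := \sum_g x g *: rG g.

Fact gmx_is_zmod_morphism : zmod_morphism gmx.
Proof.
move=> x y; rewrite /gmx -sumrB; apply: eq_bigr => g _.
by rewrite !ffunE scalerBl.
Qed.

HB.instance Definition _ := GRing.isZmodMorphism.Build _ _ gmx
  gmx_is_zmod_morphism.

Lemma gmx_gel g : gmx (gel g) = rG g.
Proof.
rewrite /gmx (bigD1 g) //= big1 ?ffunE ?eqxx ?scale1r ?addr0 // => h hg.
by rewrite ffunE (negPf hg) scale0r.
Qed.

Lemma gmxZ a x : gmx (a *: x) = a *: gmx x.
Proof.
by rewrite scaler_sumr; apply: eq_bigr => g _; rewrite galgZ scalerA.
Qed.

Fact gmx_is_monoid_morphism : monoid_morphism gmx.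
Proof.
split=> [|x y]; first by rewrite -gel1 gmx_gel repr_mx1.
rewrite [x]galg_sum mulr_suml !raddf_sum mulr_suml; apply: eq_bigr => g _ /=.
rewrite -scalerAl !gmxZ -[RHS]scalemxAl; congr (_ *: _).
rewrite [gmx y]/gmx mulmx_sumr {1}[y]galg_sum mulr_sumr raddf_sum; apply: eq_bigr => h _ /=.
rewrite -scalerAr !gmxZ -[RHS]scalemxAr; congr (_ *: _).
by rewrite -gelM !gmx_gel repr_mxM ?inE.
Qed.

HB.instance Definition _ := GRing.isMonoidMorphism.Build _ _ gmx
  gmx_is_monoid_morphism.

Lemma gmx_sum (J : Type) (r : seq J) (P : pred J) (x : J -> galg F gT) :
  gmx (\sum_(i <- r | P i) x i) = \sum_(i <- r | P i) gmx (x i).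
Proof. exact: raddf_sum. Qed.

End GroupAlgebraRepresentation.

Section Coordinates.
Variables (F : fieldType) (gT : finGroupType).
Local Notation A := (galg F gT).
Implicit Types (x y : A) (v : 'rV[F]_#|gT|).

Definition gvec x : 'rV[F]_#|gT| := \row_i x (enum_val i).
Definition ungvec v : A := [ffun g => v 0 (enum_rank g)].
Definition rmx x : 'M[F]_#|gT| :=
  \matrix_(i, j) x ((enum_val i)^-1 * enum_val j)%g.
Definition lmx x : 'M[F]_#|gT| :=
  \matrix_(i, j) x (enum_val j * (enum_val i)^-1)%g.

Lemma gvecK : cancel gvec ungvec.
Proof. by move=> x; apply/ffunP=> g; rewrite ffunE mxE enum_rankK. Qed.

Lemma ungvecK : cancel ungvec gvec.
Proof. by move=> v; apply/rowP=> i; rewrite mxE ffunE enum_valK. Qed.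

Lemma gvec_is_linear : linear gvec.
Proof. by move=> a x y; apply/rowP=> i; rewrite !mxE !ffunE. Qed.
HB.instance Definition _ :=
  GRing.isLinear.Build F A 'rV[F]_#|gT| _ gvec gvec_is_linear.

Lemma gvecMr x y : gvec (x * y) = gvec x *m rmx y.
Proof.
apply/rowP=> j; rewrite !mxE galgM (reindex (@enum_val gT gT)) /=; last first.
  by apply: onW_bij; exact: enum_val_bij.
by apply: eq_bigr => i _; rewrite !mxE.
Qed.

Lemma gvecMl x y : gvec (x * y) = gvec y *m lmx x.
Proof.
apply/rowP=> j; rewrite !mxE galgM (reindex_inj (inj_comp (mulgI (enum_val j)) invg_inj)) /=.
rewrite (reindex (@enum_val gT gT)) /=; last first.
  by apply: onW_bij; exact: enum_val_bij.
by apply: eq_bigr => i _; rewrite !mxE invMg invgK mulgKV mulrC.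
Qed.

End Coordinates.

(** * The group algebra of a subgroup and its von Neumann regularity *)

Section Regular.
Variables (F : fieldType) (gT : finGroupType) (N : {group gT}).
Local Notation A := (galg F gT).
Implicit Types (x y : A).

(** The group algebra of [N] is kept as a subring of that of the whole group, so that elements
    outside [N] can act on it by conjugation. *)
Definition gsupp : {pred galg F gT} :=
  fun x => [forall g, (x g != 0) ==> (g \in N)].

Lemma gsuppP x : reflect (forall g, g \notin N -> x g = 0) (x \in gsupp).
Proof.
apply: (iffP forallP) => [xN g gN | xN g].
  by apply/eqP; apply: contraNT gN => xg; apply: (implyP (xN g)).
by apply/implyP; apply: contraR => /xN->.
Qed.

Lemma gsupp_gel g : (gel g \in gsupp) = (g \in N).
Proof.
apply/gsuppP/idP => [gN | gN h hN].
  by apply: contraT => /gN/eqP; rewrite ffunE eqxx oner_eq0.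
by rewrite ffunE; case: eqP => // hg; rewrite hg gN in hN.
Qed.

Fact gsupp_subring : subring_closed gsupp.
Proof.
split=> [|x y /gsuppP xN /gsuppP yN|x y /gsuppP xN /gsuppP yN].
- by rewrite -gel1 gsupp_gel.
- by apply/gsuppP=> g gN; rewrite !ffunE xN // yN // subr0.
apply/gsuppP=> g gN; rewrite galgM big1 // => h _.
have [hN|/xN->] := boolP (h \in N); last by rewrite mul0r.
by rewrite yN ?mulr0 // groupMl ?groupV.
Qed.

HB.instance Definition _ := GRing.isSubringClosed.Build A gsupp gsupp_subring.

Definition gproj x : A := [ffun g => if g \in N then x g else 0].

Lemma gproj_supp x : gproj x \in gsupp.
Proof. by apply/gsuppP=> g gN; rewrite ffunE (negPf gN). Qed.

Lemma gproj_id x : x \in gsupp -> gproj x = x.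
Proof. by move/gsuppP=> xN; apply/ffunP=> g; rewrite ffunE; case: ifPn => // /xN. Qed.

Lemma gprojMl x y : x \in gsupp -> gproj (x * y) = x * gproj y.
Proof.
move/gsuppP=> xN; apply/ffunP=> g; rewrite !ffunE.
have [gN|gN] := ifPn.
  apply: eq_bigr => h _; have [hN|/xN->] := boolP (h \in N); last by rewrite !mul0r.
  by rewrite ffunE groupMl ?groupV // gN.
rewrite big1 // => h _; have [hN|/xN->] := boolP (h \in N); last by rewrite !mul0r.
by rewrite ffunE groupMl ?groupV // (negPf gN) mulr0.
Qed.

Lemma gprojMr x y : y \in gsupp -> gproj (x * y) = gproj x * y.
Proof.
move/gsuppP=> yN; apply/ffunP=> g; rewrite !ffunE.
have gh h : (h^-1 * g)%g \in N -> (h \in N) = (g \in N).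
  by move=> hg; rewrite -(groupMr h hg) mulKVg.
have [gN|gN] := ifPn.
  apply: eq_bigr => h _; have [/gh hN|/yN->] := boolP (h^-1 * g \in N)%g; last by rewrite !mulr0.
  by rewrite ffunE hN gN.
rewrite big1 // => h _; have [/gh hN|/yN->] := boolP (h^-1 * g \in N)%g; last by rewrite !mulr0.
by rewrite ffunE hN (negPf gN) mul0r.
Qed.

Hypothesis N_unit : #|N|%:R != 0 :> F.

(* Maschke: averaging over N the generalized inverse of right multiplication
   by x gives an N-linear map, that is, right multiplication by some y. *)
Lemma gsupp_regular x : x \in gsupp -> exists2 y, y \in gsupp & x * y * x = x.
Proof.
move=> xN.
pose phi (a : A) := ungvec (gvec a *m pinvmx (rmx x)).
have phiK a : phi (a * x) * x = a * x.
  apply: (can_inj (@gvecK F gT)); rewrite !(gvecMr, ungvecK).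
  by rewrite -2!mulmxA (mulmxA (rmx x)) mulmxKpV.
have phiP c a b : phi (c *: a + b) = c *: phi a + phi b.
  apply: (can_inj (@gvecK F gT)).
  by rewrite !linearP /= !ungvecK linearP mulmxDl scalemxAl.
have phi0 : phi 0 = 0.
  by apply: (can_inj (@gvecK F gT)); rewrite ungvecK !raddf0 mul0mx.
have phiD a b : phi (a + b) = phi a + phi b.
  by rewrite -[a]scale1r phiP !scale1r.
have phiZ c a : phi (c *: a) = c *: phi a by rewrite -[c *: a]addr0 phiP phi0 addr0.
pose psi a := #|N|%:R^-1 *: \sum_(n in N) gel n^-1 * phi (gel n * a).
have psig m a : m \in N -> psi (gel m * a) = gel m * psi a.
  move=> mN; rewrite /psi -scalerAr; congr (_ *: _).
  rewrite (reindex_inj (mulIg m^-1%g)) /= mulr_sumr.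
  apply: eq_big => [n|n nN]; first by rewrite groupMr ?groupV.
  by rewrite mulrA -gelM mulgKV invMg invgK gelM mulrA.
have psiM a : a \in gsupp -> psi a = a * psi 1.
  move/gsuppP=> aN.
  transitivity (\sum_g a g *: psi (gel g)).
    rewrite {1}[a]galg_sum /psi.
    under [RHS]eq_bigr => g _ do rewrite scalerA mulrC -scalerA.
    rewrite -scaler_sumr; congr (_ *: _).
    under [RHS]eq_bigr => g _ do rewrite scaler_sumr.
    rewrite exchange_big; apply: eq_bigr => n nN /=.
    rewrite mulr_sumr (big_morph phi phiD phi0) mulr_sumr; apply: eq_bigr => g _ /=.
    by rewrite -scalerAr phiZ -scalerAr.
  rewrite {2}[a]galg_sum mulr_suml; apply: eq_bigr => g _.
  have [gN|/aN->] := boolP (g \in N); last by rewrite !scale0r mul0r.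
  by rewrite -{1}[gel g]mulr1 psig // scalerAl.
have psiK : psi x * x = x.
  rewrite -scalerAl mulr_suml (eq_bigr (fun=> x)) => [|n _].
    by rewrite sumr_const -scaler_nat scalerA mulVf // scale1r.
  by rewrite -mulrA phiK mulrA gelVK mul1r.
(* At this point [x * psi 1 * x = x], but [psi 1] may have support outside [N]. The projection
   commutes with left and right multiplication by [x], so projecting the whole identity replaces
   [psi 1] by its part supported on [N]. *)
exists (gproj (psi 1)); first exact: gproj_supp.
by rewrite -gprojMl // -gprojMr // -psiM // psiK gproj_id.
Qed.

End Regular.

Lemma galg_regular (F : fieldType) (gT : finGroupType) (x : galg F gT) :
  [pchar F] =i pred0 -> exists y, x * y * x = x.
Proof.
move=> F0; have cN : #|[set: gT]%G|%:R != 0 :> F.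
  by rewrite ((pcharf0P _).1 F0) // -lt0n cardG_gt0.
have [|y _ yx] := gsupp_regular cN (x := x); last by exists y.
by apply/gsuppP=> g; rewrite inE.
Qed.

(** * Idempotents of group algebras in characteristic l *)

Lemma finite_idempotent (A : finNzRingType) (y : A) :
  exists2 n, (0 < n)%N & y ^+ n * y ^+ n = y ^+ n.
Proof.
have /injectivePn[a [c ac yac]] : ~~ injectiveb (fun i : 'I_#|A|.+1 => y ^+ i).
  apply: contraT => /negbNE/injectiveP/leq_card.
  by rewrite card_ord ltnn.
wlog lt_ac : a c ac yac / (a < c)%N.
  move=> H; have := ac; rewrite neq_ltn => /orP[/(H a c)|/(H c a)]; apply=> //.
  by rewrite eq_sym.
pose d := (c - a)%N; have d0 : (0 < d)%N by rewrite subn_gt0.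
have per1 m : (a <= m)%N -> y ^+ (m + d) = y ^+ m.
  have ad : (a + d = c)%N by apply/subnKC/ltnW.
  by move=> am; rewrite -(subnKC am) addnAC ad !exprD yac.
have per m e : (a <= m)%N -> y ^+ (m + e * d) = y ^+ m.
  move=> am; elim: e => [|e IHe]; first by rewrite addn0.
  by rewrite mulSn addnCA addnC per1 ?IHe // (leq_trans am) // leq_addr.
(* A multiple of the period [d] that is at least the preperiod [a]; taking [a.+1] keeps it positive
   when [a] is 0. *)
exists (a.+1 * d)%N; first by rewrite muln_gt0.
by rewrite -exprD per // (leq_trans (leqnSn a)) // leq_pmulr.
Qed.

Lemma exprD_comm_pchar (A : nzRingType) l n (x y : A) :
  l \in [pchar A] -> GRing.comm x y ->
  (x + y) ^+ (l ^ n) = x ^+ (l ^ n) + y ^+ (l ^ n).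
Proof.
move=> Al xy; elim: n => [|n IHn]; first by rewrite !expr1.
rewrite expnSr !exprM IHn -!(pFrobenius_autE Al) pFrobenius_autD_comm //.
exact/commrX/commr_sym/commrX/commr_sym.
Qed.

(** * Rings generated by a finite field and a semilinear element of order dividing a power of l *)

Section SkewRing.
Variables (l b : nat) (A : finNzRingType) (k : finFieldType).
Variables (j : {rmorphism k -> A}) (I : A -> Prop).
Hypotheses (l_pr : prime l) (l_char : l \in [pchar A]).
Hypotheses (I0 : I 0) (ID : forall x y, I x -> I y -> I (x + y)).
Hypotheses (IMl : forall x y, I y -> I (x * y)).
Hypotheses (IMr : forall x y, I x -> I (x * y)).
Hypothesis I1 : ~ I 1.

Let IB x y : I x -> I y -> I (x - y).
Proof. by move=> Ix Iy; rewrite -mulN1r; apply: ID => //; apply: IMl. Qed.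

(* Dedekind's independence of characters, modulo a left ideal. *)
Lemma dedekind_mod_ideal m (s : nat -> k -> k) (w : nat -> A) :
    (forall i x y, s i (x * y) = s i x * s i y) -> (forall i, s i 1 = 1) ->
    (forall i i', (i < i' < m)%N -> exists x, s i x != s i' x) ->
    (forall x, I (\sum_(i < m) j (s i x) * w i)) ->
  forall i, (i < m)%N -> I (w i).
Proof.
move=> sM s1; elim: m w => // m IHm w dist Iw.
have Iw_lt i : (i < m)%N -> I (w i).
  move=> im; have [|y yP] := dist i m; first by rewrite im ltnS leqnn.
  rewrite -subr_eq0 in yP.
  have -> : w i = j (s i y - s m y)^-1 * (j (s i y - s m y) * w i).
    by rewrite mulrA -rmorphM mulVf // rmorph1 mul1r.
  apply: IMl; move: (i) im => {}i0; apply: (IHm (fun i => j (s i y - s m y) * w i)).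
    by move=> i1 i2 /andP[i12 i2m]; apply: dist; rewrite i12 ltnS ltnW.
  move=> x; have := IB (Iw (x * y)) (IMl (j (s m y)) (Iw x)).
  congr (I _); rewrite mulr_sumr -sumrB big_ord_recr /= [X in _ + X](_ : _ = 0).
    rewrite addr0; apply: eq_bigr => i1 _.
    by rewrite !mulrA -!rmorphM -mulrBl -rmorphB sM mulrBr [s m y * _]mulrC.
  by rewrite mulrA -rmorphM sM mulrC subrr.
move=> i; rewrite ltnS leq_eqVlt => /predU1P[->|]; last exact: Iw_lt.
have := Iw 1; rewrite big_ord_recr /= s1 rmorph1 mul1r => H.
rewrite -[w m](addKr (\sum_(i < m) j (s i 1) * w i)) addrC.
apply: IB => //; elim/big_ind: _ => // i0 _; exact: IMl (Iw_lt _ _).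
Qed.

Variables (v : A) (s : k -> k).
Hypotheses (vj : forall x, v * j x = j (s x) * v) (vL : v ^+ (l ^ b) = 1).
Hypothesis A_gen : forall x : A,
  exists n, exists c : nat -> k, exists m : nat -> nat,
    x = \sum_(i < n) j (c i) * v ^+ m i.

Let Lgt0 : (0 < l ^ b)%N. Proof. by rewrite expn_gt0 prime_gt0. Qed.

Let v_rreg : GRing.rreg v.
Proof.
move=> x y xy; rewrite -[x]mulr1 -[y]mulr1 -vL -(prednK Lgt0) exprS !mulrA.
by rewrite xy.
Qed.

Let v_lreg : GRing.lreg v.
Proof.
move=> x y xy; rewrite -[x]mul1r -[y]mul1r -vL -(prednK Lgt0) exprSr -!mulrA.
by rewrite xy.
Qed.

Let sM x y : s (x * y) = s x * s y.
Proof.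
by apply/(fmorph_inj j)/v_rreg; rewrite -vj !rmorphM mulrA vj -!mulrA vj.
Qed.

Let sD x y : s (x + y) = s x + s y.
Proof.
by apply/(fmorph_inj j)/v_rreg; rewrite -vj !rmorphD mulrDr mulrDl !vj.
Qed.

Let s1 : s 1 = 1.
Proof. by apply/(fmorph_inj j)/v_rreg; rewrite -vj !rmorph1 mulr1 mul1r. Qed.

Let s0 : s 0 = 0.
Proof. by apply/(fmorph_inj j)/v_rreg; rewrite -vj !rmorph0 mulr0 mul0r. Qed.

Let s_inj : injective s.
Proof.
by move=> x y xy; apply/(fmorph_inj j)/v_lreg; rewrite /= !vj xy.
Qed.

Let si i x := iter i s x.
Let siM i x y : si i (x * y) = si i x * si i y.
Proof. by elim: i => //= i IHi; rewrite /si /= -/(si _ _) IHi sM. Qed.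
Let si1 i : si i 1 = 1.
Proof. by elim: i => //= i IHi; rewrite /si /= -/(si _ _) IHi s1. Qed.

Let vXj i x : v ^+ i * j x = j (si i x) * v ^+ i.
Proof.
elim: i => [|i IHi]; first by rewrite mulr1 mul1r.
by rewrite exprS -mulrA IHi mulrA vj -mulrA.
Qed.

Let si_inj i : injective (si i).
Proof. by elim: i => // i IHi x y /s_inj/IHi. Qed.

Let s_fin : exists q, (0 < q)%N && [forall x, si q x == x].
Proof.
exists (l ^ b)%N; rewrite Lgt0; apply/forallP=> x; apply/eqP/(fmorph_inj j).
by have := vXj (l ^ b) x; rewrite vL mulr1 mul1r.
Qed.

Let q := ex_minn s_fin.

Let qP : [/\ (0 < q)%N, forall x, si q x = x &
  forall i i', (i < i' < q)%N -> exists x, si i x != si i' x].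
Proof.
rewrite /q; case: ex_minnP => m /andP[m0 /forallP sm] m_min.
split=> // [x|i i' /andP[ii' i'm]]; first exact/eqP/sm.
apply: contrapT => noX; have := m_min (i' - i)%N; rewrite subn_gt0 ii' /=.
have -> : [forall x, si (i' - i) x == x].
  apply/forallP=> x; apply/eqP; suff: si i (si (i' - i) x) = si i x.
    exact: si_inj.
  rewrite /si -iterD subnKC ?(ltnW ii') //.
  apply/eqP; apply: contraT => xi.
  by case: noX; exists x; rewrite eq_sym.
by move=> /(_ isT); rewrite leqNgt (leq_ltn_trans (leq_subr _ _) i'm).
Qed.

Let nu := v ^+ q - 1.

Let nuC x : GRing.comm nu x.
Proof.
have [_ sq _] := qP.
apply/commr_sym/commrB/commr1; have [n [c [m ->]]] := A_gen x.
apply/commr_sym/commr_sum => i _; apply: commrM.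
  by rewrite /GRing.comm vXj sq.
exact/commrX/commr_sym/commrX.
Qed.

Let nuL : nu ^+ (l ^ b) = 0.
Proof.
have : (nu + 1) ^+ (l ^ b) = nu ^+ (l ^ b) + 1 ^+ (l ^ b).
  by apply: exprD_comm_pchar => //; apply: commr1.
rewrite subrK exprAC vL !expr1n => /(congr1 (fun x => x - 1)).
by rewrite addrK subrr.
Qed.

Let x0 := \sum_(i < q) v ^+ i.
Let tr x := \sum_(i < q) si i x.

(** Since [nu] is central, [nu * A] is a two-sided ideal and this is congruence modulo it. There
    [v ^+ q] becomes 1, and [A] behaves like a skew group ring of the cyclic group generated by
    [s]. *)
Let mods x y := exists z, x = y + nu * z.

Let mods_refl x : mods x x.
Proof. by exists 0; rewrite mulr0 addr0. Qed.

Let modsD x y x' y' : mods x y -> mods x' y' -> mods (x + x') (y + y').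
Proof. by move=> [z ->] [z' ->]; exists (z + z'); rewrite mulrDr addrACA. Qed.

Let mods_trans y x z : mods x y -> mods y z -> mods x z.
Proof. by move=> [a ->] [c ->]; exists (c + a); rewrite mulrDr addrA. Qed.

Let modsMl a x y : mods x y -> mods (a * x) (a * y).
Proof.
by move=> [z ->]; exists (a * z); rewrite mulrDr !mulrA nuC.
Qed.

Let modsMr a x y : mods x y -> mods (x * a) (y * a).
Proof. by move=> [z ->]; exists (z * a); rewrite mulrDl !mulrA. Qed.

Let modsM x y x' y' : mods x y -> mods x' y' -> mods (x * x') (y * y').
Proof. by move=> xy xy'; apply: mods_trans (modsMr _ xy) (modsMl _ xy'). Qed.

Let mods_sum m (F G : 'I_m -> A) : (forall i, mods (F i) (G i)) ->
  mods (\sum_(i < m) F i) (\sum_(i < m) G i).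
Proof.
by move=> FG; elim/big_rec2: _ => [|i x y _]; [apply: mods_refl | apply: modsD].
Qed.

Let tr_fix x : s (tr x) = tr x.
Proof.
have [q0 sq _] := qP.
rewrite (big_morph s sD s0) /tr; case: (q) q0 sq => // m _ sm.
by rewrite [RHS]big_ord_recl big_ord_recr /= addrC; congr (_ + _); apply: sm.
Qed.

Let vx0 i : mods (v ^+ i * x0) x0.
Proof.
elim: i => [|i IHi]; first by rewrite mul1r; apply: mods_refl.
(* The difference [v * x0 - x0] telescopes to [v ^+ q - 1], which is [nu * 1]. *)
rewrite exprS -mulrA; apply: mods_trans (modsMl v IHi) _; exists 1.
have [q0 _ _] := qP; rewrite /x0 /nu; case: (q) q0 => // m _.
rewrite mulr_sumr big_ord_recr [in RHS]big_ord_recl /= mulr1 -exprS.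
rewrite expr0 [1 + _]addrC -addrA [1 + _]addrC subrK.
by congr (_ + _); apply: eq_bigr => i0 _; rewrite -exprS.
Qed.

(** Moving [v ^+ i] across [j x] turns [x] into [si i x], after which the right factor [x0] absorbs
    [v ^+ i]. With [tr al = 1] this makes [j al * x0] idempotent modulo [nu]. *)
Let x0jx0 x : mods (x0 * j x * x0) (j (tr x) * x0).
Proof.
rewrite {1}/x0 rmorph_sum !mulr_suml; apply: mods_sum => i.
by rewrite vXj -mulrA; apply/modsMl/vx0.
Qed.

(** The maps [si i] with [i < q] are distinct characters, so by Dedekind's argument with all weights
    equal to 1 a vanishing trace would put 1 in [I]. The trace is linear over the fixed points of
    [s] and takes its values there, so a nonzero value can be scaled to 1. *)
Let tr1 : exists x, tr x = 1.
Proof.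
have [x xP] : exists x, tr x != 0.
  apply: contrapT => tr0; have [q0 _ dist] := qP; apply: I1.
  apply: (dedekind_mod_ideal (w := fun=> 1) siM si1 dist _ q0) => x.
  rewrite -mulr_suml mulr1 -rmorph_sum -/(tr x).
  have -> : tr x = 0 by apply/eqP; apply: contraT => xP; case: tr0; exists x.
  by rewrite rmorph0.
exists ((tr x)^-1 * x); rewrite -(mulVf xP) [in RHS]mulr_sumr.
apply: eq_bigr => i _; rewrite siM; congr (_ * _).
apply: (mulIf xP); rewrite [RHS](mulVf xP).
have {2}-> : tr x = si i (tr x) by elim: (nat_of_ord i) => //= m; rewrite /si /= -/(si _ _) => <-.
by rewrite -siM mulVf // si1.
Qed.

Let x0_central_fix x : s x = x -> GRing.comm (j x) x0.
Proof.
move=> sx; apply: commr_sum => i _; apply: commr_sym.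
rewrite /GRing.comm vXj; congr (j _ * _).
by elim: (nat_of_ord i) => //= m; rewrite /si /= -/(si _ _) => ->.
Qed.

Let mods_sym x y : mods x y -> mods y x.
Proof. by move=> [z ->]; exists (- z); rewrite mulrN addrK. Qed.

Let l_k : l \in [pchar k].
Proof. by rewrite -(fmorph_pchar j). Qed.

Let k0_gen : exists2 t, s t = t &
  forall x, s x = x -> x != 0 -> exists i, x = t ^+ i.
Proof.
pose G := [set x : {unit k} | s (val x) == val x].
have G_group : group_set G.
  apply/group_setP; split=> [|x y]; first by rewrite inE /= s1.
  by rewrite !inE /= sM => /eqP-> /eqP->.
have /cyclicP[t Gt] := field_unit_group_cyclic (Group G_group).
exists (val t).
  by have := cycle_id t; rewrite -Gt inE => /eqP.
move=> x sx x0'; have ux : x \is a GRing.unit by rewrite unitfE.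
have : FinRing.Unit ux \in Group G_group by rewrite inE /= sx.
rewrite Gt => /cycleP[i xt]; exists i.
by rewrite -[x]/(val (FinRing.Unit ux)) xt FinRing.val_unitX.
Qed.

(** Frobenius permutes [k], so some iterate fixes [t]. The exponent is taken large enough for the
    same power to annihilate [nu] as well. *)
Let frob_fix (t : k) : exists2 M, (b <= M)%N & t ^+ (l ^ M) = t.
Proof.
pose F (x : k) := x ^+ l; have F_inj : injective F.
  move=> x y; rewrite /F -!(pFrobenius_autE l_k); exact: fmorph_inj.
have Fi m x : iter m F x = x ^+ (l ^ m).
  by elim: m => //= m ->; rewrite /F -exprM -expnSr.
exists (fingraph.order F t * b.+1)%N.
  by rewrite (leq_trans (leqnSn b)) // leq_pmull // fingraph.order_gt0.
rewrite -Fi mulnC; elim: b.+1 => //= m IHm.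
by rewrite mulSn iterD IHm fingraph.iter_order.
Qed.

(* With q the order of s, nu = v ^+ q - 1 is central and nilpotent.  If al has
   trace 1, then y = j al * x0, where x0 is the sum of the v ^+ i for i < q, is
   idempotent modulo nu, so f is found among its powers. *)
Lemma skew_good_idempotent : exists f gam : A, [/\ f * f = f, ~ I f,
    gam * f = f * gam &
    forall x, exists n, exists c : nat -> int,
      f * x * f = \sum_(i < n) (gam ^+ i * f) *~ c i].
Proof.
have [al tr_al] := tr1.
pose y := j al * x0.
have yy : mods (y * y) y.
  rewrite /y mulrA -!mulrA; apply: modsMl; rewrite mulrA.
  by have := x0jx0 al; rewrite tr_al rmorph1 mul1r.
have [n n0 fid] := finite_idempotent y; pose f := y ^+ n.
have f_y : mods f y.
  rewrite /f -(prednK n0); elim: n.-1 => [|m IHm]; first exact: mods_refl.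
  by rewrite exprS; apply: mods_trans (modsMl _ IHm) _.
have fC x : s x = x -> GRing.comm (j x) f.
  move=> sx; apply/commrX/commrM; last exact: x0_central_fix.
  by rewrite /GRing.comm -!rmorphM mulrC.
have [t st t_gen] := k0_gen.
have [M bM tM] := frob_fix t.
(* This plays the part of a Jordan decomposition: the power [l ^ M] removes the nilpotent part [nu]
   and fixes [t], so [j t], and then [nu], are integer polynomials in [gam]. As the nonzero fixed
   points of [s] are powers of [t], these polynomials also contain the image of the fixed field. *)
pose gam := j t + nu.
have gf : gam * f = f * gam.
  by rewrite mulrDl mulrDr fC // nuC.
have gM : gam ^+ (l ^ M) = j t.
  rewrite exprD_comm_pchar //; last exact/commr_sym/nuC.
  by rewrite -rmorphXn tM -(subnKC bM) expnD exprM nuL expr0n expn_eq0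
    (gtn_eqF (prime_gt0 l_pr)) addr0.
(* Reduction modulo [nu] could make [I] the unit ideal, so [f] is tested against the last power
   [nu ^+ m] outside [I]: once multiplied by it, a congruence modulo [nu] becomes a congruence
   modulo [I]. Dedekind's argument, with weights [v ^+ i * nu ^+ m], then supplies a product
   involving [x0] that is outside [I]. *)
have nI : ~ I f.
  have exI : exists m, `[< I (nu ^+ m) >].
    by exists (l ^ b)%N; apply/asboolP; rewrite nuL.
  case: (ex_minnP exI) => -[|m] /asboolP Im m_min; first by case: I1.
  have nIm : ~ I (nu ^+ m).
    by move=> /asboolP/m_min; rewrite ltnn.
  have [be be_nI] : exists be, ~ I (x0 * j be * nu ^+ m).
    apply: contrapT => allI; have [q0 _ dist] := qP; apply: nIm.
    have := dedekind_mod_ideal (w := fun i => v ^+ i * nu ^+ m) siM si1 dist _ q0.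
    rewrite mul1r; apply=> x; apply: contrapT => nIx; case: allI; exists x.
    move=> Ix; apply: nIx; move: Ix; congr (I _).
    rewrite !mulr_suml; apply: eq_bigr => i _.
    by rewrite vXj mulrA.
  have al0 : al != 0.
    apply/eqP=> al0; move: tr_al; rewrite al0 /tr big1 => [/esym/eqP|i _].
      by rewrite oner_eq0.
    by elim: (nat_of_ord i) => //= i' IH; rewrite /si /= -/(si _ _) IH s0.
  move=> If; apply: be_nI; have [z fz] := mods_sym f_y.
  suff Iy : I (y * (j be * nu ^+ m)).
    have := IMl (j al^-1) Iy; congr (I _).
    by rewrite /y -!mulrA mulrA -rmorphM mulVf // rmorph1 mul1r.
  rewrite fz mulrDl; apply: ID; first exact: IMr.
  rewrite nuC -mulrA; apply: IMl; rewrite mulrA nuC -mulrA -exprS.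
  exact: IMl.
(* Modulo [nu], the product [y * x * y] is [y] times a sum of traces, so the corner of [f] reduces
   to the fixed field of [s]. *)
have step x : exists2 ka, s ka = ka & exists z,
    f * x * f = j ka * f + nu * (f * z * f).
  have [m [c [r xE]]] := A_gen x.
  pose ka := \sum_(i < m) tr (c i * si (r i) al).
  have ska : s ka = ka.
    by rewrite (big_morph s sD s0); apply: eq_bigr => i _; apply: tr_fix.
  have yxy : mods (y * x * y) (j ka * y).
    rewrite xE mulr_sumr mulr_suml rmorph_sum mulr_suml; apply: mods_sum => i.
    have -> : y * (j (c i) * v ^+ r i) * y =
        j al * (x0 * j (c i * si (r i) al) * (v ^+ r i * x0)).
      by rewrite rmorphM /y !mulrA -(mulrA _ (v ^+ r i)) vXj !mulrA.
    have -> : j (tr (c i * si (r i) al)) * y = j al * (j (tr (c i * si (r i) al)) * x0).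
      by rewrite /y !mulrA -!rmorphM mulrC.
    by apply: modsMl; apply: mods_trans (modsMl _ (vx0 (r i))) (x0jx0 _).
  have [z zP] : mods (f * x * f) (j ka * f).
    apply: mods_trans (modsM (modsMr x f_y) f_y) (mods_trans yxy _).
    exact/modsMl/mods_sym.
  exists ka => //; exists z.
  have := congr1 (fun u => f * u * f) zP; rewrite mulrDr mulrDl.
  rewrite !mulrA fid -!mulrA fid !mulrA => ->.
  by rewrite -(fC _ ska) -!mulrA fid nuC !mulrA -nuC !mulrA.
(* Expansion of a corner element in powers of [nu], with digits fixed by [s]; nilpotency of [nu]
   makes the remainder vanish at [m = l ^ b]. *)
have steps m x : exists2 ka : nat -> k, forall i, s (ka i) = ka i & exists z,
    f * x * f = \sum_(i < m) j (ka i) * nu ^+ i * f + nu ^+ m * (f * z * f).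
  elim: m => [|m [ka ska [z IHm]]].
    by exists (fun=> 0) => //; exists x; rewrite big_ord0 add0r mul1r.
  have [ka' ska' [z' zz']] := step z.
  exists (fun i => if i == m then ka' else ka i) => [i|]; first by case: ifP.
  exists z'; rewrite IHm zz' big_ord_recr /= eqxx mulrDr addrA; congr (_ + _ + _).
  - by apply: eq_bigr => i _; rewrite (ltn_eqF (ltn_ord i)).
  - by rewrite mulrA; congr (_ * _); apply/commr_sym/commrX/commr_sym/nuC.
  - by rewrite mulrA -exprSr.
exists f, gam; split=> // x.
have [ka ska [z ->]] := steps (l ^ b)%N x.
rewrite nuL mul0r addr0.
have cg : commr_rmorph intr gam by move=> m; rewrite /GRing.comm mulrzl mulrzr.
pose hm : {rmorphism {poly int} -> A} := horner_morph cg.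
pose Z a := exists P, a = hm P.
have ZD a c : Z a -> Z c -> Z (a + c).
  by move=> [P ->] [Q ->]; exists (P + Q); rewrite rmorphD.
have ZM a c : Z a -> Z c -> Z (a * c).
  by move=> [P ->] [Q ->]; exists (P * Q); rewrite rmorphM.
have Z0 : Z 0 by exists 0; rewrite rmorph0.
have ZX a m : Z a -> Z (a ^+ m).
  by move=> [P ->]; exists (P ^+ m); rewrite rmorphXn.
have Zg : Z gam by exists 'X; rewrite /hm /= horner_morphX.
have Zt : Z (j t) by rewrite -gM; apply: ZX.
have Znu : Z nu.
  have [P jt] := Zt; have [Q gQ] := Zg; exists (Q - P).
  by rewrite rmorphB -jt -gQ /gam addrC addKr.
have [P ->] : exists P, \sum_(i < l ^ b) j (ka i) * nu ^+ i * f = hm P * f.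
  rewrite -mulr_suml; suff [P ->] : Z (\sum_(i < l ^ b) j (ka i) * nu ^+ i) by exists P.
  elim/big_ind: _ => // i _; apply: ZM; last exact: ZX.
  have [->|/(t_gen _ (ska i))[m ->]] := eqVneq (ka i) 0; first by rewrite rmorph0.
  by rewrite rmorphXn; apply: ZX.
exists (size P), (fun i => P`_i).
rewrite /hm /= /horner_morph (horner_coef_wide _ (size_poly _ _)) mulr_suml.
by apply: eq_bigr => i _; rewrite coef_map /= -[RHS]mulrzl mulrA.
Qed.

End SkewRing.

(* As k is perfect, c has an l ^ b-th root d, which s fixes; replacing u by
   j d^-1 * u reduces to c = 1. *)
Lemma crossed_good_idempotent (l b : nat) (A : finNzRingType) (k : finFieldType)
    (j : {rmorphism k -> A}) (I : A -> Prop) (u : A) (s : k -> k) (c : k) :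
    prime l -> l \in [pchar A] ->
    I 0 -> (forall x y, I x -> I y -> I (x + y)) ->
    (forall x y, I y -> I (x * y)) -> (forall x y, I x -> I (x * y)) -> ~ I 1 ->
    (forall x, u * j x = j (s x) * u) -> u ^+ (l ^ b) = j c -> c != 0 ->
    (forall x : A, exists n, exists d : nat -> k, exists m : nat -> nat,
       x = \sum_(i < n) j (d i) * u ^+ m i) ->
  exists f gam : A, [/\ f * f = f, ~ I f, gam * f = f * gam &
    forall x, exists n, exists d : nat -> int,
      f * x * f = \sum_(i < n) (gam ^+ i * f) *~ d i].
Proof.
move=> l_pr l_A I0 ID IMl IMr I1 uj uL c0 A_gen.
have l_k : l \in [pchar k] by rewrite -(fmorph_pchar j).
have L0 : (0 < l ^ b)%N by rewrite expn_gt0 prime_gt0.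
pose F (x : k) := x ^+ (l ^ b); have F_inj : injective F.
  rewrite /F; elim: (b) => [|m IHm] x y; first by rewrite !expr1.
  by rewrite expnS !exprM -!(pFrobenius_autE l_k) => /IHm/fmorph_inj.
have [d Fd] : exists d, F d = c by exists (invF F_inj c); rewrite f_invF.
have d0 : d != 0.
  by apply: contra_neq c0 => d0; rewrite -Fd d0 /F expr0n gtn_eqF.
have uc : GRing.comm u (j c) by rewrite -uL; apply/commrX.
have jc0 : j c * j c^-1 = 1 by rewrite -rmorphM mulfV // rmorph1.
have u_rreg : GRing.rreg u.
  move=> x y xy; suff : x * u ^+ (l ^ b) = y * u ^+ (l ^ b).
    by rewrite uL => /(congr1 (fun z => z * j c^-1)); rewrite -!mulrA jc0 !mulr1.
  by rewrite -(prednK L0) exprS !mulrA xy.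
have sM x y : s (x * y) = s x * s y.
  by apply/(fmorph_inj j)/u_rreg; rewrite -uj !rmorphM mulrA uj -!mulrA uj.
have s1 : s 1 = 1.
  by apply/(fmorph_inj j)/u_rreg; rewrite -uj !rmorph1 mulr1 mul1r.
have sX x n : s (x ^+ n) = s x ^+ n.
  by elim: n => [|n IHn]; rewrite ?s1 // !exprS sM IHn.
have sc : s c = c by apply/(fmorph_inj j)/u_rreg; rewrite -uj uc.
have sd : s d = d by apply: F_inj; rewrite /F -sX -/(F d) Fd sc.
have ud : GRing.comm u (j d) by rewrite /GRing.comm uj sd.
have jd : j d * j d^-1 = 1 by rewrite -rmorphM mulfV // rmorph1.
pose v := j d^-1 * u.
have udV : GRing.comm (j d^-1) u.
  rewrite /GRing.comm uj; congr (j _ * _); apply: (mulIf d0).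
  by rewrite mulVf // -[X in _ * X]sd -sM mulVf // s1.
have vX n : v ^+ n = j (d ^- n) * u ^+ n.
  by rewrite /v exprMn_comm // -rmorphXn exprVn.
apply: (@skew_good_idempotent l b A k j I l_pr l_A I0 ID IMl IMr I1 v s).
- by move=> x; rewrite /v -mulrA uj !mulrA -!rmorphM mulrC.
- by rewrite vX uL -rmorphM -/(F d) Fd mulVf // rmorph1.
move=> x; have [n [e [m ->]]] := A_gen x; exists n, (fun i => e i * d ^+ m i), m.
apply: eq_bigr => i _; rewrite vX mulrA -rmorphM -mulrA mulfV ?mulr1 //.
by rewrite expf_neq0.
Qed.

(** If [z] is a right inverse of [x], a right inverse of [z] can only be [x], so inverses are
    two-sided and there are no zero divisors. Wedderburn's little theorem, contained in
    [FinDomainFieldType], gives commutativity. *)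
Lemma finite_division_ring (D : finNzRingType) :
    (forall x : D, x != 0 -> exists y, x * y = 1) ->
  exists (k : finFieldType) (j : {rmorphism k -> D}), bijective j.
Proof.
move=> Dinv.
pose U : finUnitRingType := HB.pack D (FinRing.isNzRing.Build D).
have dom : GRing.integral_domain_axiom U.
  move=> x y xy; have [//|x0] := eqVneq x 0; apply/eqP.
  have [z xz] := Dinv x x0.
  have z0 : z != 0 by apply: contra_eq_neq xz => ->; rewrite mulr0 eq_sym oner_eq0.
  have [w zw] := Dinv z z0.
  have wx : w = x by rewrite -[w]mul1r -xz -mulrA zw mulr1.
  by rewrite -[y]mul1r -zw wx -mulrA; rewrite [_ * y]xy mulr0.
pose k := FinDomainFieldType dom.
pose f (x : k) : D := x.
have fB : zmod_morphism f by [].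
have fM : monoid_morphism f by [].
pose j : {rmorphism k -> D} := HB.pack f (GRing.isZmodMorphism.Build _ _ f fB)
   (GRing.isMonoidMorphism.Build _ _ f fM).
by exists k, j; exists (fun x : D => x : k).
Qed.

Section Corner.
Variables (B : finNzRingType) (A : subringClosed B) (e : B).

Definition corner_pred : {pred B} :=
  fun x => [&& x \in A, e * x == x & x * e == x].

(** The proofs are parameters of the type because the ring instance attached to it needs them: [e]
    must lie in the corner to be its unit, and must differ from 0. *)
Definition corner (eA : e \in A) (ee : e * e == e) (e0 : e != 0) : Type :=
  {x : B | corner_pred x}.

Variables (eA : e \in A) (ee : e * e == e) (e0 : e != 0).
Local Notation C := (corner eA ee e0).

HB.instance Definition _ := SubFinite.copy C {x : B | corner_pred x}.

Fact corner_zmod_closed : zmod_closed corner_pred.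
Proof.
split=> [|x y /and3P[xA /eqP ex /eqP xe] /and3P[yA /eqP ey /eqP ye]].
  by apply/and3P; rewrite rpred0 mulr0 mul0r.
by apply/and3P; rewrite rpredB // mulrBr mulrBl ex ey xe ye.
Qed.

HB.instance Definition _ := GRing.isZmodClosed.Build B corner_pred
  corner_zmod_closed.
HB.instance Definition _ := [SubChoice_isSubZmodule of C by <:].

Lemma cornerP (x : C) : [/\ val x \in A, e * val x = val x & val x * e = val x].
Proof. by have /and3P[? /eqP ? /eqP ?] := valP x. Qed.

Fact corner_1 : corner_pred e. Proof. by apply/and3P. Qed.
Fact corner_M (x y : C) : corner_pred (val x * val y).
Proof.
have [xA ex xe] := cornerP x; have [yA ey ye] := cornerP y.
by apply/and3P; rewrite rpredM // mulrA ex -mulrA ye.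
Qed.

Definition corner_one : C := Sub e corner_1.
Definition corner_mul (x y : C) : C := Sub (val x * val y) (corner_M x y).

Fact corner_mulA : associative corner_mul.
Proof. by move=> x y z; apply: val_inj; rewrite /= mulrA. Qed.
Fact corner_mul1 : left_id corner_one corner_mul.
Proof. by move=> x; apply: val_inj => /=; have [] := cornerP x. Qed.
Fact corner_mulr1 : right_id corner_one corner_mul.
Proof. by move=> x; apply: val_inj => /=; have [] := cornerP x. Qed.
Fact corner_mulDl : left_distributive corner_mul +%R.
Proof. by move=> x y z; apply: val_inj; exact: mulrDl. Qed.
Fact corner_mulDr : right_distributive corner_mul +%R.
Proof. by move=> x y z; apply: val_inj; exact: mulrDr. Qed.
Fact corner_1neq0 : corner_one != 0.
Proof. by rewrite -val_eqE. Qed.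

HB.instance Definition _ := GRing.Zmodule_isNzRing.Build C
  corner_mulA corner_mul1 corner_mulr1 corner_mulDl corner_mulDr corner_1neq0.

End Corner.

(** The embedding sends 1 to [e], so it is not a morphism of unital rings; additivity and
    multiplicativity are therefore given separately. *)
Lemma corner_ring (B : finNzRingType) (A : subringClosed B) (e : B) :
    e \in A -> e * e = e -> e != 0 ->
  exists (G : finNzRingType) (w : {additive G -> B}),
    [/\ injective w, w 1 = e, {morph w : x y / x * y}, forall x, w x \in A &
        forall x, x \in A -> e * x = x -> x * e = x -> exists y, w y = x].
Proof.
move=> eA /eqP ee e0; exists (corner eA ee e0), val.
split=> // [|x|x xA ex xe]; first exact: val_inj; first by have [] := cornerP x.
have xC : corner_pred A e x by apply/and3P; rewrite xA ex xe.
by exists (Sub x xC).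
Qed.

(** The whole ring seen as a subring, so that [corner_ring] yields e B e as well as e A e. *)
Definition full_pred (B : nzRingType) : {pred B} := fun=> true.
HB.instance Definition _ (B : nzRingType) :=
  GRing.isSubringClosed.Build B (@full_pred B)
    (And3 (erefl true) (fun _ _ _ _ => erefl true) (fun _ _ _ _ => erefl true)).

(** * Extensions of a regular finite ring by a cyclic l-group *)

Section CyclicExtension.
Variables (B : finNzRingType) (A : subringClosed B) (l b : nat) (t t' : B).
Variable I : B -> Prop.
Hypotheses (l_pr : prime l) (l_B : l \in [pchar B]).
Hypothesis A_regular : forall x, x \in A -> exists2 y, y \in A & x * y * x = x.
Hypotheses (tt' : t * t' = 1) (t't : t' * t = 1).
Hypothesis tA : forall a, a \in A -> t * a * t' \in A.
Hypothesis t'A : forall a, a \in A -> t' * a * t \in A.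
Hypotheses (tL : t ^+ (l ^ b) \in A) (t'L : t' ^+ (l ^ b) \in A).
Hypothesis B_gen : forall x : B, exists n, exists2 a : nat -> B,
  forall i, a i \in A & x = \sum_(i < n) a i * t ^+ i.
Hypotheses (I0 : I 0) (ID : forall x y, I x -> I y -> I (x + y)).
Hypotheses (IMl : forall x y, I y -> I (x * y)).
Hypotheses (IMr : forall x y, I x -> I (x * y)).
Hypothesis I1 : ~ I 1.

Let L := (l ^ b)%N.
Let L0 : (0 < L)%N. Proof. by rewrite expn_gt0 prime_gt0. Qed.

Let tX i : t ^+ i * t' ^+ i = 1.
Proof.
elim: i => [|i IHi]; first by rewrite mulr1.
by rewrite exprSr exprS -mulrA (mulrA t) tt' mul1r.
Qed.

Let t'X i : t' ^+ i * t ^+ i = 1.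
Proof.
elim: i => [|i IHi]; first by rewrite mulr1.
by rewrite exprSr exprS -mulrA (mulrA t') t't mul1r.
Qed.

Let tAX i a : a \in A -> t ^+ i * a * t' ^+ i \in A.
Proof.
elim: i a => [|i IHi] a aA; first by rewrite mulr1 mul1r.
by have := IHi _ (tA aA); rewrite exprSr exprS !mulrA.
Qed.

Let t'AX i a : a \in A -> t' ^+ i * a * t ^+ i \in A.
Proof.
elim: i a => [|i IHi] a aA; first by rewrite mulr1 mul1r.
by have := IHi _ (t'A aA); rewrite exprSr exprS !mulrA.
Qed.

(** The corner e A e is taken of least cardinality among idempotents outside [I]. An idempotent [z]
    below [e] and outside [I] is then [e] itself; if [z] lies in [I], then [e - z] does not, so
    [e - z = e] and [z = 0]. *)
Let minimal_idempotent : exists e, [/\ e \in A, e * e = e, ~ I e &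
  forall z, z \in A -> z * z = z -> e * z = z -> z * e = z -> z != 0 -> z = e].
Proof.
pose S e := [pred x : B | (x \in A) && (e * x * e == x)].
pose P m := `[< exists e, [/\ e \in A, e * e = e, ~ I e & #|S e| = m] >].
have exP : exists m, P m.
  exists #|S 1|; apply/asboolP; exists 1.
  by rewrite rpred1 mulr1.
case: (ex_minnP exP) => m /asboolP[e [eA ee nIe <-]] m_min.
exists e; split=> // z zA zz ez ze z0.
have small f : f \in A -> f * f = f -> e * f = f -> f * e = f -> ~ I f -> f = e.
  move=> fA ff ef fe nIf.
  have Sfe : S f \subset S e.
    apply/subsetP=> x; rewrite !inE => /andP[-> /eqP fx] /=.
    by rewrite -fx !mulrA ef -!mulrA fe !mulrA.
  have : e \in S f.
    apply: contraT => eSf; have /proper_card : S f \proper S e.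
      by apply/properP; split=> //; exists e => //; rewrite inE eA /= !ee.
    by rewrite ltnNge m_min //; apply/asboolP; exists f.
  by rewrite inE eA /= fe ff => /eqP.
have [Iz|nIz] := pselect (I z); last exact: small.
suff ez_e : e - z = e.
  by case/eqP: z0; apply/eqP; rewrite -oppr_eq0 -(inj_eq (addrI e)) ez_e addr0.
apply: small; first exact: rpredB.
- by rewrite mulrBr !mulrBl ee ez ze zz subrr subr0.
- by rewrite mulrBr ee ez.
- by rewrite mulrBl ee ze.
by move=> Iez; apply: nIe; rewrite -(subrK z e); apply: ID.
Qed.

(* Let e be a minimal idempotent of A outside I.  Nonzero homogeneous elements of
   e B e, graded by the degree in t, are invertible; hence e A e is a finite field
   k, and e B e is spanned over k by the powers of one element u of minimal
   positive degree. *)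
Lemma cyclic_ext_good_idempotent : exists f gam : B, [/\ f * f = f, ~ I f,
    gam * f = f * gam &
    forall x, exists n, exists c : nat -> int,
      f * x * f = \sum_(i < n) (gam ^+ i * f) *~ c i].
Proof.
have [e [eA ee nIe e_min]] := minimal_idempotent.
have e0 : e != 0 by apply/eqP=> e0; apply: nIe; rewrite e0.
(* Regularity makes [x * y] a nonzero idempotent below [e], and minimality identifies it with
   [e]. *)
have Ainv x : x \in A -> e * x = x -> x * e = x -> x != 0 ->
    exists y, [/\ y \in A, e * y = y, y * e = y & x * y = e].
  move=> xA ex xe x0; have [y0 y0A xyx] := A_regular xA.
  pose y := e * y0 * e; have yA : y \in A by rewrite !rpredM.
  have xy : x * y * x = x by rewrite /y !mulrA xe -!mulrA ex !mulrA xyx.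
  have ey : e * y = y by rewrite /y !mulrA ee.
  have ye : y * e = y by rewrite /y -!mulrA ee.
  clearbody y; exists y; split=> //; apply: e_min; rewrite ?rpredM //.
  - by rewrite mulrA xy.
  - by rewrite mulrA ex.
  - by rewrite -mulrA ye.
  - by apply: contra_neq x0 => xy0; rewrite -xy xy0 mul0r.
(* Degrees are natural numbers that matter only modulo [L], since [t ^+ L] and its inverse lie in
   [A]. An inverse of an element of degree [i] is accordingly given the degree [L.-1 * i]. *)
pose hom i x := [/\ e * x = x, x * e = x & exists2 a, a \in A & x = a * t ^+ i].
have homM i i' x x' : hom i x -> hom i' x' -> hom (i + i')%N (x * x').
  move=> [ex xe [a aA xa]] [ex' xe' [a' aA' xa']].
  split; rewrite ?mulrA ?ex // -?mulrA ?xe' //.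
  exists (a * (t ^+ i * a' * t' ^+ i)); first by rewrite rpredM // tAX.
  by rewrite xa xa' exprD -!mulrA (mulrA (t' ^+ i)) t'X mul1r.
have homL i m x : hom (i + L * m)%N x -> hom i x.
  move=> [ex xe [a aA xa]]; split=> //; exists (a * t ^+ (L * m)).
    by rewrite rpredM // exprM rpredX.
  by rewrite xa addnC exprD mulrA.
have hom_gen i a : a \in A -> hom i (e * (a * t ^+ i) * e).
  move=> aA; split; rewrite ?mulrA ?ee // -?mulrA ?ee //.
  exists (e * a * (t ^+ i * e * t' ^+ i)).
    by apply: rpredM; [exact: rpredM | exact: tAX].
  by rewrite -!mulrA t'X mulr1.
have hom0 x : hom 0 x -> [/\ x \in A, e * x = x & x * e = x].
  by move=> [ex xe [a aA xa]]; split=> //; rewrite xa mulr1.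
have rinv i x : hom i x -> x != 0 -> exists2 y, hom (L.-1 * i)%N y & x * y = e.
  move=> [ex xe [a aA xa]] x0.
  have ea : e * a = a.
    by move: ex; rewrite xa mulrA => /(congr1 (fun z => z * t' ^+ i)); rewrite -!mulrA tX !mulr1.
  have [c cA aca] := A_regular aA.
  have [||| |y [yA ey ye acey]] := Ainv (a * c * e).
  - by rewrite !rpredM.
  - by rewrite !mulrA ea.
  - by rewrite -mulrA ee.
  - apply: contra_neq x0 => ace0; rewrite xa -aca -[X in _ * X * _]ea !mulrA ace0.
    by rewrite !mul0r.
  pose z := e * (t' ^+ i * (c * e * y)); exists z.
    have -> : z = e * ((t' ^+ i * (c * e * y) * t ^+ i * t' ^+ (L * i)) * t ^+ (L.-1 * i)) * e.
      have -> : (L * i = i + L.-1 * i)%N by rewrite -{1}(prednK L0) mulSn.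
      rewrite exprD -!mulrA (mulrA (t' ^+ (L.-1 * i))) t'X mul1r.
      by rewrite (mulrA (t ^+ i)) tX mul1r ye /z !mulrA.
    apply: hom_gen; rewrite rpredM //; last by rewrite exprM rpredX.
    by rewrite t'AX // !rpredM.
  rewrite /z mulrA xe xa -mulrA (mulrA (t ^+ i)) tX mul1r.
  by rewrite !mulrA.
have homX i x m : hom i x -> hom (m * i)%N (e * x ^+ m).
  move=> hx; elim: m => [|m IHm].
    by rewrite mulr1; split; rewrite ?ee //; exists e; rewrite ?mulr1.
  by rewrite exprSr mulrA mulSn addnC; apply: homM.
have [i0 [i0_gt0 [u hu u0] i0_min]] : exists i0, [/\ (0 < i0)%N,
    exists2 u, hom i0 u & u != 0 &
    forall i x, (0 < i)%N -> hom i x -> x != 0 -> (i0 <= i)%N].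
  pose P i := (0 < i)%N && `[< exists2 u, hom i u & u != 0 >].
  have exP : exists i, P i.
    (* The idempotent [e] itself is homogeneous of degree [L], so a positive degree does occur. *)
    exists L; rewrite /P L0; apply/asboolP; exists e => //.
    by split=> //; exists (e * t' ^+ L); rewrite ?rpredM // -mulrA t'X mulr1.
  case: (ex_minnP exP) => i0 /andP[i0_gt0 /asboolP hu0] i0_min.
  exists i0; split=> // i x i_gt0 hx x0; apply: i0_min.
  by rewrite /P i_gt0; apply/asboolP; exists x.
have [u' hu' uu'] := rinv _ _ hu u0.
have [eu ue _] := hu; have [eu' u'e _] := hu'.
have u'0 : u' != 0 by apply: contra_neq e0 => u'0; rewrite -uu' u'0 mulr0.
have u'u : u' * u = e.
  have [w [ew we _] u'w] := rinv _ _ hu' u'0.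
  by rewrite -[u in LHS]ue -u'w (mulrA u) uu' ew u'w.
have [D [w [w_inj w1 wM wA w_surj]]] := corner_ring eA ee e0.
have wl x : e * w x = w x by rewrite -w1 -wM mul1r.
have wr x : w x * e = w x by rewrite -w1 -wM mulr1.
have [k [j0 [g j0K gK]]] : exists (k : finFieldType)
    (j0 : {rmorphism k -> D}), bijective j0.
  apply: finite_division_ring => x x0.
  have [||||y [yA ey ye xy]] := Ainv (w x) => //.
    by apply: contra_neq x0 => x0; apply: w_inj; rewrite x0 raddf0.
  have [z wz] := w_surj y yA ey ye.
  by exists z; apply: w_inj; rewrite wM wz xy.
have [G [W [W_inj W1 WM _ W_surj]]] := @corner_ring B (@full_pred B) e isT ee e0.
have {}W_surj x : e * x = x -> x * e = x -> exists y, W y = x by apply: W_surj.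
have Wl x : e * W x = W x by rewrite -W1 -WM mul1r.
have Wr x : W x * e = W x by rewrite -W1 -WM mulr1.
have WX x m : W (x ^+ m) = e * W x ^+ m.
  elim: m => [|m IHm]; first by rewrite mulr1.
  by rewrite !exprSr WM IHm mulrA.
have [jf jfE] : exists jf : k -> G, forall x, W (jf x) = w (j0 x).
  apply: (@fin_all_exists k (fun=> G) (fun x y => W y = w (j0 x))) => x.
  exact: W_surj.
have jfB : zmod_morphism jf.
  by move=> x y; apply: W_inj; rewrite raddfB !jfE rmorphB raddfB.
have jfM : monoid_morphism jf.
  split=> [|x y]; apply: W_inj; first by rewrite jfE rmorph1 w1 W1.
  by rewrite WM !jfE rmorphM wM.
pose j : {rmorphism k -> G} := HB.pack jf (GRing.isZmodMorphism.Build _ _ jf jfB)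
   (GRing.isMonoidMorphism.Build _ _ jf jfM).
have j_surj x : hom 0%N x -> exists c, W (j c) = x.
  move=> /hom0[xA ex xe]; have [y wy] := w_surj x xA ex xe.
  by exists (g y); rewrite jfE gK.
have hom_j c : hom 0%N (W (j c)).
  by split=> //; exists (w (j0 c)); rewrite ?wA // mulr1 jfE.
have [U WU] := W_surj u eu ue.
have [U' WU'] := W_surj u' eu' u'e.
have UU' : U * U' = 1 by apply: W_inj; rewrite WM WU WU' uu' W1.
have U'U : U' * U = 1 by apply: W_inj; rewrite WM WU WU' u'u W1.
have hLi0 : (i0 + L.-1 * i0 = 0 + L * i0)%N by rewrite -mulSn (prednK L0).
have [s sP] : exists s : k -> k, forall x, U * j x * U' = j (s x).
  apply: (@fin_all_exists k (fun=> k) (fun x y => U * j x * U' = j y)) => x.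
  have [c jc] : exists c, W (j c) = u * W (j x) * u'.
    apply: j_surj; apply: (homL 0%N i0); rewrite -hLi0 -[i0 in (i0 + _)%N]addn0.
    exact: (homM _ _ _ _ (homM _ _ _ _ hu (hom_j x)) hu').
  by exists c; apply: W_inj; rewrite jc !WM WU WU'.
have Us x : U * j x = j (s x) * U by rewrite -sP -mulrA U'U mulr1.
have [c jc] : exists c, U ^+ L = j c.
  have [c jc] : exists c, W (j c) = W (U ^+ L).
    apply: j_surj; apply: (homL 0%N i0); rewrite WX WU.
    exact: homX.
  by exists c; apply: W_inj.
have UX m : U ^+ m * U' ^+ m = 1.
  elim: m => [|m IHm]; first by rewrite mulr1.
  by rewrite exprSr exprS -mulrA (mulrA U) UU' mul1r.
have U'X m : U' ^+ m * U ^+ m = 1.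
  elim: m => [|m IHm]; first by rewrite mulr1.
  by rewrite exprSr exprS -mulrA (mulrA U') U'U mul1r.
have c0 : c != 0.
  apply/eqP=> c0; have /eqP := UX L; rewrite jc c0 rmorph0 mul0r.
  by rewrite eq_sym oner_eq0.
have l_G : l \in [pchar G].
  rewrite inE l_pr; apply/eqP/W_inj.
  by rewrite raddf0 raddfMn -mulr_natl (pcharf0 l_B) mul0r.
(* Euclidean division of degrees: a power of [U'] brings the degree down to [i %% i0], which by
   minimality of [i0] is 0 unless the element vanishes. *)
have Ghom i x : hom i (W x) -> exists d m, x = j d * U ^+ m.
  move=> hx; pose m := (i %/ i0)%N; pose y := x * U' ^+ m.
  have hy : hom (i %% i0)%N (W y).
    apply: (homL _ (m * i0)%N); rewrite WM WX WU' mulrA Wr.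
    have := homM _ _ _ _ hx (homX _ _ m hu'); rewrite mulrA Wr.
    congr (hom _ _); rewrite [i in LHS](divn_eq i i0) -/m addnAC addnC; congr (_ + _)%N.
    by rewrite -mulnDr hLi0 add0n mulnCA.
  have xy : x = y * U ^+ m by rewrite /y -mulrA U'X mulr1.
  have [y0|y0] := eqVneq (W y) 0.
    exists 0, m; rewrite xy rmorph0; congr (_ * _); apply: W_inj.
    by rewrite y0 raddf0.
  have i0i : (i %% i0 = 0)%N.
    apply/eqP; rewrite -leqn0 leqNgt; apply/negP=> i_gt0.
    by have := i0_min _ _ i_gt0 hy y0; rewrite leqNgt ltn_mod i0_gt0.
  rewrite i0i in hy; have [d jd] := j_surj _ hy.
  by exists d, m; rewrite xy; congr (_ * _); apply: W_inj.
have G_gen (x : G) : exists n, exists d : nat -> k, exists m : nat -> nat,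
    x = \sum_(i < n) j (d i) * U ^+ m i.
  have [n [a aA xa]] := B_gen (W x).
  have [d dP] : exists d : 'I_n -> k * nat, forall i : 'I_n,
      e * (a i * t ^+ i) * e = W (j (d i).1 * U ^+ (d i).2).
    apply: (@fin_all_exists 'I_n (fun=> (k * nat)%type)
      (fun (i : 'I_n) z => e * (a i * t ^+ i) * e = W (j z.1 * U ^+ z.2))) => i.
    have hi := hom_gen i _ (aA i); have [eh he _] := hi.
    have [y Wy] := W_surj _ eh he; rewrite -Wy in hi *.
    have [d [m dm]] := Ghom i y hi.
    by exists (d, m); rewrite -dm.
  pose dd i := if insub i is Some i' then d i' else (0, 0%N).
  have ddE (i : 'I_n) : dd i = d i by rewrite /dd valK.
  exists n, (fun i => (dd i).1), (fun i => (dd i).2).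
  apply: W_inj; rewrite raddf_sum -Wr -Wl xa mulr_sumr mulr_suml.
  by apply: eq_bigr => i _; rewrite /= ddE -dP.
pose IG (x : G) := I (W x).
have [|||||f [gam [ff nf gf fxf]]] := @crossed_good_idempotent l b G k j IG U s c
    l_pr l_G _ _ _ _ _ Us jc c0 G_gen.
- by rewrite /IG raddf0.
- by move=> x y; rewrite /IG raddfD; apply: ID.
- by move=> x y; rewrite /IG WM; apply: IMl.
- by move=> x y; rewrite /IG WM; apply: IMr.
- by rewrite /IG W1.
exists (W f), (W gam).
split=> //; first by rewrite -WM ff.
- by rewrite -!WM gf.
move=> x; have [y Wy] : exists y, W y = e * x * e.
  by apply: W_surj; rewrite ?mulrA ?ee // -!mulrA ee.
have [n [d fyf]] := fxf y.
exists n, d; move/(congr1 W): fyf; rewrite !WM raddf_sum /= Wy.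
rewrite !mulrA Wr -!mulrA Wl !mulrA => ->.
apply: eq_bigr => i _; rewrite raddfMz WM WX.
case: (nat_of_ord i) => [|i']; first by rewrite mulr1 Wl mul1r.
by rewrite exprS mulrA Wl.
Qed.
End CyclicExtension.

Section ModularIdempotents.
Variables (gT : finGroupType) (l b : nat) (N : {group gT}) (t : gT).
Hypotheses (l_pr : prime l) (nN : [set: gT] \subset 'N(N)%g).
Hypotheses (lN : coprime #|N| l) (tL : (t ^+ (l ^ b))%g \in N).
Hypothesis gen_t : forall g, exists i, (g * t ^- i)%g \in N.
Local Notation B := (galg 'F_l gT).

Definition split_idempotent (f : B) : Prop :=
  f * f = f /\ exists2 gam, gam * f = f * gam &
    forall x, exists n, exists c : nat -> int,
      f * x * f = \sum_(i < n) (gam ^+ i * f) *~ c i.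

(** The sums of products [a * f * b] with [f] split form a two-sided ideal. If it were proper, some
    split idempotent would lie outside it, although [f = 1 * f * 1]. *)
Lemma split_idempotents_generate : exists2 s : seq (B * B * B),
  forall u, u \in s -> split_idempotent u.1.2 &
  \sum_(u <- s) u.1.1 * u.1.2 * u.2 = 1.
Proof.
pose I (x : B) := exists2 s : seq (B * B * B),
  forall u, u \in s -> split_idempotent u.1.2 &
  \sum_(u <- s) u.1.1 * u.1.2 * u.2 = x.
suff : I 1 by [].
apply: contrapT => I1.
have conjN g x : x \in gsupp N -> gel g * x * gel g^-1 \in gsupp N.
  move/gsuppP=> xN; apply/gsuppP=> h hN; rewrite gel_mulr gel_mull.
  rewrite invgK xN // -conjgE.
  by rewrite memJ_norm // (subsetP nN) ?inE.
have NF : #|N|%:R != 0 :> 'F_l.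
  rewrite -(dvdn_pcharf (pchar_Fp l_pr)) -prime_coprime // coprime_sym.
  exact: lN.
have gX (g : gT) i : gel (g ^+ i)%g = gel g ^+ i :> B by apply: gelX.
have cyc_gen (x : B) : exists n, exists2 a : nat -> B,
    forall i, a i \in gsupp N & x = \sum_(i < n) a i * gel t ^+ i.
  have [r rN] : exists r : gT -> nat, forall g, (g * t ^- r g)%g \in N.
    exact: (@fin_all_exists gT (fun=> nat) (fun g i => (g * t ^- i)%g \in N)).
  pose r' g : 'I_#[t]%g := Ordinal (ltn_pmod (r g) (order_gt0 t)).
  have r'N g : (g * t ^- r' g)%g \in N by rewrite /= expg_mod_order.
  pose a i : B := \sum_(g | r' g == i :> nat) x g *: gel (g * t ^- i)%g.
  exists #[t]%g, a => [i|].
    apply: rpred_sum => g /eqP rg; apply/gsuppP=> h hN.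
    have := r'N g; rewrite rg galgZ ffunE => gN.
    by case: eqP => [hg|]; [rewrite hg gN in hN | rewrite mulr0].
  rewrite [x in LHS]galg_sum (partition_big r' predT) //=; apply: eq_bigr => i _.
  rewrite mulr_suml; apply: eq_bigr => g _.
  by rewrite -scalerAl -gX -gelM mulgKV.
have [|||||||||f [gam [ff nIf gf fxf]]] := @cyclic_ext_good_idempotent B (gsupp N) l b
    (gel t) (gel t^-1) I l_pr _ (gsupp_regular NF) (gelKV _ _) (gelVK _ _)
    _ _ _ _ cyc_gen _ _ _ _ I1.
- rewrite inE l_pr; apply/eqP/ffunP=> g; rewrite -(scaler_nat l (1 : B)).
  by rewrite (pcharf0 (pchar_Fp l_pr)) scale0r.
- by move=> a aN; apply: conjN.
- by move=> a aN; rewrite -{2}[t]invgK; apply: conjN.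
- by rewrite -gX gsupp_gel.
- by rewrite -gX gsupp_gel expVgn groupV.
- by exists [::]; rewrite // big_nil.
- move=> x y [s1 gs1 <-] [s2 gs2 <-]; exists (s1 ++ s2); last by rewrite big_cat.
  by move=> u; rewrite mem_cat => /orP[/gs1|/gs2].
- move=> x y [s gs <-]; exists [seq (x * u.1.1, u.1.2, u.2) | u <- s].
    by move=> u /mapP[u' /gs gu ->].
  by rewrite big_map mulr_sumr; apply: eq_bigr => u _; rewrite /= !mulrA.
- move=> x y [s gs <-]; exists [seq (u.1.1, u.1.2, u.2 * y) | u <- s].
    by move=> u /mapP[u' /gs gu ->].
  by rewrite big_map mulr_suml; apply: eq_bigr => u _; rewrite /= !mulrA.
apply: nIf; exists [:: (1, f, 1)]; last by rewrite big_seq1 mul1r mulr1.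
by move=> u; rewrite inE => /eqP->; split=> //; exists gam.
Qed.

End ModularIdempotents.

(** * Lifting idempotents to the l-adic numbers *)

Section PadicField.
Variables (l : nat) (l_pr : prime l) (K : padic_field l).
Local Notation abs := (@padic_abs l K).
Implicit Types (x : K).

Lemma padic_abs0 : abs 0 = 0.
Proof.
have := padic_abs_ratr K 0; rewrite /rat_padic_abs eqxx => <-.
by congr abs; rewrite -[0 in RHS]/(0%:~R) ratr_int.
Qed.

Lemma padic_abs_gt0 x : x != 0 -> 0 < abs x.
Proof.
move=> x0; rewrite lt_def padic_abs_ge0 andbT.
by apply: contra_neq x0 => /padic_abs_eq0.
Qed.

Lemma padic_abs1 : abs 1 = 1.
Proof.
have := padic_absM (1 : K) 1; rewrite mulr1 -[X in X = _]mulr1.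
by move/(mulfI (lt0r_neq0 (padic_abs_gt0 (oner_neq0 K)))).
Qed.

Lemma padic_absN x : abs (- x) = abs x.
Proof.
rewrite -mulN1r padic_absM -[RHS]mul1r; congr (_ * _); apply/eqP.
rewrite -(@pexpr_eq1 _ _ 2) ?padic_abs_ge0 // expr2 -padic_absM.
by rewrite mulrNN mulr1 padic_abs1.
Qed.

Lemma padic_absD_le x y c : abs x <= c -> abs y <= c -> abs (x + y) <= c.
Proof. by move=> xc yc; rewrite (le_trans (padic_absD x y)) // ge_max xc. Qed.

Lemma padic_absD_lt x y c : abs x < c -> abs y < c -> abs (x + y) < c.
Proof. by move=> xc yc; rewrite (le_lt_trans (padic_absD x y)) // gt_max xc. Qed.

Lemma padic_abs_sum_le (J : Type) (r : seq J) (P : pred J) (F : J -> K) c : 0 <= c ->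
  (forall i, P i -> abs (F i) <= c) -> abs (\sum_(i <- r | P i) F i) <= c.
Proof.
move=> c0 Fc; elim/big_rec: _ => [|i x Pi xc]; first by rewrite padic_abs0.
by apply: padic_absD_le => //; apply: Fc.
Qed.

Lemma padic_abs_sum_lt (J : Type) (r : seq J) (P : pred J) (F : J -> K) c : 0 < c ->
  (forall i, P i -> abs (F i) < c) -> abs (\sum_(i <- r | P i) F i) < c.
Proof.
move=> c0 Fc; elim/big_rec: _ => [|i x Pi xc]; first by rewrite padic_abs0.
by apply: padic_absD_lt => //; apply: Fc.
Qed.

Lemma padic_abs_nat n : abs n%:R <= 1.
Proof.
elim: n => [|n IHn]; first by rewrite padic_abs0.
by rewrite -addn1 natrD padic_absD_le // padic_abs1.
Qed.

Lemma padic_abs_int (n : int) : abs n%:~R <= 1.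
Proof.
by case: n => n; rewrite ?NegzE ?rmorphN /= ?padic_absN padic_abs_nat.
Qed.

Lemma padic_abs_l : abs l%:R < 1.
Proof.
have := padic_abs_ratr K l%:~R; rewrite ratr_int => ->.
rewrite /rat_padic_abs intr_eq0 eqz_nat (gtn_eqF (prime_gt0 l_pr)).
rewrite numq_int denq_int /= logn1 sub0r lognE l_pr prime_gt0 // dvdnn divnn.
by rewrite prime_gt0 // logn1 exprN1 invf_lt1 ?ltr1n ?ltr0n ?prime_gt0 ?prime_gt1.
Qed.

Lemma padic_pchar : [pchar K] =i pred0.
Proof.
apply/pcharf0P => -[|n]; first by rewrite !eqxx.
apply/negP=> /eqP n0; have := padic_abs_ratr K n.+1%:~R.
rewrite ratr_int -[_%:~R]/(n.+1%:R) n0 padic_abs0 /rat_padic_abs intr_eq0 /=.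
move/esym/eqP; rewrite expfz_eq0 => /andP[_].
by rewrite pnatr_eq0 (gtn_eqF (prime_gt0 l_pr)).
Qed.

(* Reduction modulo l, as a relation on the ring of integers of K. *)
Definition redK x (y : 'F_l) : Prop :=
  exists n : int, abs (x - n%:~R) < 1 /\ n%:~R = y.

Lemma Fp_int_eq0 (n : int) : n%:~R = 0 :> 'F_l -> abs n%:~R < 1.
Proof.
have natP m : m%:R = 0 :> 'F_l -> abs m%:R < 1.
  move/eqP; rewrite -(dvdn_pcharf (pchar_Fp l_pr)) => /dvdnP[d ->].
  rewrite natrM padic_absM (le_lt_trans _ padic_abs_l) //.
  by rewrite ler_piMl ?padic_abs_ge0 // padic_abs_nat.
case: n => n; first exact: natP.
by rewrite NegzE !rmorphN => /eqP; rewrite oppr_eq0 padic_absN => /eqP/natP.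
Qed.

Lemma redK0P x : redK x 0 <-> abs x < 1.
Proof.
split=> [[n [xn /Fp_int_eq0 n0]]|x1]; last by exists 0; rewrite subr0.
by rewrite -(subrK n%:~R x) padic_absD_lt.
Qed.

Lemma redK_int (n : int) : redK n%:~R n%:~R.
Proof. by exists n; rewrite subrr padic_abs0. Qed.

Lemma redK_le1 x y : redK x y -> abs x <= 1.
Proof.
move=> [n [xn _]]; rewrite -(subrK n%:~R x).
by rewrite padic_absD_le ?padic_abs_int // ltW.
Qed.

Lemma redKD x y x' y' : redK x y -> redK x' y' -> redK (x + x') (y + y').
Proof.
move=> [n [xn <-]] [n' [xn' <-]]; exists (n + n'); rewrite !rmorphD; split=> //.
by rewrite opprD addrACA padic_absD_lt.
Qed.

Lemma redKM x y x' y' : redK x y -> redK x' y' -> redK (x * x') (y * y').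
Proof.
move=> xy [n' [xn' <-]]; have x1 := redK_le1 xy; case: xy => n [xn <-].
exists (n * n'); rewrite !rmorphM; split=> //.
have -> : x * x' - n%:~R * n'%:~R = x * (x' - n'%:~R) + (x - n%:~R) * n'%:~R.
  by rewrite mulrBr mulrBl addrA subrK.
apply: padic_absD_lt; rewrite padic_absM.
  by rewrite (le_lt_trans _ xn') // ler_piMl ?padic_abs_ge0.
by rewrite (le_lt_trans _ xn) // ler_piMr ?padic_abs_ge0 ?padic_abs_int.
Qed.

Lemma redK_sum (J : Type) (r : seq J) (P : pred J) (F : J -> K) (G : J -> 'F_l) :
  (forall i, P i -> redK (F i) (G i)) ->
  redK (\sum_(i <- r | P i) F i) (\sum_(i <- r | P i) G i).
Proof.
move=> FG; elim/big_rec2: _ => [|i x y Pi]; first exact: (redK_int 0).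
by apply: redKD; apply: FG.
Qed.

Lemma redK_near x x' y : redK x y -> abs (x' - x) < 1 -> redK x' y.
Proof.
move=> [n [xn ny]] xx'; exists n; split=> //.
by rewrite -(subrK x x') -addrA padic_absD_lt.
Qed.

Lemma redK_lift (y : 'F_l) : exists x, redK x y.
Proof.
exists (y : nat)%:~R; exists (y : nat)%:Z; split; first by rewrite subrr padic_abs0.
by rewrite -[RHS]natr_Zp.
Qed.

(** A kernel vector satisfies [v = v *m M], and by the ultrametric inequality its coordinate of
    largest absolute value would be strictly smaller than itself. *)
Lemma small_perturbation_unit n (M : 'M[K]_n) :
  (forall i j, abs (M i j) < 1) -> 1%:M - M \in unitmx.
Proof.
move=> M1; rewrite -row_free_unit; apply: inj_row_free => v.
rewrite mulmxBr mulmx1 => /eqP; rewrite subr_eq0 => /eqP vM.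
apply/eqP/rV0Pn => -[i0 vi0].
case: (@arg_maxP _ _ _ i0 predT (fun i => abs (v 0 i)) isT) => i _ imax'.
have imax j : abs (v 0 j) <= abs (v 0 i) := imax' j isT.
have vi : 0 < abs (v 0 i).
  by rewrite (lt_le_trans (padic_abs_gt0 vi0)) // imax.
suff : abs (v 0 i) < abs (v 0 i) by rewrite ltxx.
rewrite {1}vM mxE; apply: padic_abs_sum_lt => // j _; rewrite padic_absM.
have [->|vj] := eqVneq (v 0 j) 0; first by rewrite padic_abs0 mul0r.
rewrite (lt_le_trans _ (imax j)) // gtr_pMr ?M1 //.
exact: padic_abs_gt0.
Qed.

End PadicField.

(** This is the polynomial 3 y^2 - 2 y^3, written so that the correction is a multiple of the defect
    [y * y - y]. *)
Definition newton_idem (A : nzRingType) (y : A) : A :=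
  y + (y * y - y) * (1 - y *+ 2).

(** Only [y] and integers occur, so the identity is checked in the commutative ring of integer
    polynomials and then evaluated at [y]. The square of the old defect is a factor of the new
    one. *)
Lemma newton_idem_defect (A : nzRingType) (y : A) (w := y * y - y) :
  newton_idem y * newton_idem y - newton_idem y = w * w * (w *+ 4 - 3%:R).
Proof.
have cy : commr_rmorph intr y by move=> m; rewrite /GRing.comm mulrzl mulrzr.
pose h : {rmorphism {poly int} -> A} := horner_morph cy.
have yE : y = h 'X by rewrite /h /= horner_morphX.
have nE : newton_idem y = h (newton_idem 'X).
  by rewrite /newton_idem yE !(rmorphD, rmorphN, rmorphM, rmorphMn, rmorph1).
rewrite nE /w yE.
transitivity (h (('X * 'X - 'X) * ('X * 'X - 'X) * (('X * 'X - 'X) *+ 4 - 3%:R))); last first.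
  by rewrite !(rmorphD, rmorphN, rmorphM, rmorphMn, rmorph1).
rewrite -rmorphM -rmorphB.
congr (h _); rewrite /newton_idem; ring.
Qed.

Lemma expr_lt_eps (d e : rat) : 0 < d -> d < 1 -> 0 < e -> exists n, d ^+ n < e.
Proof.
move=> d0 d1 e0; pose h := d^-1 - 1.
have h0 : 0 < h by rewrite subr_gt0 invf_gt1.
have bern n : 1 + n%:R * h <= d^-1 ^+ n.
  elim: n => [|n IHn]; first by rewrite mul0r addr0.
  have Q1 : 1 <= d^-1 ^+ n by rewrite exprn_ege1 // ltW // invf_gt1.
  have -> : d^-1 ^+ n.+1 = d^-1 ^+ n + h * d^-1 ^+ n.
    by rewrite exprS /h mulrBl mul1r addrC subrK.
  by rewrite -natr1 mulrDl mul1r addrA lerD // ler_peMr // ltW.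
have [n hn] : exists n : nat, e^-1 / h < n%:R.
  by exists (Num.bound (e^-1 / h)); apply/archi_boundP/ltW/divr_gt0; rewrite ?invr_gt0.
exists n; rewrite -ltf_pV2 ?posrE ?exprn_gt0 // -exprVn.
rewrite (lt_le_trans _ (bern n)) //.
by rewrite (lt_trans (y := n%:R * h)) ?ltrDr // -ltr_pdivrMr.
Qed.

Section Lifting.
Variables (gT : finGroupType) (l : nat) (l_pr : prime l) (K : padic_field l).
Local Notation abs := (@padic_abs l K).
Local Notation A := (galg K gT).
Local Notation B := (galg 'F_l gT).

Definition gred (x : A) (y : B) : Prop := forall g, redK (x g) (y g).
Definition gbd (x : A) (c : rat) : Prop := forall g, abs (x g) <= c.

Lemma gredD x y x' y' : gred x y -> gred x' y' -> gred (x + x') (y + y').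
Proof. by move=> xy xy' g; rewrite !ffunE; apply: redKD. Qed.

Lemma gredM x y x' y' : gred x y -> gred x' y' -> gred (x * x') (y * y').
Proof.
by move=> xy xy' g; rewrite !galgM; apply: redK_sum => h _; apply: redKM.
Qed.

Lemma gred_gel g : gred (gel g) (gel g).
Proof. by move=> h; rewrite !ffunE; exact: (redK_int K ((h == g) : nat)%:Z). Qed.

Lemma gred0 : gred 0 0.
Proof. by move=> g; rewrite !ffunE; apply: (redK_int K 0). Qed.

Lemma gredN x y : gred x y -> gred (- x) (- y).
Proof.
move=> xy g; rewrite !ffunE -mulN1r -[- y g]mulN1r.
by apply: redKM => //; apply: (redK_int K (-1)).
Qed.

Lemma gredMz x y (n : int) : gred x y -> gred (x *~ n) (y *~ n).
Proof.
move=> xy; have gredMn x' y' m : gred x' y' -> gred (x' *+ m) (y' *+ m).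
  by move=> xy'; elim: m => [|m IHm]; rewrite ?mulr0n ?mulrS; [apply: gred0 | apply: gredD].
by case: n => n; rewrite ?NegzE ?mulrNz -!pmulrn; [|apply: gredN]; apply: gredMn.
Qed.

Lemma gredX x y n : gred x y -> gred (x ^+ n) (y ^+ n).
Proof.
by move=> xy; elim: n => [|n IHn]; [apply: (gred_gel 1%g) | rewrite !exprS; apply: gredM].
Qed.

Lemma gred_sum (J : Type) (r : seq J) (P : pred J) (F : J -> A) (G : J -> B) :
  (forall i, P i -> gred (F i) (G i)) ->
  gred (\sum_(i <- r | P i) F i) (\sum_(i <- r | P i) G i).
Proof.
move=> FG; elim/big_rec2: _ => [|i x y Pi]; first exact: gred0.
by apply: gredD; apply: FG.
Qed.

Lemma gred_lift y : exists x, gred x y.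
Proof.
have [f fP] : exists f : gT -> K, forall g, redK (f g) (y g).
  apply: (@fin_all_exists gT (fun=> K) (fun g x => redK x (y g))) => g.
  exact: redK_lift.
by exists (finfun f : A) => g; rewrite ffunE.
Qed.

Lemma gred_near x x' y : gred x y -> (forall g, abs ((x' - x) g) < 1) -> gred x' y.
Proof. by move=> xy xx' g; apply: redK_near (xy g) _; have := xx' g; rewrite !ffunE. Qed.

Lemma gbdM x y c d : 0 <= c -> 0 <= d -> gbd x c -> gbd y d -> gbd (x * y) (c * d).
Proof.
move=> c0 d0 xc yd g; rewrite galgM; apply: padic_abs_sum_le => [|h _]; first exact: mulr_ge0.
by rewrite padic_absM ler_pM ?padic_abs_ge0.
Qed.

Lemma gbdD x y c : gbd x c -> gbd y c -> gbd (x + y) c.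
Proof. by move=> xc yc g; rewrite ffunE padic_absD_le. Qed.

Lemma gbdN x c : gbd x c -> gbd (- x) c.
Proof. by move=> xc g; rewrite ffunE padic_absN. Qed.

Lemma gred_bd1 x y : gred x y -> gbd x 1.
Proof. by move=> xy g; apply: redK_le1 (xy g). Qed.

Lemma gbd_nat n : gbd (n%:R : A) 1.
Proof. exact: (gred_bd1 (gredMz n (gred_gel 1%g))). Qed.

(** Newton's iteration from an arbitrary lift, with the limit taken coefficient by coefficient. Of
    its quadratic convergence only the bound [d ^+ n.+1] on the n-th defect is retained. *)
Lemma gred_idempotent_lift (f : B) : f * f = f -> exists2 e : A, e * e = e & gred e f.
Proof.
move=> ff; have [y0 y0f] := gred_lift f.
pose y n : A := iter n (@newton_idem A) y0.
pose w n := y n * y n - y n.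
have [d [d0 d1 wd]] : exists d, [/\ 0 < d, d < 1 & gbd (w 0%N) d].
  have w1 g : abs (w 0%N g) < 1.
    apply/(redK0P l_pr); have := gredD (gredM y0f y0f) (gredN y0f).
    by rewrite ff subrr => /(_ g); rewrite [(0 : B) g]ffunE.
  (* The default [2^-1] keeps [d] positive even if the initial lift is already idempotent. *)
  exists (\big[Num.max/2^-1]_g abs (w 0%N g)); split.
  - by apply: lt_le_trans (bigmax_ge_id _ _ _ _); rewrite invr_gt0.
  - by apply/bigmax_ltP; split=> //; rewrite invf_lt1.
  - by move=> g; apply: le_bigmax.
have d_ge0 := ltW d0; have d_le1 := ltW d1.
have yw n : gbd (y n) 1 /\ gbd (w n) (d ^+ n.+1).
  elim: n => [|n [yn wn]]; first by split=> //; apply: gred_bd1 y0f.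
  have dn0 m : 0 <= d ^+ m by apply: exprn_ge0.
  have dn1 m : d ^+ m <= 1 by apply: exprn_ile1.
  have wn1 : gbd (w n) 1 by move=> g; apply: le_trans (wn g) (dn1 _).
  have yn2 : gbd (1 - y n *+ 2) 1.
    apply: gbdD; first exact: (gbd_nat 1).
    by apply: gbdN; rewrite mulr2n; apply: gbdD.
  split.
    by apply: gbdD => //; have := gbdM ler01 ler01 wn1 yn2; rewrite mulr1.
  rewrite /w /y iterS newton_idem_defect -/(y n) -/(w n).
  have w4 : gbd (w n *+ 4 - 3%:R) 1.
    apply: gbdD; last exact/gbdN/gbd_nat.
    by rewrite -mulr_natl; have := gbdM ler01 ler01 (gbd_nat 4) wn1; rewrite mulr1.
  have := gbdM (mulr_ge0 (dn0 n.+1) (dn0 n.+1)) ler01 (gbdM (dn0 _) (dn0 _) wn wn) w4.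
  rewrite mulr1 -exprD => H g; apply: le_trans (H g) _.
  by rewrite ler_wiXn2l // ?d_ge0 // addSn !addnS !ltnS leq_addr.
have ystep n m : gbd (y (n + m)%N - y n) (d ^+ n.+1).
  elim: m => [|m IHm].
    by rewrite addn0 subrr => g; rewrite ffunE padic_abs0 exprn_ge0.
  rewrite addnS {1}/y iterS -/(y _) /newton_idem -/(w _) addrAC.
  apply: gbdD => //; have [yn wn] := yw (n + m)%N.
  have yn2 : gbd (1 - y (n + m)%N *+ 2) 1.
    apply: gbdD; first exact: (gbd_nat 1).
    by apply: gbdN; rewrite mulr2n; apply: gbdD.
  have := gbdM (exprn_ge0 _ d_ge0) ler01 wn yn2; rewrite mulr1 => H g.
  by apply: le_trans (H g) _; rewrite ler_wiXn2l // ltnS leq_addr.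
have [e eP] : exists e : gT -> K, forall g (eps : rat), 0 < eps -> exists N : nat,
    forall n, (N <= n)%N -> abs (y n g - e g) < eps.
  apply: (@fin_all_exists gT (fun=> K) (fun g x => forall eps, 0 < eps -> exists N : nat,
    forall n, (N <= n)%N -> abs (y n g - x) < eps)) => g.
  apply: padic_complete => eps eps0; have [N dN] := expr_lt_eps d0 d1 eps0.
  exists N => m n Nm Nn; rewrite (le_lt_trans _ dN) //.
  have near k : (N <= k)%N -> abs (y k g - y N g) <= d ^+ N.
    move=> Nk; have := ystep N (k - N)%N g; rewrite subnKC // !ffunE => /le_trans; apply.
    by rewrite exprS ler_piMl // exprn_ge0.
  rewrite -(subrK (y N g) (y m g)) -addrA padic_absD_le ?near //.
  by rewrite -opprB padic_absN near.
pose E : A := finfun e.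
have Ey n : gbd (E - y n) (d ^+ n.+1).
  move=> g; rewrite !ffunE.
  have [N eN] := eP g (d ^+ n.+1) (exprn_gt0 _ d0).
  rewrite -(subrK (y (n + N)%N g) (e g)) -addrA padic_absD_le //.
    by rewrite -opprB padic_absN ltW // eN // leq_addl.
  by have := ystep n N g; rewrite !ffunE.
have E1 : gbd E 1.
  rewrite -(subrK (y 0%N) E); apply: gbdD; last by have [] := yw 0%N.
  by move=> g; apply: le_trans (Ey 0%N g) _; rewrite expr1.
exists E; last first.
  apply: gred_near y0f _ => g; rewrite (le_lt_trans (Ey 0%N g)) //.
apply/eqP; rewrite -subr_eq0; apply/eqP/ffunP=> g; rewrite [RHS]ffunE.
apply/eqP; apply: contraT => /padic_abs_gt0 Eg.
have [n dn] := expr_lt_eps d0 d1 Eg.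
suff : abs ((E * E - E) g) <= d ^+ n.+1.
  move=> H; have := lt_le_trans dn H; rewrite exprS ltNge ler_piMl ?exprn_ge0 //.
suff : gbd (E * E - E) (d ^+ n.+1) by apply.
have -> : E * E - E = E * (E - y n) + (E - y n) * y n + w n - (E - y n).
  rewrite /w; move: (y n) => z.
  rewrite mulrBr mulrBl (addrA (_ - _)) subrK (addrA (_ - _)) subrK opprB.
  by rewrite addrA subrK.
have [yn wn] := yw n.
apply: gbdD; last exact/gbdN.
apply: gbdD => //; apply: gbdD.
  by have := gbdM ler01 (exprn_ge0 _ d_ge0) E1 (Ey n); rewrite mul1r.
by have := gbdM (exprn_ge0 _ d_ge0) ler01 (Ey n) yn; rewrite mulr1.
Qed.

End Lifting.

Definition commuting_idempotent (R : comNzRingType) (gT : finGroupType)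
    (e : galg R gT) : Prop :=
  e * e = e /\ forall g h, GRing.comm (e * gel g * e) (e * gel h * e).

Section PadicIdempotents.
Variables (gT : finGroupType) (l : nat) (l_pr : prime l) (K : padic_field l).
Local Notation abs := (@padic_abs l K).
Local Notation A := (galg K gT).
Local Notation B := (galg 'F_l gT).

(* For X g = e g e, with c a lift of gam to the corner, X g - Q g has coordinates
   of absolute value less than 1 for some polynomial Q g in c.  It is thus a
   small combination of the X h; solving, the X g are combinations of the Q h,
   which commute. *)
Lemma split_idempotent_lift (f : B) : split_idempotent f ->
  exists2 e : A, commuting_idempotent e & gred e f.
Proof.
move=> [ff [gam gf fxf]].
have [e ee ef] := gred_idempotent_lift l_pr K ff.
have [c0 c0g] := gred_lift K gam.
have [c [ce ec cred]] : exists c, [/\ c * e = c, e * c = c & gred c (f * gam * f)].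
  exists (e * c0 * e); rewrite -mulrA ee !mulrA ee; split=> //.
  by apply: gredM => //; apply: gredM.
have gfX i : (f * gam * f) ^+ i * f = gam ^+ i * f.
  elim: i => [|i IHi]; first by rewrite !expr0.
  rewrite exprS -mulrA IHi -gf -(mulrA gam f f) ff.
  have fgX : f * gam ^+ i = gam ^+ i * f by apply/commr_sym/commr_sym/commrX/commr_sym.
  by rewrite -mulrA (mulrA f) fgX -mulrA ff mulrA -exprS.
have [n [d fgf]] : exists n : gT -> nat, exists d : gT -> nat -> int, forall g,
    f * gel g * f = \sum_(i < n g) (gam ^+ i * f) *~ d g i.
  have [nd ndP] : exists nd : gT -> nat * (nat -> int), forall g,
      f * gel g * f = \sum_(i < (nd g).1) (gam ^+ i * f) *~ (nd g).2 i.
    apply: (@fin_all_exists gT (fun=> (nat * (nat -> int))%type) (fun g nd =>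
      f * gel g * f = \sum_(i < nd.1) (gam ^+ i * f) *~ nd.2 i)) => g.
    by have [n [d H]] := fxf (gel g); exists (n, d).
  by exists (fun g => (nd g).1), (fun g => (nd g).2).
pose X g := e * gel g * e.
pose Q g := \sum_(i < n g) (c ^+ i * e) *~ d g i.
have QC g h : GRing.comm (Q g) (Q h).
  have cce i : GRing.comm c (c ^+ i * e).
    by rewrite /GRing.comm mulrA -exprS exprSr -!mulrA ce ec.
  have eQ x : GRing.comm x c -> GRing.comm x e -> GRing.comm x (Q h).
    move=> xc xe; apply: commr_sum => i _; rewrite -mulrzl.
    by apply: commrM; [apply: commr_int | apply: commrM => //; apply: commrX].
  have eC : GRing.comm e c by rewrite /GRing.comm ec ce.
  apply/commr_sym; apply: commr_sum => i _; rewrite -mulrzl.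
  apply: commrM; first exact: commr_int.
  apply: commrM; last exact/commr_sym/eQ.
  by apply: commrX; apply/commr_sym/eQ => //; apply: commr_sym.
have XQ g h : abs ((X g - Q g) h) < 1.
  apply/(redK0P l_pr).
  suff : gred (X g - Q g) 0 by move/(_ h); rewrite [(0 : B) h]ffunE.
  rewrite -(subrr (f * gel g * f)) {2}fgf; apply: gredD; last apply: gredN.
    by apply: gredM => //; apply: gredM => //; apply: gred_gel.
  under [\sum_(i < n g) (gam ^+ i * f) *~ d g i]eq_bigr => i _ do rewrite -gfX.
  by apply: gred_sum => i _; apply/gredMz/gredM => //; apply: gredX.
pose M := \matrix_(i, j < #|gT|) (X (enum_val i) - Q (enum_val i)) (enum_val j).
have M_unit : 1%:M - M \in unitmx.
  by apply: small_perturbation_unit => i j; rewrite mxE.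
have XMQ i : \sum_j (1%:M - M) i j *: X (enum_val j) = Q (enum_val i).
  have eXe g : e * X g * e = X g by rewrite /X !mulrA ee -!mulrA ee.
  have eQe g : e * Q g * e = Q g.
    rewrite mulr_sumr mulr_suml; apply: eq_bigr => i' _.
    rewrite mulrzAr mulrzAl; congr (_ *~ _).
    have eX : GRing.comm e (c ^+ i') by apply: commrX; rewrite /GRing.comm ec ce.
    by rewrite mulrA eX -!mulrA !ee.
  (* An element unchanged by multiplication by [e] on both sides can be written with the same
     coefficients on the [X h] as on the [gel h]. *)
  have XQ_sum g : X g - Q g = \sum_h (X g - Q g) h *: X h.
    rewrite -{1}(eXe g) -{1}(eQe g) -mulrBl -mulrBr {1}[X g - Q g]galg_sum.
    rewrite mulr_sumr mulr_suml; apply: eq_bigr => h _.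
    by rewrite -scalerAr -scalerAl.
  rewrite -[RHS](subrK (X (enum_val i))) -[_ - X _]opprB XQ_sum [RHS]addrC.
  under eq_bigr => j _ do rewrite !mxE scalerBl.
  rewrite sumrB; congr (_ - _).
    rewrite (bigD1 i) //= eqxx scale1r big1 ?addr0 // => j ji.
    by rewrite eq_sym (negPf ji) scale0r.
  by rewrite [RHS](reindex (@enum_val gT gT)) //; apply: onW_bij; exact: enum_val_bij.
exists e => //; split=> // g h; rewrite -/(X g) -/(X h).
have XsQ g' : X g' = \sum_i invmx (1%:M - M) (enum_rank g') i *: Q (enum_val i).
  under eq_bigr => i _ do rewrite -XMQ scaler_sumr.
  rewrite exchange_big (bigD1 (enum_rank g')) //= [X in _ + X]big1 ?addr0.
    under eq_bigr => i _ do rewrite scalerA.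
    rewrite -scaler_suml enum_rankK.
    have := congr1 (fun N : 'M_ _ => N (enum_rank g') (enum_rank g')) (mulVmx M_unit).
    by rewrite !mxE eqxx /= => ->; rewrite scale1r.
  move=> j jg; under eq_bigr => i _ do rewrite scalerA.
  rewrite -scaler_suml.
  have := congr1 (fun N : 'M_ _ => N (enum_rank g') j) (mulVmx M_unit).
  by rewrite !mxE eq_sym (negPf jg) /= => ->; rewrite scale0r.
rewrite (XsQ h); apply: commr_sum => i _.
rewrite /GRing.comm -scalerAr -scalerAl; congr (_ *: _); apply: commr_sym.
rewrite (XsQ g); apply: commr_sum => j _.
by rewrite /GRing.comm -scalerAr -scalerAl QC.
Qed.

Lemma gred_unit (y : A) : gred y 1 -> exists z, z * y = 1.
Proof.
move=> y1; have : 1%:M - rmx (1 - y) \in unitmx.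
  apply: small_perturbation_unit => i j; rewrite mxE; apply/(redK0P l_pr).
  have := gredD (@gred_gel gT l K 1%g) (gredN y1); rewrite gel1 subrr.
  by move/(_ ((enum_val i)^-1 * enum_val j)%g); rewrite [(0 : B) _]ffunE.
have -> : 1%:M - rmx (1 - y) = rmx y.
  apply/matrixP=> i j; rewrite !mxE !ffunE -eq_mulVg1 (inj_eq enum_val_inj).
  by rewrite opprB addrC subrK.
move=> yu; exists (ungvec (gvec 1 *m invmx (rmx y))).
by apply: (can_inj (@gvecK K gT)); rewrite gvecMr ungvecK mulmxKV.
Qed.

(** The relation for 1 modulo l is lifted term by term. The lifted sum reduces to 1, so it has a
    left inverse, which is absorbed in the left factors. *)
Lemma padic_commuting_idempotents (b : nat) (N : {group gT}) (t : gT) :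
    [set: gT] \subset 'N(N)%g -> coprime #|N| l -> (t ^+ (l ^ b))%g \in N ->
    (forall g, exists i, (g * t ^- i)%g \in N) ->
  exists2 s : seq (A * A * A),
    forall u, u \in s -> commuting_idempotent u.1.2 &
    \sum_(u <- s) u.1.1 * u.1.2 * u.2 = 1.
Proof.
move=> nN lN tL gen_t.
have [s s_split s1] := split_idempotents_generate l_pr nN lN tL gen_t.
have [s' s'_com s's] : exists2 s' : seq (A * A * A),
    forall u, u \in s' -> commuting_idempotent u.1.2 &
    gred (\sum_(u <- s') u.1.1 * u.1.2 * u.2) (\sum_(u <- s) u.1.1 * u.1.2 * u.2).
  elim: s s_split {s1} => [|[[a f] c] s IHs] s_split.
    by exists [::] => //; rewrite !big_nil; apply: gred0.
  have [|s' s'_com s's] := IHs.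
    by move=> u us; apply: s_split; rewrite inE us orbT.
  have [|e e_com ef] := @split_idempotent_lift f.
    by apply: (s_split (a, f, c)); rewrite mem_head.
  have [a' aa'] := gred_lift K a; have [c' cc'] := gred_lift K c.
  exists ((a', e, c') :: s') => [u|].
    by rewrite inE => /predU1P[->|/s'_com].
  by rewrite !big_cons; apply: gredD => //=; apply: gredM => //; apply: gredM.
have [z z1] : exists z, z * \sum_(u <- s') u.1.1 * u.1.2 * u.2 = 1.
  by apply: gred_unit; rewrite -s1.
exists [seq (z * u.1.1, u.1.2, u.2) | u <- s'] => [u /mapP[v /s'_com vc ->] //|].
rewrite big_map -{}z1 mulr_sumr; apply: eq_bigr => u _.
by rewrite /= !mulrA.
Qed.

End PadicIdempotents.

Lemma ramification_idempotents (p : nat) (gT : finGroupType) (l : nat)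
    (K : padic_field l) :
    prime l -> l != p -> ramification_group p gT ->
  exists2 s : seq (galg K gT * galg K gT * galg K gT),
    forall u, u \in s -> commuting_idempotent u.1.2 &
    \sum_(u <- s) u.1.1 * u.1.2 * u.2 = 1.
Proof.
move=> l_pr lp [P [C [PC pP /cyclicP[c Cc] _]]].
have [/andP[sPG nPG] sCG mulPC nPC _] := sdprod_context PC.
(* Here [l ^ b] is the l-part of the order of [c], and [H] is the part of [C] of order prime to l.
   The normal subgroup sought is [P <*> H], of order prime to l because [P] is a p-group, and [c]
   generates the quotient. *)
pose b := logn l #[c]%g; pose H := <[c ^+ (l ^ b)]>%G.
have sHC : H \subset C by rewrite Cc cycleX.
have nPH : H \subset 'N(P)%g := subset_trans sHC nPC.
have mulPH : (P * H)%g = (P <*> H)%g by rewrite norm_joinEr.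
have lP : coprime #|P| l.
  rewrite coprime_sym prime_coprime //; apply/negP=> lP.
  have := pgroupP pP l l_pr lP; rewrite inE => /eqP lp'.
  by rewrite lp' eqxx in lp.
have lH : coprime #|H| l.
  have cb : (l ^ b %| #[c]%g)%N by apply: pfactor_dvdnn.
  rewrite coprime_sym prime_coprime // -[#|H|]/#[c ^+ (l ^ b)]%g orderXdiv //.
  rewrite -[#[c]%g](@partnC l) ?order_gt0 // p_part mulKn ?expn_gt0 ?prime_gt0 //.
  by rewrite -p'natE // part_pnat.
apply: (@padic_commuting_idempotents gT l l_pr K b (P <*> H)%G c).
- rewrite -mulPC mul_subG //; first by rewrite (subset_trans (joing_subl P H)) ?normG.
  rewrite normsY // cents_norm // (sub_abelian_cent2 _ (subxx C) sHC) //.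
  by rewrite Cc cycle_abelian.
- have := mul_cardG P H; rewrite mulPH => cardM.
  have : coprime (#|P| * #|H|) l by rewrite coprimeMl lP.
  by rewrite cardM coprimeMl => /andP[].
- by rewrite mem_gen // inE orbC cycle_id.
move=> g; have : g \in (P * C)%g by rewrite mulPC inE.
case/mulsgP=> x y xP; rewrite Cc => /cycleP[i ->] ->.
by exists i; rewrite mulgK mem_gen // inE xP.
Qed.

(** * Descent of representations *)

(** The trace of an idempotent is its rank: in a full-rank factorization the product in the reverse
    order is the identity matrix. *)
Lemma idempotent_trace0 (F : fieldType) n (M : 'M[F]_n) :
  [pchar F] =i pred0 -> M *m M = M -> \tr M = 0 -> M = 0.
Proof.
move=> F0 MM tM.
have rc : row_base M *m col_base M = 1%:M.
  apply: (row_free_inj (row_base_free M)); rewrite mul1mx /=.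
  apply: (row_full_inj (col_base_full M)).
  by rewrite -mulmxA mulmx_base mulmxA mulmx_base MM.
move: tM; rewrite -{1}(mulmx_base M) mxtrace_mulC rc mxtrace1 => /eqP.
by rewrite ((pcharf0P _).1 F0) mxrank_eq0 => /eqP.
Qed.

Lemma submodule_repr (F : fieldType) (gT : finGroupType) (G : {group gT}) n
    (rG : mx_representation F G n) (U : 'M_n) : mxmodule rG U ->
  exists (r : mx_representation F G (\rank U)) (B : 'M_(\rank U, n)),
    [/\ row_free B, (B :=: U)%MS & forall g, g \in G -> r g *m B = B *m rG g].
Proof.
move=> modU; exists (submod_repr modU), (val_submod 1%:M).
have BU : (val_submod 1%:M :=: U)%MS := val_submod1 U.
split=> // [|g gG]; first by rewrite /row_free BU.
by rewrite -val_submodE -(val_submodJ modU) // mul1mx.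
Qed.

Section RegularModule.
Variables (F : fieldType) (gT : finGroupType).
Local Notation A := (galg F gT).
Implicit Types (x y e : A).

Lemma rmxM x y : rmx (x * y) = rmx x *m rmx y.
Proof.
apply/row_matrixP=> i; rewrite !rowE.
by rewrite -[delta_mx 0 i]ungvecK mulmxA -!gvecMr mulrA.
Qed.

Lemma lmxM x y : lmx (x * y) = lmx y *m lmx x.
Proof.
apply/row_matrixP=> i; rewrite !rowE.
by rewrite -[delta_mx 0 i]ungvecK mulmxA -!gvecMl mulrA.
Qed.

Lemma lrmxC x y : lmx x *m rmx y = rmx y *m lmx x.
Proof.
apply/row_matrixP=> i; rewrite !rowE !mulmxA -[delta_mx 0 i]ungvecK.
by rewrite -!(gvecMl, gvecMr) mulrA.
Qed.

Lemma rmx1 : rmx (1 : A) = 1%:M.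
Proof.
apply/row_matrixP=> i; rewrite !rowE mulmx1 -[delta_mx 0 i]ungvecK.
by rewrite -gvecMr mulr1.
Qed.

Lemma right_regular_mx_repr :
  mx_repr [set: gT] (fun g => rmx (gel g : A)).
Proof. by split=> [|g h _ _]; rewrite ?rmx1 // gelM rmxM. Qed.

Definition right_regular := MxRepresentation right_regular_mx_repr.

(** The row space of [lmx e] consists of the coordinates of the right ideal generated by [e]. It is
    stable under the group because left and right multiplications commute. *)
Lemma right_ideal_repr e : exists (d : nat)
    (r : mx_representation F [set: gT] d) (W : 'M[F]_(d, #|gT|)),
  [/\ d = \rank (lmx e), row_free W, (W <= lmx e)%MS &
      forall g, r g *m W = W *m rmx (gel g)].
Proof.
have modU : mxmodule right_regular (lmx e).
  by apply/mxmoduleP=> g _ /=; rewrite lrmxC submxMl.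
have [r [W [Wfree WU rW]]] := submodule_repr modU.
exists (\rank (lmx e)), r, W; split=> // [|g]; first by rewrite WU.
by rewrite rW ?inE.
Qed.

Lemma commuting_corner e : commuting_idempotent e ->
  forall x y, (e * x * e) * (e * y * e) = (e * y * e) * (e * x * e).
Proof.
move=> [ee eC]; have eE z : e * z * e = \sum_g z g *: (e * gel g * e).
  rewrite {1}[z]galg_sum mulr_sumr mulr_suml; apply: eq_bigr => g _.
  by rewrite -scalerAr -scalerAl.
have commZ a u v : GRing.comm u v -> GRing.comm u (a *: v :> A).
  by move=> uv; rewrite /GRing.comm -scalerAr -scalerAl uv.
move=> x y; rewrite (eE x) (eE y); apply: commr_sum => h _; apply/commZ.
by apply/commr_sym/commr_sum => g _; apply/commZ/commr_sym.
Qed.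

End RegularModule.

Section Descent.
Variables (K C : fieldType) (iota : {rmorphism K -> C}) (gT : finGroupType).
Hypothesis K0 : [pchar K] =i pred0.
Let C0 : [pchar C] =i pred0. Proof. by move=> x; rewrite (fmorph_pchar iota) K0. Qed.
Local Notation repC := (mx_representation C [set: gT]).
Local Notation repK := (mx_representation K [set: gT]).
Local Notation up := (gmap iota).

Definition has_character n (V : repC n) (tau : gT -> K) : Prop :=
  forall g, \tr (V g) = iota (tau g).

Definition ftrace (tau : gT -> K) (x : galg K gT) : K := \sum_g x g * tau g.

Lemma ftraceE n (V : repC n) tau x : has_character V tau ->
  \tr (gmx V (up x)) = iota (ftrace tau x).
Proof.
move=> Vt; rewrite /gmx raddf_sum rmorph_sum; apply: eq_bigr => g _ /=.
by rewrite mxtraceZ Vt gmapE rmorphM.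
Qed.

(** Nondegeneracy of the trace form on the corner of [e]. Being expressed by [tau] alone, it is a
    condition over [K], and linear algebra transports it to [C]. *)
Definition trace_faithful (tau : gT -> K) (e : galg K gT) : Prop :=
  forall x, (forall y, ftrace tau (e * x * e * y) = 0) -> e * x * e = 0.

(* Take e of minimal rank among the idempotents with commutative corner that act
   nontrivially on V: if the trace form of e K[G] e had a kernel, regularity would
   give an idempotent z of that kernel, which acts as 0 on V because its trace
   vanishes, and e - z would have smaller rank. *)
Lemma trace_faithful_idempotent n (V : repC n) tau
    (s : seq (galg K gT * galg K gT * galg K gT)) :
    (0 < n)%N -> has_character V tau ->
    (forall u, u \in s -> commuting_idempotent u.1.2) ->
    \sum_(u <- s) u.1.1 * u.1.2 * u.2 = 1 ->
  exists e, [/\ commuting_idempotent e, e != 0 & trace_faithful tau e].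
Proof.
move=> n0 Vt s_com s1; pose gm x := gmx V (up x).
have gmM x y : gm (x * y) = gm x *m gm y by rewrite /gm !rmorphM.
have gm0 : gm 0 = 0 by rewrite /gm !rmorph0.
pose P m := `[< exists e, [/\ commuting_idempotent e, gm e != 0 & \rank (lmx e) = m] >].
have exP : exists m, P m.
  suff [e [ec e0]] : exists e, commuting_idempotent e /\ gm e != 0.
    by exists (\rank (lmx e)); apply/asboolP; exists e.
  apply: contrapT => noe.
  have : gm 1 == 0.
    rewrite -s1 /gm !raddf_sum big_seq big1 // => u us /=.
    have u0 : gm u.1.2 = 0.
      apply/eqP; apply: contraT => u0; case: noe; exists u.1.2.
      by split=> //; apply: s_com.
    by rewrite -/(gm _) !gmM u0 mulmx0 mul0mx.
  rewrite /gm !rmorph1; case: (n) n0 => // m _.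
  by rewrite oner_eq0.
case: (ex_minnP exP) => m /asboolP[e [ec e0 <-]] m_min.
have [ee _] := ec.
exists e; split=> //; first by apply: contra_neq e0 => ->; rewrite gm0.
move=> x xT; set z0 := e * x * e; apply/eqP; apply: contraT => z0_neq0.
have ez0 : e * z0 = z0 by rewrite /z0 !mulrA ee.
have {}xT y : ftrace tau (z0 * y) = 0 := xT y.
clearbody z0; have [w zwz] := galg_regular z0 K0.
have [z [ez ze zz z_neq0 gz]] : exists z,
    [/\ e * z = z, z * e = z, z * z = z, z != 0 & gm z = 0].
  have zz0 : z0 * w * e * z0 = z0 by rewrite -mulrA ez0.
  have zz : (z0 * w * e) * (z0 * w * e) = z0 * w * e by rewrite !mulrA zz0.
  exists (z0 * w * e); split=> //.
  - by rewrite !mulrA ez0.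
  - by rewrite -mulrA ee.
  - by apply: contra_neq z0_neq0 => z00; rewrite -zz0 z00 mul0r.
  apply: idempotent_trace0 => //; first by rewrite -gmM zz.
  by rewrite (ftraceE _ Vt) -mulrA xT rmorph0.
pose e2 := e - z.
have ee2 : e * e2 = e2 by rewrite mulrBr ee ez.
have e2e : e2 * e = e2 by rewrite mulrBl ee ze.
have e22 : e2 * e2 = e2 by rewrite {1}/e2 mulrBl ee2 mulrBr ze zz subrr subr0.
have e2c : commuting_idempotent e2.
  split=> // g h.
  have corner y : e2 * y * e2 = e * (e2 * y * e2) * e.
    by rewrite !mulrA ee2 -!mulrA e2e.
  by rewrite /GRing.comm (corner (gel g)) (corner (gel h)) commuting_corner.
have ge2 : gm e2 != 0 by rewrite /gm !raddfB /= -!/(gm _) gz subr0.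
have sub : (lmx e2 <= lmx e)%MS by rewrite -ee2 lmxM submxMl.
have : (\rank (lmx e) <= \rank (lmx e2))%N by apply/m_min/asboolP; exists e2.
rewrite (geq_leqif (mxrank_leqif_sup sub)) => /submxP[D eD].
have : lmx e2 = lmx e by rewrite -[in LHS]e2e lmxM eD -mulmxA -lmxM e22.
move/(congr1 (fun M => ungvec (gvec 1 *m M))); rewrite -!gvecMl !gvecK !mulr1.
by rewrite /e2 => /eqP; rewrite -subr_eq0 addrAC subrr sub0r oppr_eq0 (negPf z_neq0).
Qed.

(* The Gram matrix of the trace form has its entries in K. *)
Lemma trace_faithful_extension n (V : repC n) tau e :
    e * e = e -> has_character V tau -> trace_faithful tau e ->
  forall x, gmx V (up e * x * up e) = 0 -> up e * x * up e = 0.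
Proof.
move=> ee Vt ef.
pose t := \matrix_(i, j < #|gT|)
  ftrace tau (e * gel (enum_val i) * e * gel (enum_val j)).
pose E := lmx e *m rmx e.
have ftrace_sum (J : finType) (F : J -> galg K gT) :
    ftrace tau (\sum_i F i) = \sum_i ftrace tau (F i).
  rewrite /ftrace exchange_big; apply: eq_bigr => g _ /=.
  by rewrite sum_ffunE mulr_suml.
have ftraceZ a x : ftrace tau (a *: x) = a * ftrace tau x.
  by rewrite /ftrace mulr_sumr; apply: eq_bigr => g _; rewrite galgZ mulrA.
have tE x j : (gvec x *m t) 0 j = ftrace tau (e * x * e * gel (enum_val j)).
  rewrite {2}[x]galg_sum mulr_sumr !mulr_suml ftrace_sum mxE.
  rewrite [RHS](reindex (@enum_val gT gT)) /=; last by apply: onW_bij; exact: enum_val_bij.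
  by apply: eq_bigr => i _; rewrite !mxE -scalerAr -!scalerAl ftraceZ.
have ker_t (v : 'rV_#|gT|) : v *m t = 0 -> v *m E = 0.
  rewrite -[v]ungvecK => vt; rewrite mulmxA -gvecMl -gvecMr ef ?raddf0 // => y.
  rewrite [y]galg_sum mulr_sumr ftrace_sum big1 // => g _.
  rewrite -scalerAr ftraceZ -[g]enum_rankK -tE vt mxE mulr0.
  by [].
(* The inclusion of the kernel of [t] in that of [E] becomes a factorization of [E] through [t], an
   identity preserved by the extension to [C]. *)
have tD : E = t *m (pinvmx t *m E).
  have : (1%:M - t *m pinvmx t) *m E = 0.
    apply/row_matrixP=> i; rewrite row_mul ker_t ?row0 // -row_mul.
    by rewrite mulmxBl mul1mx mulmxKpV // subrr row0.
  by rewrite mulmxBl mul1mx mulmxA => /eqP; rewrite subr_eq0 => /eqP.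
move=> x xV; apply: (can_inj (@gvecK C gT)).
have upE : map_mx iota E = lmx (up e) *m rmx (up e).
  rewrite map_mxM; congr (_ *m _).
    by apply/matrixP=> i j; rewrite !mxE gmapE.
  by apply/matrixP=> i j; rewrite !mxE gmapE.
rewrite raddf0 gvecMr gvecMl -mulmxA -upE tD map_mxM mulmxA.
have -> : gvec x *m map_mx iota t = 0; last by rewrite mul0mx.
apply/rowP=> j; rewrite !mxE.
transitivity (\tr (gmx V (up e * x * up e * gel (enum_val j)))); last first.
  by rewrite rmorphM /= gmx_gel xV mul0r mxtrace0.
rewrite [X in gmx V (_ * X * _ * _)]galg_sum mulr_sumr !mulr_suml gmx_sum raddf_sum /=.
rewrite [RHS](reindex (@enum_val gT gT)) /=; last by apply: onW_bij; exact: enum_val_bij.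
apply: eq_bigr => i _; rewrite !mxE -scalerAr -!scalerAl gmxZ mxtraceZ.
by rewrite -(ftraceE _ Vt) !rmorphM /= !gmap_gel.
Qed.

(* A vector v for which x |-> v (e x e) has maximal rank. *)
Lemma separating_vector n (V : repC n) (e : galg C gT) :
    commuting_idempotent e ->
    (forall x, gmx V (e * x * e) = 0 -> e * x * e = 0) ->
  exists2 v : 'rV_n, v *m gmx V e = v &
    forall x, v *m gmx V (e * x * e) = 0 -> e * x * e = 0.
Proof.
move=> e_com e_faith; have [ee _] := e_com.
have eC := commuting_corner e_com.
have VM x y : gmx V (x * y) = gmx V x *m gmx V y by rewrite rmorphM.
pose S (v : 'rV_n) := \matrix_(i < #|gT|) (v *m gmx V (e * gel (enum_val i) * e)).
have SE v x : gvec x *m S v = v *m gmx V (e * x * e).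
  rewrite {2}[x]galg_sum mulr_sumr mulr_suml gmx_sum mulmx_sumr.
  rewrite [RHS](reindex (@enum_val gT gT)) /=; last by apply: onW_bij; exact: enum_val_bij.
  rewrite mulmx_sum_row; apply: eq_bigr => i _.
  by rewrite mxE rowK -scalerAr -scalerAl gmxZ -scalemxAr.
pose P m := `[< exists2 v : 'rV_n, v *m gmx V e = v & \rank (S v) = m >].
have exP : exists m, P m.
  by exists (\rank (S 0)); apply/asboolP; exists 0; rewrite ?mul0mx.
have leP m : P m -> (m <= n)%N by move=> /asboolP[v _ <-]; apply: rank_leq_col.
case: (ex_maxnP exP leP) => m /asboolP[v ve <-] v_max.
exists v => // x vx; apply/eqP; apply: contraT => z0_neq0.
have [w zwz] := galg_regular (e * x * e) C0.
have [z [ez ze zz z_neq0 vz]] : exists z,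
    [/\ e * z = z, z * e = z, z * z = z, z != 0 & v *m gmx V z = 0].
  have ez0 : e * (e * x * e) = e * x * e by rewrite !mulrA ee.
  move: (e * x * e) zwz ez0 z0_neq0 vx => z0 zwz ez0 z0_neq0 vz0.
  have zz0 : z0 * w * e * z0 = z0 by rewrite -mulrA ez0.
  have zz : (z0 * w * e) * (z0 * w * e) = z0 * w * e by rewrite !mulrA zz0.
  exists (z0 * w * e); split=> //.
  - by rewrite !mulrA ez0.
  - by rewrite -mulrA ee.
  - by apply: contra_neq z0_neq0 => z00; rewrite -zz0 z00 mul0r.
  by rewrite -mulrA VM mulmxA vz0 mul0mx.
have eze : e * z * e = z by rewrite ez ze.
have Vz : gmx V z != 0.
  by apply: contra_neq z_neq0 => Vz; rewrite -eze e_faith // eze.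
(* A nonzero vector [w1] of V z is added to [v]. If a corner element kills [v + w1], then
   multiplying by [z], which commutes with it and kills [v], shows that it kills [w1] and hence [v].
   The kernel therefore shrinks, strictly so because [z] leaves it, against the maximality of the
   rank. *)
have [i wi] : exists i, row i (gmx V z) != 0.
  apply: contrapT => no_i; case/eqP: Vz; apply/row_matrixP=> i; rewrite row0.
  by apply/eqP; apply: contraT => Vzi; case: no_i; exists i.
pose w1 := row i (gmx V z).
have w1z : w1 *m gmx V z = w1 by rewrite /w1 -row_mul -VM zz.
have w1e : w1 *m gmx V e = w1 by rewrite /w1 -row_mul -VM ze.
have : (\rank (S (v + w1)%R) <= \rank (S v))%N.
  apply: v_max; apply/asboolP; exists (v + w1) => //.
  by rewrite mulmxDl ve w1e.
have sub : (kermx (S (v + w1)%R) <= kermx (S v))%MS.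
  apply/rV_subP=> y /sub_kermxP; rewrite -[y]ungvecK !SE.
  move: (ungvec y) => {}y vy; apply/sub_kermxP; rewrite SE.
  suff w1y : w1 *m gmx V (e * y * e) = 0 by rewrite mulmxDl w1y addr0 in vy.
  have := congr1 (mulmxr (gmx V z)) vy; rewrite /= mul0mx => <-.
  by rewrite -mulmxA -VM -[z in RHS]eze eC eze [in RHS]VM [in RHS]mulmxA mulmxDl vz add0r w1z.
rewrite leqNgt; case/negP.
have : (kermx (S (v + w1)%R) < kermx (S v))%MS.
  rewrite ltmxE sub /=; apply/negP=> sub'.
  have /sub_kermxP : (gvec z <= kermx (S (v + w1)%R))%MS.
    by apply: submx_trans sub'; apply/sub_kermxP; rewrite SE eze.
  by rewrite SE eze mulmxDl vz add0r w1z; apply/eqP.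
move/rank_ltmx; rewrite !mxrank_ker.
have r1 := rank_leq_row (S (v + w1)); have r2 := rank_leq_row (S v).
by rewrite -(ltn_add2r (\rank (S (v + w1)))) subnK // -(ltn_add2r (\rank (S v)))
  addnAC subnK // ltn_add2l.
Qed.

(** The representation [r] is fixed before [V], so that its trace can be subtracted from [tau] in an
    induction on the character alone. *)
Lemma trace_faithful_embedding tau e :
    commuting_idempotent e -> trace_faithful tau e ->
  exists (d : nat) (r : repK d), d = \rank (lmx e) /\
    forall n (V : repC n), has_character V tau ->
    exists2 M : 'M_(d, n), row_free M &
      forall g, map_mx iota (r g) *m M = M *m V g.
Proof.
move=> e_com e_faith; have [ee _] := e_com.
have [d [r [W [dE Wfree We rW]]]] := right_ideal_repr e.
exists d, r; split=> // n V Vt.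
have eu_com : commuting_idempotent (up e).
  have [_ eC] := e_com; split=> [|g h]; first by rewrite -rmorphM ee.
  by rewrite /GRing.comm -!(gmap_gel iota) -!rmorphM /= eC.
have [v ve v_sep] := separating_vector eu_com
  (trace_faithful_extension ee Vt e_faith).
have VM x y : gmx V (x * y) = gmx V x *m gmx V y by rewrite rmorphM.
(* Passage from the corner to the right ideal: if [v] kills [x], it kills every corner element
   [x * y * up e], so all of these vanish, and the regularity relation [x = x * w * x] forces
   [x = 0]. *)
have v_inj x : up e * x = x -> v *m gmx V x = 0 -> x = 0.
  move=> ex vx; have [w xwx] := galg_regular x C0.
  have xy y : x * y * up e = 0.
    have := v_sep (x * y); rewrite (mulrA (up e)) ex !VM !mulmxA vx !mul0mx.
    exact.
  by rewrite -xwx -[X in _ * X]ex mulrA xy mul0r.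
pose T := \matrix_(i < #|gT|) (v *m V (enum_val i)).
have TE x : gvec x *m T = v *m gmx V x.
  rewrite {2}[x]galg_sum gmx_sum mulmx_sumr.
  rewrite [RHS](reindex (@enum_val gT gT)) /=; last by apply: onW_bij; exact: enum_val_bij.
  rewrite mulmx_sum_row; apply: eq_bigr => i _.
  by rewrite mxE rowK gmxZ -scalemxAr gmx_gel.
have up_lmx : map_mx iota (lmx e) = lmx (up e).
  by apply/matrixP=> i j; rewrite !mxE gmapE.
have up_rmx g : map_mx iota (rmx (gel g)) = rmx (gel g).
  by apply/matrixP=> i j; rewrite !mxE !ffunE rmorph_nat.
exists (map_mx iota W *m T) => [|g].
  apply: inj_row_free => u; rewrite mulmxA => uT.
  have uW : u *m map_mx iota W *m lmx (up e) = u *m map_mx iota W.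
    have /submxP[D ->] := We; rewrite map_mxM up_lmx -!mulmxA -lmxM -rmorphM.
    by rewrite ee.
  have : u *m map_mx iota W = 0.
    suff uW0 : ungvec (u *m map_mx iota W) = 0 by rewrite -[LHS]ungvecK uW0 raddf0.
    apply: v_inj; last by rewrite -TE ungvecK.
    by apply: (can_inj (@gvecK C gT)); rewrite gvecMl ungvecK.
  have WF : row_free (map_mx iota W) by rewrite row_free_map.
  by move=> uW0; apply: (row_free_inj WF); rewrite /= uW0 mul0mx.
rewrite mulmxA -map_mxM rW map_mxM -!mulmxA; congr (_ *m _); rewrite up_rmx.
apply/row_matrixP=> i; rewrite !rowE !mulmxA -[delta_mx 0 i]ungvecK -gvecMr !TE.
by rewrite VM gmx_gel mulmxA.
Qed.

End Descent.

Section CharacterDescent.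
Variables (K C : fieldType) (iota : {rmorphism K -> C}) (gT : finGroupType).
Hypothesis K0 : [pchar K] =i pred0.
Local Notation repC := (mx_representation C [set: gT]).
Local Notation repK := (mx_representation K [set: gT]).
Variable s : seq (galg K gT * galg K gT * galg K gT).
Hypothesis s_com : forall u, u \in s -> commuting_idempotent u.1.2.
Hypothesis s1 : \sum_(u <- s) u.1.1 * u.1.2 * u.2 = 1.

(** Since [rK] is chosen before [V], all representations of dimension [n] with character [tau] are
    isomorphic to one extension, hence to each other; this provides the fact that characters
    determine representations. When no representation affords [tau], the choice of [rK] is
    arbitrary, and the zero-dimensional one is taken. *)
Lemma character_descent n (tau : gT -> K) :
  exists m (rK : repK m), forall n' (V : repC n'), n' = n ->
    has_character iota V tau -> mx_rsim (map_repr iota rK) V.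
Proof.
have [N] := ubnP n; elim: N => // N IHN in n tau *; rewrite ltnS => nN.
have [->|n0] := posnP n.
  exists 0%N, (mx_repr_of_repr (@grepr0 K gT [set: gT]%G)) => n' V n'0 _.
  rewrite n'0 in V *; exists 1%:M => [|//|g _]; first by [].
  - by rewrite row_free_unit unitmx1.
  - by rewrite [LHS]flatmx0 [RHS]flatmx0.
have [[V0 V0t]|noV] := pselect (exists V0 : repC n, has_character iota V0 tau); last first.
  exists 0%N, (mx_repr_of_repr (@grepr0 K gT [set: gT]%G)) => n' V n'n Vt.
  by subst n'; case: noV; exists V.
have [e [e_com e0 e_faith]] := trace_faithful_idempotent K0 n0 V0t s_com s1.
have [d [r1 [dE emb]]] := trace_faithful_embedding iota K0 e_com e_faith.
have d0 : (0 < d)%N.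
  rewrite dE lt0n mxrank_eq0; apply: contra_neq e0 => e0.
  by rewrite -[e]gvecK -[e]mulr1 gvecMl e0 mulmx0; apply/ffunP=> g; rewrite !ffunE mxE.
have dn : (d <= n)%N.
  by have [M0 M0_free _] := emb _ V0 V0t; rewrite -(eqP M0_free) rank_leq_col.
have [|m2 [r2 r2P]] := IHN (n - d)%N (fun g => tau g - \tr (r1 g)).
  by rewrite (leq_trans _ nN) // ltn_subrL d0 n0.
exists (d + m2)%N, (mx_repr_of_repr (dadd_grepr (Representation r1) (Representation r2))).
move=> n' V n'n Vt; subst n'.
have [M1 M1_free M1_hom] := emb _ V Vt.
have C0 : [pchar C] =i pred0 by move=> x; rewrite (fmorph_pchar iota) K0.
have modM1 : mxmodule V <<M1>>%MS.
  apply/mxmoduleP=> g _; rewrite (eqmxMr _ (genmxE M1)) genmxE -M1_hom.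
  exact: submxMl.
have pG : ([pchar C]^'.-group [set: gT])%g.
  by apply/pgroupP=> q _ _; apply/negP; rewrite C0.
have [W modW addW dxW] := mx_Maschke_pchar V pG modM1 (submx1 _).
have [rW [B [B_free BW rB]]] := submodule_repr modW.
have rM1 : \rank <<M1>>%MS = d by rewrite genmxE; apply/eqP.
have rkW : (d + \rank W = n)%N.
  by have := mxdirectP dxW; rewrite /= rM1 addW mxrank1.
have col_free q (D : 'M_(q, \rank W)) : row_free D -> row_free (col_mx M1 (D *m B)).
  move=> D_free; rewrite /row_free -addsmxE mxrank_disjoint_sum.
    by rewrite !mxrankMfree // (eqP M1_free) (eqP D_free).
  apply/eqP; rewrite -submx0 -(mxdirect_addsP dxW) capmxS ?genmxE //.
  by rewrite (submx_trans (submxMl _ _)) // BW.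
have homW q (rq : mx_representation C [set: gT] q) (D : 'M_(q, \rank W)) :
    (forall g, rq g *m D = D *m rW g) ->
    forall g, block_mx (map_mx iota (r1 g)) 0 0 (rq g) *m col_mx M1 (D *m B) =
              col_mx M1 (D *m B) *m V g.
  move=> Dq g; rewrite mul_block_col mul_col_mx !mul0mx addr0 add0r M1_hom.
  by rewrite !mulmxA Dq -!mulmxA rB ?inE.
have simW : mx_rsim (mx_repr_of_repr (dadd_grepr (Representation (map_repr iota r1))
    (Representation rW))) V.
  exists (col_mx M1 (1%:M *m B)); first exact: rkW.
    by apply: col_free; rewrite row_free_unit unitmx1.
  by move=> g _; apply: homW => h; rewrite mulmx1 mul1mx.
have [||D m2W D_free Dhom] := r2P _ rW; first by apply/eqP; rewrite -(eqn_add2l d) rkW subnKC.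
  move=> g; rewrite rmorphB /= -Vt -(mxtrace_rsim simW) ?inE //=.
  by rewrite mxtrace_block map_reprE trace_map_mx addrC addKr.
exists (col_mx M1 (D *m B)) => [||g _]; last 2 first.
- exact: col_free.
- rewrite map_reprE /= map_block_mx !map_mx0.
  apply: (homW _ (map_repr iota r2)) => h.
  by rewrite -Dhom ?inE.
by rewrite m2W.
Qed.

End CharacterDescent.

(** * Descent of intertwiners and symplectic forms *)

Section UnitDescent.
Variables (K C : fieldType) (iota : {rmorphism K -> C}) (n : nat).
Hypothesis K0 : [pchar K] =i pred0.

(* The determinant of the generic element is a nonzero polynomial, so the
   coefficients may be replaced by natural numbers one at a time. *)
Lemma unit_descent (S : 'M[K]_n -> Prop) (J : Type) (B : J -> 'M[K]_n) :
    (forall A A', S A -> S A' -> S (A + A')) ->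
    (forall a A, S A -> S (a *: A)) -> (forall i, S (B i)) ->
  forall (r : seq J) (c : J -> C) A, S A ->
    map_mx iota A + \sum_(i <- r) c i *: map_mx iota (B i) \in unitmx ->
  exists2 N, S N & N \in unitmx.
Proof.
move=> SD SZ SB; elim=> [|i r IHr] c A SA.
  by rewrite big_nil addr0 map_unitmx => Au; exists A.
rewrite big_cons addrCA addrC; set X := map_mx iota A + _ => Xu.
pose p := \det (map_mx polyC X + 'X *: map_mx polyC (map_mx iota (B i))).
have pE t : p.[t] = \det (X + t *: map_mx iota (B i)).
  rewrite -[LHS]/(horner_eval t p) -det_map_mx; congr (\det _).
  by apply/matrixP=> j k; rewrite !mxE /= /horner_eval hornerD hornerM hornerX !hornerC.
have p0 : p != 0.
  apply: contraTneq Xu => p0.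
  by rewrite unitmxE -pE p0 horner0 unitr0.
have [k pk] : exists k : nat, p.[k%:R] != 0.
  apply: contrapT => nok.
  pose rs := [seq k%:R : C | k <- seq.iota 0 (size p)].
  have /(max_poly_roots p0) : all (root p) rs.
    apply/allP=> _ /mapP[k _ ->]; apply/rootP/eqP.
    by apply: contraT => pk; case: nok; exists k.
  have C0 : [pchar C] =i pred0 by move=> x; rewrite (fmorph_pchar iota) K0.
  suff rs_uniq : uniq rs by move/(_ rs_uniq); rewrite size_map size_iota ltnn.
  rewrite map_inj_uniq ?iota_uniq // => j k jk.
  wlog le_jk : j k jk / (j <= k)%N.
    by move=> H; have [/H|/ltnW/H] := leqP j k; [apply | move/(_ (esym jk))].
  apply/eqP; rewrite eqn_leq le_jk -subn_eq0 /=.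
  by rewrite -((pcharf0P _).1 C0) natrB // jk subrr.
apply: (IHr c (A + k%:R *: B i)); first by apply: SD => //; apply: SZ.
rewrite map_mxD map_mxZ rmorph_nat addrAC unitmxE -pE.
by rewrite unitfE.
Qed.

End UnitDescent.

Section FormDescent.
Variables (K C : fieldType) (iota : {rmorphism K -> C}) (gT : finGroupType).
Hypothesis K0 : [pchar K] =i pred0.
Local Notation repK := (mx_representation K [set: gT]).
Let C0 : [pchar C] =i pred0. Proof. by move=> x; rewrite (fmorph_pchar iota) K0. Qed.
Let natC m : (0 < m)%N -> m%:R != 0 :> C.
Proof. by rewrite ((pcharf0P _).1 C0) -lt0n. Qed.

(* Noether-Deuring *)
Lemma mx_rsim_descent n (r1 r2 : repK n) :
  mx_rsim (map_repr iota r1) (map_repr iota r2) -> mx_rsim r1 r2.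
Proof.
case=> M _ Mfree Mhom.
pose S (N : 'M[K]_n) := forall g, r1 g *m N = N *m r2 g.
(* Averages of elementary matrices span the intertwiners over [C] as well as over [K]. Averaging
   fixes [M], which is why its coefficients on the [B ij] are its entries divided by the order of
   the group. *)
pose B (ij : 'I_n * 'I_n) := \sum_g r1 g *m delta_mx ij.1 ij.2 *m r2 g^-1%g.
have [||ij|||N NS Nu] := @unit_descent _ _ iota n K0 S _ B _ _ _
    (index_enum _) (fun ij => #|gT|%:R^-1 * M ij.1 ij.2) 0.
- by move=> A A' AS AS' g; rewrite mulmxDr mulmxDl AS AS'.
- by move=> a A AS g; rewrite -scalemxAr -scalemxAl AS.
- move=> h; rewrite /B mulmx_sumr mulmx_suml (reindex_inj (mulgI h^-1%g)) /=.
  apply: eq_bigr => g _; rewrite !mulmxA -repr_mxM ?inE // mulKVg.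
  by rewrite -[RHS]mulmxA -repr_mxM ?inE // invMg invgK.
- by move=> g; rewrite mulmx0 mul0mx.
- rewrite map_mx0 add0r.
  suff -> : \sum_ij (#|gT|%:R^-1 * M ij.1 ij.2) *: map_mx iota (B ij) = M.
    by rewrite -row_free_unit.
  have MM : \sum_g map_mx iota (r1 g) *m M *m map_mx iota (r2 g^-1%g) = #|gT|%:R *: M.
    rewrite (eq_bigr (fun=> M)) => [|g _].
      by rewrite sumr_const -scaler_nat.
    rewrite -[map_mx iota (r1 g)]/(map_repr iota r1 g) Mhom ?inE // -mulmxA.
    by rewrite -map_mxM -repr_mxM ?inE // mulgV repr_mx1 map_mx1 mulmx1.
  have cG : #|gT|%:R != 0 :> C by apply: natC; apply/card_gt0P; exists 1%g.
  apply: (scalerI cG); rewrite -MM scaler_sumr.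
  under eq_bigr => ij _ do rewrite scalerA mulrA mulfV // mul1r map_mx_sum scaler_sumr.
  rewrite exchange_big; apply: eq_bigr => g _ /=.
  rewrite [in RHS](matrix_sum_delta M) pair_big mulmx_sumr mulmx_suml /=.
  apply: eq_bigr => -[i j] _ /=.
  by rewrite !map_mxM map_delta_mx -scalemxAr -scalemxAl.
by exists N; rewrite ?row_free_unit // => g _; apply: NS.
Qed.

Definition invariant_form n (F : fieldType) (r : mx_representation F [set: gT] n)
  (J : 'M[F]_n) : Prop := J^T = - J /\ forall g, (r g)^T *m J *m r g = J.

Lemma symplectic_form_descent n (r : repK n) (J : 'M[C]_n) :
    invariant_form (map_repr iota r) J -> J \in unitmx ->
  exists2 J' : 'M[K]_n, invariant_form r J' & J' \in unitmx.
Proof.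
move=> [Jalt Jinv] Ju.
(* With these antisymmetrized matrices, [J] is recovered as [J - J^T], which is twice [J]; hence the
   denominator [#|gT| * 2]. *)
pose D (ij : 'I_n * 'I_n) : 'M[K]_n := delta_mx ij.1 ij.2 - delta_mx ij.2 ij.1.
pose B ij := \sum_g (r g)^T *m D ij *m r g.
have [||ij|||N NS Nu] := @unit_descent _ _ iota n K0 (invariant_form r) _ B _ _ _
    (index_enum _) (fun ij => (#|gT| * 2)%:R^-1 * J ij.1 ij.2) 0.
- move=> A A' [Aalt AS] [A'alt AS']; split=> [|g].
    by rewrite linearD /= Aalt A'alt opprD.
  by rewrite mulmxDr mulmxDl AS AS'.
- move=> a A [Aalt AS]; split=> [|g]; first by rewrite linearZ /= Aalt scalerN.
  by rewrite -scalemxAr -scalemxAl AS.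
- split=> [|h].
    rewrite /B raddf_sum -sumrN; apply: eq_bigr => g _ /=.
    rewrite !trmx_mul trmxK mulmxA -mulNmx -mulmxN; congr (_ *m _ *m _).
    by rewrite /D raddfB /= !trmx_delta opprB.
  rewrite /B mulmx_sumr mulmx_suml [RHS](reindex_inj (mulIg h)) /=.
  apply: eq_bigr => g _; rewrite repr_mxM ?inE // trmx_mul !mulmxA.
  by [].
- by split=> [|g]; rewrite ?trmx0 ?oppr0 // mulmx0 mul0mx.
- rewrite map_mx0 add0r.
  suff -> : \sum_ij ((#|gT| * 2)%:R^-1 * J ij.1 ij.2) *: map_mx iota (B ij) = J by [].
  have JJ : \sum_g (map_mx iota (r g))^T *m (J - J^T) *m map_mx iota (r g) =
      (#|gT| * 2)%:R *: J.
    rewrite (eq_bigr (fun=> J *+ 2)) => [|g _].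
      by rewrite sumr_const -mulrnA -scaler_nat mulnC.
    rewrite Jalt opprK -mulr2n -scaler_nat -scalemxAr -scalemxAl.
    by have := Jinv g; rewrite map_reprE => ->.
  have cG : (#|gT| * 2)%:R != 0 :> C.
    by apply: natC; rewrite muln_gt0 andbT; apply/card_gt0P; exists 1%g.
  apply: (scalerI cG); rewrite -JJ scaler_sumr.
  under eq_bigr => ij _ do rewrite scalerA mulrA mulfV // mul1r map_mx_sum scaler_sumr.
  rewrite exchange_big; apply: eq_bigr => g _ /=.
  have -> : J - J^T = \sum_ij J ij.1 ij.2 *: map_mx iota (D ij).
    under eq_bigr => ij _ do rewrite map_mxB !map_delta_mx scalerBr.
    rewrite sumrB {1}(matrix_sum_delta J) pair_big; congr (_ - _).
    rewrite {1}(matrix_sum_delta J) pair_big raddf_sum; apply: eq_bigr => -[i j] _ /=.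
    by rewrite linearZ /= trmx_delta.
  rewrite mulmx_sumr mulmx_suml; apply: eq_bigr => ij _ /=.
  by rewrite !map_mxM map_trmx -scalemxAr -scalemxAl.
by exists N.
Qed.

End FormDescent.

Section SymplecticBasis.
Variables (F : fieldType) (n : nat) (J : 'M[F]_n).
Hypotheses (F0 : [pchar F] =i pred0) (Jalt : J^T = - J) (Ju : J \in unitmx).

Let formT k m (A : 'M_(k, n)) (B : 'M_(m, n)) :
  (A *m J *m B^T)^T = - (B *m J *m A^T).
Proof. by rewrite !trmx_mul trmxK Jalt mulNmx mulmxN mulmxA. Qed.

(** Symplectic Gram-Schmidt: the orthogonal of fewer than [n] rows contains some [v != 0], a partner
    [w0] is found by nondegeneracy, and correcting [w0] by the rows of [X] and [Y] does not change
    its pairing with [v]. *)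
Lemma hyperbolic_family k : (k + k <= n)%N -> exists X Y : 'M_(k, n),
  [/\ X *m J *m X^T = 0, X *m J *m Y^T = 1%:M & Y *m J *m Y^T = 0].
Proof.
elim: k => [|k IHk] kn.
  by exists 0, 0; split; apply/matrixP; case.
have [|X [Y [XX XY YY]]] := IHk; first by rewrite (leq_trans _ kn) // addSn addnS leqW // leqW.
have YX : Y *m J *m X^T = - 1%:M.
  by rewrite -[LHS]opprK -formT XY trmx1.
have [v [v0 vX vY]] : exists v : 'rV_n,
    [/\ v != 0, v *m J *m X^T = 0 & v *m J *m Y^T = 0].
  pose Z := J *m (col_mx X Y)^T.
  have /rowV0Pn[v /sub_kermxP vZ v0] : kermx Z != 0.
    rewrite -mxrank_eq0 mxrank_ker subn_eq0 -ltnNge.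
    by rewrite (leq_ltn_trans (rank_leq_col _)) // (leq_trans _ kn) // addSn addnS leqW.
  exists v; split=> //.
    have := congr1 lsubmx vZ; rewrite /Z tr_col_mx !mul_mx_row row_mxKl.
    by rewrite mulmxA => ->; apply/matrixP=> i j; rewrite !mxE.
  have := congr1 rsubmx vZ; rewrite /Z tr_col_mx !mul_mx_row row_mxKr.
  by rewrite mulmxA => ->; apply/matrixP=> i j; rewrite !mxE.
have [w0 vw0] : exists w0 : 'rV_n, v *m J *m w0^T = 1%:M.
  have /rV0Pn[i vi] : v *m J != 0.
    by apply: contra_neq v0 => vJ0; rewrite -(mulmxK Ju v) vJ0 mul0mx.
  exists (((v *m J) 0 i)^-1 *: delta_mx 0 i).
  rewrite linearZ /= trmx_delta -scalemxAr -colE.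
  move: (v *m J) vi => u ui.
  by apply/matrixP=> a b; rewrite !ord1 !mxE eqxx mulVf.
pose w := w0 - (w0 *m J *m Y^T) *m X + (w0 *m J *m X^T) *m Y.
have wE (Z : 'M_(n, k)) : w *m J *m Z = w0 *m J *m Z
    - (w0 *m J *m Y^T) *m (X *m J *m Z) + (w0 *m J *m X^T) *m (Y *m J *m Z).
  by rewrite /w !mulmxDl !mulNmx !mulmxA.
have wX : w *m J *m X^T = 0.
  by rewrite wE XX YX mulmx0 subr0 mulmxN mulmx1 subrr.
have wY : w *m J *m Y^T = 0.
  by rewrite wE XY YY mulmx0 addr0 mulmx1 subrr.
have vw : v *m J *m w^T = 1%:M.
  have -> : w^T = w0^T - X^T *m (w0 *m J *m Y^T)^T + Y^T *m (w0 *m J *m X^T)^T.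
    by rewrite -!trmx_mul -linearB -linearD.
  rewrite mulmxDr mulmxBr [v *m J *m (X^T *m _)]mulmxA [v *m J *m (Y^T *m _)]mulmxA.
  by rewrite vX vY !mul0mx subr0 addr0.
have self0 (u : 'rV_n) : u *m J *m u^T = 0.
  apply/matrixP=> i j; rewrite !ord1 [RHS]mxE.
  have := congr1 (fun M : 'M_1 => M 0 0) (formT u u); rewrite mxE [in RHS]mxE.
  move/eqP; rewrite -subr_eq0 opprK -mulr2n -mulr_natr mulf_eq0.
  by rewrite ((pcharf0P _).1 F0) orbF => /eqP.
have anti m (A : 'M_(m, n)) (u : 'rV_n) : u *m J *m A^T = 0 -> A *m J *m u^T = 0.
  by move=> uA; rewrite -[LHS]opprK -formT uA trmx0 oppr0.
suff : exists X' Y' : 'M_(1 + k, n), [/\ X' *m J *m X'^T = 0,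
    X' *m J *m Y'^T = 1%:M & Y' *m J *m Y'^T = 0] by [].
exists (col_mx v X), (col_mx w Y); split.
- rewrite tr_col_mx mul_col_mx mul_col_row self0 vX XX (anti _ _ _ vX).
  by rewrite block_mx0.
- rewrite tr_col_mx mul_col_mx mul_col_row vw vY XY (anti _ _ _ wX).
  by rewrite -scalar_mx_block.
rewrite tr_col_mx mul_col_mx mul_col_row self0 wY YY (anti _ _ _ wY).
by rewrite block_mx0.
Qed.

End SymplecticBasis.

Lemma symplectic_form_unit (F : fieldType) a : symplectic_form F a \in unitmx.
Proof.
have : symplectic_form F a *m (- symplectic_form F a) = 1%:M.
  rewrite /symplectic_form mulmxN mulmx_block !(mul0mx, mulmx0, mul1mx, mulmx1, add0r, addr0).
  by rewrite opp_block_mx !opprK oppr0 -scalar_mx_block.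
by case/mulmx1_unit.
Qed.

Lemma symplectic_formT (F : fieldType) a :
  (symplectic_form F a)^T = - symplectic_form F a.
Proof.
by rewrite /symplectic_form tr_block_mx linearN /= !trmx0 trmx1 opp_block_mx oppr0 opprK.
Qed.

Lemma symplectic_basis (F : fieldType) a (J : 'M[F]_(a + a)) :
    [pchar F] =i pred0 -> J^T = - J -> J \in unitmx ->
  exists2 P, P \in unitmx & P^T *m J *m P = symplectic_form F a.
Proof.
move=> F0 Jalt Ju.
have [X [Y [XX XY YY]]] := hyperbolic_family F0 Jalt Ju (leqnn (a + a)).
have PJP : (col_mx X Y) *m J *m (col_mx X Y)^T = symplectic_form F a.
  rewrite tr_col_mx mul_col_mx mul_col_row XX XY YY; congr (block_mx _ _ _ _).
  by apply: trmx_inj; rewrite !trmx_mul trmxK Jalt mulNmx mulmxN mulmxA XY linearN /= trmx1.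
exists (col_mx X Y)^T; last by rewrite trmxK.
have := symplectic_form_unit F a; rewrite -PJP !unitmx_mul => /andP[].
by [].
Qed.

(** * Characteristic polynomials *)

Lemma char_poly_similar (F : fieldType) n (P A B : 'M[F]_n) :
  P \in unitmx -> P *m A = B *m P -> char_poly A = char_poly B.
Proof.
move=> Pu PA; pose Q := map_mx polyC P.
have Qu : \det Q != 0.
  by rewrite det_map_mx polyC_eq0 -unitfE -unitmxE.
have : Q *m char_poly_mx A = char_poly_mx B *m Q.
  rewrite /char_poly_mx mulmxBr mulmxBl -!map_mxM PA.
  by rewrite scalar_mxC.
move/(congr1 determinant); rewrite !det_mulmx mulrC => /(mulIf Qu).
by [].
Qed.

(** The [Q i] are the cofactors of the product, one for each position, so that repeated roots are
    counted with multiplicity. *)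
Lemma deriv_prod_XsubC (R : comNzRingType) (rs : seq R) :
  exists Q : nat -> {poly R},
    (forall i, (i < size rs)%N -> \prod_(z <- rs) ('X - z%:P) = ('X - (rs`_i)%:P) * Q i) /\
    (\prod_(z <- rs) ('X - z%:P))^`() = \sum_(i < size rs) Q i.
Proof.
elim: rs => [|w rs [Q [QE Qd]]].
  by exists (fun=> 0); split=> //; rewrite big_nil big_ord0 derivC.
exists (fun i => if i is i'.+1 then ('X - w%:P) * Q i' else \prod_(z <- rs) ('X - z%:P)).
split=> [[|i] /= ri|]; rewrite ?big_cons //.
  by rewrite (QE i) // mulrCA.
rewrite derivM derivXsubC mul1r Qd big_ord_recl /=; congr (_ + _).
by rewrite mulr_sumr.
Qed.

(* Newton's identities, in the form that determines all coefficients from the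
   power sums of the roots. *)
Lemma newton_coef (R : comNzRingType) (rs : seq R) m
    (P := \prod_(z <- rs) ('X - z%:P)) :
  P`_m.+1 *+ m.+1 =
    \sum_(k < size P) P`_(m + k).+1 * \sum_(i < size rs) rs`_i ^+ k.
Proof.
have [Q [QE Qd]] := deriv_prod_XsubC rs.
have sP : size P = (size rs).+1 by rewrite /P size_prod_XsubC.
have coefQ i : (i < size rs)%N ->
    (Q i)`_m = \sum_(k < size P) P`_(m + k).+1 * rs`_i ^+ k.
  move=> ri; have PE := QE i ri.
  (* Synthetic division by the i-th linear factor. The recursion telescopes, and its remainder
     vanishes beyond the degree of [Q i]. *)
  have step j : P`_j.+1 = (Q i)`_j - rs`_i * (Q i)`_j.+1.
    by rewrite /P PE mulrBl coefB coefXM mulrC coefMC mulrC.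
  have tel N : \sum_(k < N) P`_(m + k).+1 * rs`_i ^+ k =
      (Q i)`_m - rs`_i ^+ N * (Q i)`_(m + N).
    elim: N => [|N IHN]; first by rewrite big_ord0 addn0 mul1r subrr.
    by rewrite big_ord_recr /= IHN step addnS exprSr; ring.
  rewrite tel [X in _ - _ * X]nth_default ?mulr0 ?subr0 //.
  have Q0 : Q i != 0.
    by apply/eqP=> Q0; have := sP; rewrite /P PE Q0 mulr0 size_poly0.
  have : size P = (size (Q i)).+1.
    by rewrite /P PE mulrC size_Mmonic ?monicXsubC // size_XsubC addn2.
  by move=> ->; rewrite addnS leqW // leq_addl.
rewrite -coef_deriv Qd coef_sum.
under eq_bigr => i _ do rewrite coefQ //.
rewrite exchange_big; apply: eq_bigr => k _ /=.
by rewrite mulr_sumr.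
Qed.

Section RationalCharPoly.
Variable C : numClosedFieldType.

Definition is_rat (x : C) : Prop := exists q : rat, x = ratr q.

Lemma is_ratD x y : is_rat x -> is_rat y -> is_rat (x + y).
Proof. by move=> [q ->] [r ->]; exists (q + r); rewrite rmorphD. Qed.
Lemma is_ratM x y : is_rat x -> is_rat y -> is_rat (x * y).
Proof. by move=> [q ->] [r ->]; exists (q * r); rewrite rmorphM. Qed.
Lemma is_ratN x : is_rat x -> is_rat (- x).
Proof. by move=> [q ->]; exists (- q); rewrite rmorphN. Qed.
Lemma is_ratV x : is_rat x -> is_rat x^-1.
Proof. by move=> [q ->]; exists q^-1; rewrite fmorphV. Qed.
Lemma is_rat_nat n : is_rat n%:R.
Proof. by exists n%:R; rewrite rmorph_nat. Qed.
Lemma is_rat_sum (J : Type) (r : seq J) (P : pred J) (F : J -> C) :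
  (forall i, P i -> is_rat (F i)) -> is_rat (\sum_(i <- r | P i) F i).
Proof.
move=> FP; elim/big_ind: _ => //; first exact: (is_rat_nat 0).
exact: is_ratD.
Qed.

Lemma rational_polyP (p : {poly C}) : (forall i, is_rat p`_i) -> rational_poly p.
Proof.
move=> pr; have [q qE] : exists q : 'I_(size p) -> rat, forall i : 'I_(size p), p`_i = ratr (q i).
  by apply: (@fin_all_exists _ (fun=> rat)
    (fun (i : 'I_(size p)) q => p`_i = ratr q)) => i; apply: pr.
exists (\poly_(i < size p) if insub i is Some j then q j else 0).
apply/polyP=> i; rewrite coef_map coef_poly.
have [ip|ip] := ltnP i (size p); last by rewrite nth_default // raddf0.
by rewrite insubT /= -qE.
Qed.

(* [newton_coef] misses the constant coefficient, hence the additional root 0 in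
   the proof. *)
Lemma prod_XsubC_rational (rs : seq C) :
    (forall k, (0 < k)%N -> is_rat (\sum_(i < size rs) rs`_i ^+ k)) ->
  rational_poly (\prod_(z <- rs) ('X - z%:P)).
Proof.
move=> rs_rat; pose rs0 := 0 :: rs; pose P := \prod_(z <- rs0) ('X - z%:P).
have PE : P = 'X * \prod_(z <- rs) ('X - z%:P).
  by rewrite /P big_cons subr0.
have sP : size P = (size rs0).+1 by rewrite /P size_prod_XsubC.
have rs0_rat k : (0 < k)%N -> is_rat (\sum_(i < size rs0) rs0`_i ^+ k).
  by move=> k0; rewrite big_ord_recl /= expr0n gtn_eqF // add0r; apply: rs_rat.
suff Prat d m : (size P <= m.+1 + d)%N -> is_rat P`_m.+1.
  apply: rational_polyP => i; have := Prat (size P) i (leq_addl _ _).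
  by rewrite PE coefXM.
elim: d m => [|d IHd] m mP.
  by rewrite addn0 in mP; rewrite nth_default //; apply: (is_rat_nat 0).
have newt : P`_m.+1 *+ m.+1 = \sum_(k < size P) P`_(m + k).+1 *
    \sum_(i < size rs0) rs0`_i ^+ k := newton_coef rs0 m.
rewrite sP big_ord_recl addn0 in newt.
(* The term [k = 0] of Newton's identity is the unknown coefficient times the number of roots. Moved
   to the left it leaves the factor [m.+1 - size rs0], which vanishes only at the leading
   coefficient, known to be 1. *)
have [m_top|m_top] := eqVneq m.+1 (size rs0).
  have -> : P`_m.+1 = lead_coef P by rewrite m_top lead_coefE sP.
  by rewrite (eqP (monic_prod_XsubC _ _ _)); apply: (is_rat_nat 1).
pose c : C := m.+1%:R - (size rs0)%:R.
have c0 : c != 0 by rewrite subr_eq0 eqr_nat.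
have -> : P`_m.+1 = c^-1 * (P`_m.+1 * c) by rewrite mulrC mulfK.
apply: is_ratM; first by apply/is_ratV/is_ratD; [|apply: is_ratN]; apply: is_rat_nat.
rewrite mulrBr mulr_natr newt (eq_bigr (fun=> 1)) => [|i _]; last by rewrite expr0.
rewrite sumr_const card_ord addrAC subrr add0r.
apply: is_rat_sum => k _; apply: is_ratM; last exact: rs0_rat.
by apply: IHd; rewrite addSn -addnS (leq_trans mP) // !addSn !addnS !ltnS leq_add2r leq_addr.
Qed.

Lemma trig_mulmx n (A B : 'M[C]_n) : is_trig_mx A -> is_trig_mx B ->
  is_trig_mx (A *m B) /\ forall i, (A *m B) i i = A i i * B i i.
Proof.
move=> /is_trig_mxP tA /is_trig_mxP tB; split=> [|i].
  apply/is_trig_mxP=> i j ij; rewrite mxE big1 // => k _.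
  have [ik|ki] := ltnP i k; first by rewrite tA // mul0r.
  by rewrite tB ?mulr0 // (leq_ltn_trans ki).
rewrite mxE (bigD1 i) //= big1 ?addr0 // => k ki.
have [ik|] := ltnP i k; first by rewrite tA // mul0r.
by move=> ki'; rewrite tB ?mulr0 // ltn_neqAle ki' andbT.
Qed.

Lemma char_poly_rational n (M : 'M[C]_n) :
  (forall k, is_rat (\tr (M ^+ k))) -> rational_poly (char_poly M).
Proof.
move=> Mrat; have [P P_unitary] : cotrigonalizable_in (@unitarymx C n n) [:: M].
  by apply: cotrigonalization => A B; rewrite !inE => /eqP-> /eqP->.
have Pu := unitarymx_unit P_unitary.
rewrite /= andbT => trigPM; set T := conjmx P M in trigPM.
have PT : P *m M = T *m P by rewrite /T conjumx // mulmxKV.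
have PTk k : P *m M ^+ k = T ^+ k *m P.
  elim: k => [|k IHk]; first by rewrite !expr0 mulmx1 mul1mx.
  by rewrite !exprS mulmxA PT -!mulmxA IHk.
have Tk k : is_trig_mx (T ^+ k) /\ forall i, (T ^+ k) i i = T i i ^+ k.
  elim: k => [|k [IHk IHk']]; first by split=> [|i]; rewrite ?scalar_mx_is_trig // mxE eqxx.
  rewrite exprS; have [t1 t2] := trig_mulmx trigPM IHk.
  by split=> // i; rewrite t2 IHk' exprS.
rewrite (char_poly_similar Pu PT) (char_poly_trig trigPM).
pose rs := [seq T i i | i : 'I_n].
have -> : \prod_(i < n) ('X - (T i i)%:P) = \prod_(z <- rs) ('X - z%:P).
  by rewrite big_image.
apply: prod_XsubC_rational => k _.
suff -> : \sum_(i < size rs) rs`_i ^+ k = \tr (M ^+ k) by [].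
have -> : \sum_(i < size rs) rs`_i ^+ k = \sum_(z <- rs) z ^+ k.
  by rewrite (big_nth 0) big_mkord.
rewrite big_image /= -(mulKmx Pu (M ^+ k)) PTk mxtrace_mulC mulmxK //.
by apply: eq_bigr => i _; have [_ ->] := Tk k.
Qed.

(** Roots may be repeated, so [q] need not divide X^m - 1. Its gcd with X^m - 1 is nonconstant and,
    by Gauss's lemma, integral once made monic; it is divided out and the quotient is handled by
    induction on the size. *)
Lemma monic_unity_roots_integral m (q : {poly rat}) : (0 < m)%N -> q \is monic ->
    (forall z : C, root (map_poly ratr q) z -> z ^+ m = 1) ->
  exists r : {poly int}, q = map_poly intr r.
Proof.
move=> m0; have [N] := ubnP (size q); elim: N q => // N IHN q; rewrite ltnS => qN q_mon q_roots.
have [q1|q1] := eqVneq (size q) 1.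
  exists 1; rewrite rmorph1; have /size_poly1P[c c0 qc] : size q == 1 by apply/eqP.
  by move: q_mon; rewrite qc monicE lead_coefC => /eqP->.
have [z qz] : exists z : C, root (map_poly ratr q) z.
  by apply/closed_rootP; rewrite size_map_poly.
pose u : {poly rat} := 'X^m - 1.
have uz : root (map_poly ratr u) z.
  by rewrite /u rmorphB rmorph1 /= map_polyXn rootE !hornerE q_roots ?subrr.
pose g := gcdp q u.
have gz : root (map_poly ratr g) z by rewrite gcdp_map root_gcd qz uz.
have uE : u = map_poly intr ('X^m - 1 : {poly int}).
  by rewrite /u rmorphB rmorph1 /= map_polyXn.
have : g %| map_poly intr ('X^m - 1 : {poly int}) by rewrite -uE dvdp_gcdr.
case/dvdpP_rat_int => p1 [c c0 gE] [r1 p1r1].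
have lp : lead_coef p1 * lead_coef r1 = 1.
  rewrite -lead_coefM -p1r1; apply/eqP; rewrite -monicE monicXnsubC //.
have p1u : lead_coef p1 * lead_coef p1 = 1.
  have : lead_coef p1 \is a GRing.unit by apply/unitrP; exists (lead_coef r1); rewrite mulrC lp.
  by case/orP=> /eqP->.
pose p2 := lead_coef p1 *: p1.
have p2_mon : p2 \is monic by rewrite monicE lead_coefZ p1u.
pose p2Q : {poly rat} := map_poly intr p2.
have p2Q_mon : p2Q \is monic by apply: monic_map.
have p2g : p2Q %= g.
  rewrite gE /p2Q map_polyZ /= (eqp_trans (eqp_scale _ _)) //.
    by rewrite intr_eq0; apply/eqP=> p10; rewrite p10 mul0r in p1u.
  by rewrite eqp_sym eqp_scale.
have /dvdpP[q2 qE] : p2Q %| q by rewrite (eqp_dvdl _ p2g) dvdp_gcdl.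
have q2_mon : q2 \is monic.
  by move: q_mon; rewrite !monicE qE lead_coefM (eqP p2Q_mon) mulr1.
have p2Q_size : (1 < size p2Q)%N.
  rewrite (eqp_size p2g) -(size_map_poly (ratr : rat -> C)).
  by apply: root_size_gt1 gz; rewrite map_poly_eq0 gcdp_eq0 (negPf (monic_neq0 q_mon)).
have [|||r2 q2E] := IHN q2.
- apply: leq_trans qN; rewrite qE size_Mmonic ?monic_neq0 //.
  by rewrite -(subnK p2Q_size) addn2 !addnS /= ltnS leq_addr.
- exact: q2_mon.
- by move=> w q2w; apply: q_roots; rewrite qE rmorphM rootM q2w.
by exists (r2 * p2); rewrite rmorphM /= qE q2E.
Qed.

Lemma finite_order_char_poly_integral n m (M : 'M[C]_n) (q : {poly rat}) :
    (0 < m)%N -> M ^+ m = 1 -> char_poly M = map_poly ratr q ->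
  exists r : {poly int}, q = map_poly intr r.
Proof.
move=> m0 Mm Mq; apply: (monic_unity_roots_integral m0).
  by have := char_poly_monic M; rewrite Mq map_monic.
move=> z; rewrite -Mq -eigenvalue_root_char => /eigenvalueP[v vM v0].
have vMk k : v *m M ^+ k = z ^+ k *: v.
  elim: k => [|k IHk]; first by rewrite !expr0 mulmx1 scale1r.
  by rewrite exprSr exprS mulmxA IHk -scalemxAl vM scalerA mulrC.
have := vMk m; rewrite Mm mulmx1 => /eqP; rewrite -subr_eq0.
rewrite -[X in X - _]scale1r -scalerBl scaler_eq0 (negPf v0) orbF subr_eq0.
by move/eqP.
Qed.

End RationalCharPoly.

(** * Quotients of the rational group algebra *)

(** That [ratr] is a morphism rests on characteristic 0, witnessed for an unordered field such as
    Q_l by its embedding in [C]. *)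
Lemma ratr_rmorphism (F : fieldType) (C : numFieldType) (j : {rmorphism F -> C}) :
  exists f : {rmorphism rat -> F}, forall q, f q = ratr q.
Proof.
have jr q : j (ratr q) = ratr q := fmorph_rat j q.
have fB : zmod_morphism (ratr : rat -> F).
  by move=> x y; apply: (fmorph_inj j); rewrite rmorphB /= !jr rmorphB.
have fM : monoid_morphism (ratr : rat -> F).
  split=> [|x y]; apply: (fmorph_inj j); first by rewrite jr !rmorph1.
  by rewrite rmorphM /= !jr rmorphM.
pose f : {rmorphism rat -> F} := HB.pack (ratr : rat -> F)
  (GRing.isZmodMorphism.Build _ _ (ratr : rat -> F) fB)
  (GRing.isMonoidMorphism.Build _ _ (ratr : rat -> F) fM).
by exists f.
Qed.

Section RationalGroupAlgebra.
Variables (gT : finGroupType).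
Local Notation QG := (group_algebra gT).

Lemma ga_ofM (g h : gT) : ga_of (g * h) = ga_of g * ga_of h :> QG.
Proof. exact: (@gelM rat gT g h). Qed.

Lemma representation_qmx (F : fieldType) (C : numFieldType)
    (j : {rmorphism F -> C}) n (r : mx_representation F [set: gT] n) :
  exists psi : {rmorphism QG -> 'M[F]_n},
    forall x, psi x = \sum_g ratr (x g) *: r g.
Proof.
have [f fE] := ratr_rmorphism j.
pose psi (x : QG) : 'M[F]_n := gmx r (gmap f (x : galg rat gT)).
have psiB : zmod_morphism psi.
  move=> x y; exact: etrans (congr1 (gmx r) (raddfB (@gmap _ _ f gT) x y)) (raddfB (gmx r) _ _).
have psiM : monoid_morphism psi.
  split=> [|x y]; first exact: etrans (congr1 (gmx r) (rmorph1 (@gmap _ _ f gT))) (rmorph1 (gmx r)).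
  exact: etrans (congr1 (gmx r) (rmorphM (@gmap _ _ f gT) x y)) (rmorphM (gmx r) _ _).
pose psi' : {rmorphism QG -> 'M[F]_n} := HB.pack psi
  (GRing.isZmodMorphism.Build _ _ psi psiB)
  (GRing.isMonoidMorphism.Build _ _ psi psiM).
exists psi' => x; rewrite /= /psi /gmx; apply: eq_bigr => g _.
by rewrite gmapE fE.
Qed.

(** Ring morphisms are automatically Q-linear here: [denq q] times the image of the scalar [q] is
    [numq q] times the identity, and [denq q] is invertible in [F]. *)
Lemma rmorphism_qmx (F : fieldType) (C : numFieldType)
    (j : {rmorphism F -> C}) n (phi : {rmorphism QG -> 'M[F]_n}) x :
  phi x = \sum_g ratr (x g) *: phi (ga_of g).
Proof.
pose c (q : rat) : QG := q *: (1 : galg rat gT).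
have xE : x = \sum_g c (x g) * ga_of g.
  apply: etrans (@galg_sum rat gT x) (eq_bigr _ _) => g _.
  have cE (q : rat) (u : galg rat gT) : q *: u = (q *: 1) * u.
    by rewrite -galg_scalerAl mul1r.
  exact: cE.
rewrite {1}xE rmorph_sum; apply: eq_bigr => g _; rewrite rmorphM.
suff -> : phi (c (x g)) = (ratr (x g))%:M by rewrite -[_ * _]/(_ *m _) mul_scalar_mx.
set q := x g.
have cq : c q *~ denq q = 1 *~ numq q.
  have cq : (q *: (1 : galg rat gT)) *~ denq q = 1 *~ numq q.
    by rewrite scalerMzl -mulrzr -numqE scaler_int.
  exact: cq.
have pq : phi (c q) *~ denq q = 1 *~ numq q.
  by rewrite -raddfMz cq raddfMz; congr (_ *~ _); apply: (rmorph1 phi).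
have dF : (denq q)%:~R != 0 :> F.
  by rewrite -(fmorph_eq0 j) rmorph_int intr_eq0 denq_neq0.
apply: (scalerI dF); rewrite scaler_int pq /ratr scale_scalar_mx mulrCA mulfV // mulr1.
by rewrite -scaler_int scalemx1.
Qed.

End RationalGroupAlgebra.

Section Quotients.
Variables (gT : finGroupType).
Local Notation QG := (group_algebra gT).

Lemma quotient_lift (E : ga_quotient gT) (T : pzRingType) (psi : {rmorphism QG -> T}) :
    (forall x, quot_map E x = 0 -> psi x = 0) ->
  exists rho : {rmorphism E -> T}, forall x, rho (quot_map E x) = psi x.
Proof.
move=> ker; pose rho (y : E) : T := psi (xchoose (quot_surj y)).
have rhoE x : rho (quot_map E x) = psi x.
  apply/eqP; rewrite -subr_eq0 -rmorphB; apply/eqP/ker.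
  by rewrite rmorphB (eqP (xchooseP (quot_surj (quot_map E x)))) subrr.
have surj y : exists x, quot_map E x = y.
  by have [x /eqP xy] := quot_surj y; exists x.
have rhoB : zmod_morphism rho.
  move=> y y'; have [x <-] := surj y; have [x' <-] := surj y'.
  by rewrite -rmorphB !rhoE rmorphB.
have rhoM : monoid_morphism rho.
  split=> [|y y']; first by rewrite -(rmorph1 (quot_map E)) rhoE rmorph1.
  have [x <-] := surj y; have [x' <-] := surj y'.
  by rewrite -rmorphM !rhoE rmorphM.
pose rho' : {rmorphism E -> T} := HB.pack rho
  (GRing.isZmodMorphism.Build _ _ rho rhoB)
  (GRing.isMonoidMorphism.Build _ _ rho rhoM).
by exists rho'.
Qed.

Lemma quot_surjP (E : ga_quotient gT) (y : E) : exists x, quot_map E x = y.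
Proof. by have [x /eqP xy] := quot_surj y; exists x. Qed.

Lemma quotient_representation (E : ga_quotient gT) (F : fieldType) n
    (rho : {rmorphism E -> 'M[F]_n}) :
  exists V : mx_representation F [set: gT] n, forall g, V g = rho (quot_of E g).
Proof.
have rP : mx_repr [set: gT] (fun g => rho (quot_of E g)).
  split=> [|g h _ _].
    have -> : quot_of E 1%g = 1 by apply: (rmorph1 (quot_map E)).
    by rewrite rmorph1.
  by rewrite /quot_of ga_ofM !rmorphM.
by exists (MxRepresentation rP).
Qed.

Section Image.
Variables (T : pzRingType) (psi : {rmorphism QG -> T}).

Definition image_pred : {pred T} := fun y => `[< exists x, psi x = y >].
Fact image_subring : subring_closed image_pred.
Proof.
split=> [|y y' /asboolP[x <-] /asboolP[x' <-]|y y' /asboolP[x <-] /asboolP[x' <-]].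
- by apply/asboolP; exists 1; rewrite rmorph1.
- by apply/asboolP; exists (x - x'); rewrite rmorphB.
by apply/asboolP; exists (x * x'); rewrite rmorphM.
Qed.

(** It is only equipped as a possibly zero ring, for [T] may be the ring of matrices of size 0. *)
Definition image_ring : Type := {y : T | image_pred y}.
HB.instance Definition _ := SubChoice.copy image_ring {y : T | image_pred y}.
HB.instance Definition _ :=
  GRing.SubChoice_isSubPzRing.Build T image_pred image_ring image_subring.

Lemma image_quotient : exists (E : ga_quotient gT) (rho : {rmorphism E -> T}),
  injective rho /\ forall x, rho (quot_map E x) = psi x.
Proof.
have psiP x : image_pred (psi x) by apply/asboolP; exists x.
pose q x : image_ring := Sub (psi x) (psiP x).
have qB : zmod_morphism q by move=> x x'; apply: val_inj; rewrite /= rmorphB.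
have qM : monoid_morphism q.
  by split=> [|x x']; apply: val_inj; rewrite /= ?rmorph1 ?rmorphM.
pose q' : {rmorphism QG -> image_ring} := HB.pack q
  (GRing.isZmodMorphism.Build _ _ q qB) (GRing.isMonoidMorphism.Build _ _ q qM).
have q_surj (y : image_ring) : exists x, q' x == y.
  have /asboolP[x xy] := valP y; exists x.
  by apply/eqP/val_inj.
exists (@GaQuotient gT image_ring q' q_surj), val; split=> //.
exact: val_inj.
Qed.

End Image.
End Quotients.

Section BilinearOfMatrix.
Variables (F : fieldType) (n : nat) (J : 'M[F]_n).

Definition mx_biscalar (v w : 'cV[F]_n) : F := (v^T *m J *m w) 0 0.

Fact mx_biscalar_bilinear : bilinear_for *%R *%R mx_biscalar.
Proof.
split=> [w a v v'|v a w w'] /=; rewrite /mx_biscalar.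
  by rewrite linearP /= !mulmxDl -!scalemxAl !mxE.
by rewrite linearP /= !mxE.
Qed.

HB.instance Definition _ := bilinear_isBilinear.Build F 'cV[F]_n 'cV[F]_n F *%R *%R
  mx_biscalar mx_biscalar_bilinear.

End BilinearOfMatrix.

(** * The correspondence *)

Lemma quotient_qmx (gT : finGroupType) (E : ga_quotient gT) (F : fieldType)
    (C : numFieldType) (j : {rmorphism F -> C}) n (rho : {rmorphism E -> 'M[F]_n}) x :
  rho (quot_map E x) = \sum_g ratr (x g) *: rho (quot_of E g).
Proof. exact: (rmorphism_qmx j (rho \o quot_map E)%FUN x). Qed.

Lemma biscalar_mxE (K : fieldType) n (B : {biscalar 'cV[K]_n})
    (J := \matrix_(i, j) B (delta_mx i 0) (delta_mx j 0)) v w :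
  B v w = (v^T *m J *m w) 0 0.
Proof.
have colE (u : 'cV[K]_n) : u = \sum_i u i 0 *: delta_mx i 0.
  rewrite {1}[u]matrix_sum_delta; apply: eq_bigr => i _.
  by rewrite big_ord1.
rewrite {1}[w]colE linear_sumr mxE; apply: eq_bigr => j _.
rewrite linearZr_LR /= mulrC; congr (_ * _).
rewrite {1}[v]colE linear_sumlz mxE; apply: eq_bigr => i _.
by rewrite linearZl_LR /= !mxE.
Qed.

Lemma mx_form_inj (K : fieldType) n (A B : 'M[K]_n) :
  (forall v w : 'cV_n, (v^T *m A *m w) 0 0 = (v^T *m B *m w) 0 0) -> A = B.
Proof.
move=> AB; apply/matrixP=> i j; have := AB (delta_mx i 0) (delta_mx j 0).
by rewrite !trmx_delta -!rowE -!colE !mxE.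
Qed.

Lemma ga_star_of (gT : finGroupType) (g : gT) : ga_star (ga_of g) = ga_of g^-1%g.
Proof.
by apply/ffunP=> h; rewrite !ffunE -(inj_eq invg_inj) invgK.
Qed.

(** On group elements the involution is inversion, so adjointness of the form becomes invariance of
    its Gram matrix. *)
Lemma polarized_repr_form (gT : finGroupType) (E : ga_quotient gT) (K : fieldType) n
    (rho : {rmorphism E -> 'M[K]_n}) : polarized_repr rho ->
  exists2 J : 'M[K]_n, J^T = - J /\ J \in unitmx &
    forall g, (rho (quot_of E g))^T *m J *m rho (quot_of E g) = J.
Proof.
move=> [B [Balt Bnd Badj]].
pose J : 'M[K]_n := \matrix_(i, j) B (delta_mx i 0) (delta_mx j 0).
have BE v w : B v w = (v^T *m J *m w) 0 0 := biscalar_mxE B v w.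
exists J; first split.
- apply/matrixP=> i j; rewrite !mxE; apply/eqP; rewrite -addr_eq0.
  set u := delta_mx j 0; set v := delta_mx i 0.
  have := Balt (u + v); rewrite linearDl !linearDr !Balt add0r addr0 => /eqP.
  by [].
- rewrite -row_free_unit; apply: inj_row_free => u uJ.
  suff : u^T = 0 by move/(congr1 trmx); rewrite trmxK trmx0.
  by apply: Bnd => w; rewrite BE trmxK uJ mul0mx mxE.
move=> g; apply: mx_form_inj => v w; set X := rho _.
have := Badj (quot_of E g) v (X *m w).
rewrite !BE trmx_mul !mulmxA => ->; rewrite -!mulmxA; congr ((_ *m (_ *m _)) 0 0).
rewrite mulmxA quot_star_map ga_star_of -/(quot_of E g^-1%g) -[_ *m X]/(_ * _).
rewrite -rmorphM /quot_of -rmorphM -ga_ofM mulVg.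
by rewrite (rmorph1 (quot_map E)) rmorph1 mul1mx.
Qed.

Lemma rational_trace (C : numFieldType) n (A : 'M[C]_n) :
  rational_poly (char_poly A) -> exists q : rat, \tr A = ratr q.
Proof.
case: n A => [|n] A [r rE]; first by exists 0; rewrite /mxtrace big_ord0 rmorph0.
exists (- r`_n); rewrite rmorphN /= -coef_map -rE -[n]/(n.+1.-1).
by rewrite char_poly_trace // opprK.
Qed.

Section Correspondence.
Variables (p : nat) (gT : finGroupType) (a : nat) (C : numClosedFieldType).
Variables (Ql : forall l : prime_neq p, padic_field l).
Variable iota : forall l : prime_neq p, {rmorphism Ql l -> C}.
Hypothesis ramG : ramification_group p gT.
Local Notation QG := (group_algebra gT).
Implicit Types (S : symplectic_realization gT C a) (F : symplectic_family gT a Ql).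

Let Ql0 l : [pchar Ql l] =i pred0 := padic_pchar (prime_valP l) (Ql l).

Lemma map_ratr_mx l n (r : mx_representation (Ql l) [set: gT] n) (x : QG) :
  map_mx (iota l) (\sum_g ratr (x g) *: r g) =
  \sum_g ratr (x g) *: map_mx (iota l) (r g).
Proof.
by rewrite map_mx_sum; apply: eq_bigr => g _; rewrite map_mxZ fmorph_rat.
Qed.

Lemma intertwine_sum n (M : 'M[C]_n) (A B : gT -> 'M[C]_n) (c : gT -> C) :
  (forall g, M *m A g = B g *m M) ->
  M *m (\sum_g c g *: A g) = (\sum_g c g *: B g) *m M.
Proof.
move=> MAB; rewrite mulmx_sumr mulmx_suml; apply: eq_bigr => g _.
by rewrite -scalemxAr -scalemxAl MAB.
Qed.

(** An isomorphism over [C] on group elements gives the rest: the kernel of Q[G] -> E acts as 0 on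
    V, hence on [F l] because extension of scalars is injective on matrices, and characteristic
    polynomials can likewise be compared over [C]. *)
Lemma correspondsP S F : corresponds iota S F <->
  forall l, exists2 M, M \in unitmx &
    forall g, M *m map_mx (iota l) (F l g) = real_repr S (quot_of (real_alg S) g) *m M.
Proof.
split=> [SF l|SF l].
  have [rho [_ [M Mu Mrho] Frho]] := SF l.
  by exists M => // g; rewrite Frho Mrho.
have [M Mu MF] := SF l.
have [psi psiE] := representation_qmx (iota l) (F l).
have Mpsi x : M *m map_mx (iota l) (psi x) = real_repr S (quot_map _ x) *m M.
  rewrite psiE map_ratr_mx (quotient_qmx (idfun : {rmorphism C -> C})).
  exact: intertwine_sum.
have [rho rhoE] : exists rho : {rmorphism real_alg S -> 'M[Ql l]_(a + a)},
    forall x, rho (quot_map _ x) = psi x.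
  apply: quotient_lift => x x0; apply: (map_mx_inj (f := iota l)).
  have := Mpsi x; rewrite x0 rmorph0 mul0mx => MM0.
  by rewrite map_mx0 -[LHS](mulKmx Mu) MM0 mulmx0.
have Mrho y : M *m map_mx (iota l) (rho y) = real_repr S y *m M.
  by have [x <-] := quot_surjP y; rewrite rhoE Mpsi.
exists rho; split; last 1 first.
- move=> g; have [f fE] := ratr_rmorphism (iota l).
  rewrite /quot_of rhoE psiE (bigD1 g) //= big1 => [|h hg].
    by rewrite ffunE eqxx -fE rmorph1 scale1r addr0.
  by rewrite ffunE (negPf hg) -fE rmorph0 scale0r.
- move=> y; have [q qE] := @real_rational _ _ _ S y; exists q.
  apply: (map_poly_inj (iota l)); rewrite -map_poly_comp.
  rewrite (eq_map_poly (g := ratr)) => [|z]; last exact: fmorph_rat.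
  by rewrite -qE map_char_poly; apply: char_poly_similar Mu (Mrho y).
by exists M.
Qed.

Lemma char_poly_trace_eq n (K : fieldType) (A B : 'M[K]_n) :
  char_poly A = char_poly B -> \tr A = \tr B.
Proof.
case: n A B => [|n] A B AB; first by rewrite /mxtrace !big_ord0.
by apply: oppr_inj; rewrite -!char_poly_trace // AB.
Qed.

Lemma realization_descent n (tau : gT -> rat) l :
  exists m (rK : mx_representation (Ql l) [set: gT] m),
    forall (V : mx_representation C [set: gT] n),
    (forall g, \tr (V g) = ratr (tau g)) -> mx_rsim (map_repr (iota l) rK) V.
Proof.
have [s s_com s1] := ramification_idempotents (Ql l) (prime_valP l)
  (prime_val_neq l) ramG.
have [m [rK rKP]] := character_descent (iota l) (Ql0 l) s_com s1 n
  (fun g => ratr (tau g)).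
by exists m, rK => V Vt; apply: rKP => // g; rewrite Vt fmorph_rat.
Qed.

End Correspondence.

Lemma mx_rsimP (gT : finGroupType) (K : fieldType) n
    (r1 r2 : mx_representation K [set: gT] n) :
  mx_rsim r1 r2 <-> exists2 M, M \in unitmx & forall g, M *m r2 g = r1 g *m M.
Proof.
split=> [[M _ Mfree Mr]|[M Mu Mr]].
  by exists M => [|g]; rewrite -?row_free_unit ?Mr ?inE.
by exists M => [||g _]; rewrite ?row_free_unit ?Mr.
Qed.

Lemma char_poly_rsim (gT : finGroupType) (K : fieldType) n
    (r1 r2 : mx_representation K [set: gT] n) :
  mx_rsim r1 r2 -> forall g, char_poly (r1 g) = char_poly (r2 g).
Proof.
move/mx_rsimP=> [M Mu Mr] g; apply/esym; exact: char_poly_similar Mu (Mr g).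
Qed.

Section Bijection.
Variables (p : nat) (gT : finGroupType) (a : nat) (C : numClosedFieldType).
Variables (Ql : forall l : prime_neq p, padic_field l).
Variable iota : forall l : prime_neq p, {rmorphism Ql l -> C}.
Hypothesis ramG : ramification_group p gT.
Local Notation QG := (group_algebra gT).
Implicit Types (S : symplectic_realization gT C a) (F : symplectic_family gT a Ql).

Let Ql0 l : [pchar Ql l] =i pred0 := padic_pchar (prime_valP l) (Ql l).

Lemma corresponds_rsim S F (V : mx_representation C [set: gT] (a + a)) :
    (forall g, V g = real_repr S (quot_of (real_alg S) g)) ->
  corresponds iota S F <-> forall l, mx_rsim (map_repr (iota l) (F l)) V.
Proof.
move=> VE; rewrite correspondsP; split=> SF l.
  by apply/mx_rsim_sym/mx_rsimP; have [M Mu MF] := SF l; exists M => // g; rewrite VE MF.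
have /mx_rsim_sym/mx_rsimP[M Mu MF] := SF l.
by exists M => // g; rewrite -VE -MF.
Qed.

Lemma integral_char_poly (V : mx_representation C [set: gT] (a + a)) (g : gT) :
  rational_poly (char_poly (V g)) -> exists r : {poly int}, char_poly (V g) = map_poly intr r.
Proof.
case=> q qE; have Vg : V g ^+ #[g]%g = 1.
  have -> : V g ^+ #[g]%g = V (g ^+ #[g]%g)%g.
    elim: (#[g]%g) => [|k IHk]; first by rewrite expr0 expg0 repr_mx1.
    by rewrite exprS expgS repr_mxM ?inE // IHk.
  by rewrite expg_order repr_mx1.
have [r rE] := finite_order_char_poly_integral (order_gt0 g) Vg qE.
exists r; rewrite qE rE -map_poly_comp; apply: eq_map_poly => x /=.
exact: ratr_int.
Qed.

Lemma realization_family S : exists F, corresponds iota S F.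
Proof.
have [V VE] := quotient_representation (real_repr S).
have [J [Jalt Ju] Jinv] := polarized_repr_form (@real_polarized _ _ _ S).
have Vrat g : rational_poly (char_poly (V g)) by rewrite VE; apply: real_rational.
have [tau tauE] : exists tau : gT -> rat, forall g, \tr (V g) = ratr (tau g).
  by apply: (@fin_all_exists _ (fun=> rat)
    (fun g q => \tr (V g) = ratr q)) => g; apply: rational_trace.
(* A representation is to be chosen for infinitely many [l], so existence is stated as a sigma type
   and obtained through [cid]. *)
have exF l : {r : mx_representation (Ql l) [set: gT] (a + a) |
    (forall g, Sp (r g)) /\ mx_rsim (map_repr (iota l) r) V}.
  apply: cid; have [m [rK rKV]] := realization_descent iota ramG (a + a) tau l.
  have sim := rKV V tauE; have ma := mxrank_rsim sim; subst m.
  have [M Mu MV] := (mx_rsimP _ _).1 sim.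
  pose JM := (invmx M)^T *m J *m invmx M.
  have JM_alt : JM^T = - JM.
    by rewrite /JM !trmx_mul trmxK Jalt mulNmx mulmxN mulmxA.
  have JM_unit : JM \in unitmx by rewrite !unitmx_mul unitmx_tr !unitmx_inv Mu Ju.
  have JM_inv g : (map_repr (iota l) rK g)^T *m JM *m map_repr (iota l) rK g = JM.
    have rE : invmx M *m map_repr (iota l) rK g = V g *m invmx M.
      by rewrite -[_ *m map_repr _ _ _](mulmxK Mu) -(mulmxA (invmx M)) -MV mulKmx.
    rewrite /JM -!mulmxA rE !mulmxA -trmx_mul rE trmx_mul.
    by rewrite -[in RHS](Jinv g) -VE !mulmxA.
  have [J1 [J1alt J1inv] J1u] :=
    symplectic_form_descent (Ql0 l) (conj JM_alt JM_inv) JM_unit.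
  have [P Pu PJ] := symplectic_basis (Ql0 l) J1alt J1u.
  have Qu : invmx P \in unitmx by rewrite unitmx_inv.
  pose r := rconj_repr rK Qu.
  have rE g : r g = invmx P *m rK g *m P by rewrite /r /= /rconj_mx invmxK.
  exists r; split=> [g|].
    rewrite /Sp -PJ rE !trmx_mul !mulmxA trmx_inv (mulmxKV (_ : P^T \in unitmx)) ?unitmx_tr //.
    rewrite -!mulmxA mulKVmx // !mulmxA -(mulmxA _ J1); congr (_ *m _).
    by rewrite -!mulmxA; congr (_ *m _); rewrite !mulmxA J1inv.
  apply: mx_rsim_trans sim; apply: mx_rsim_map; apply/mx_rsim_sym/mx_rsimP.
  by exists P => // g; rewrite rE !mulmxA mulmxV // mul1mx.
have rSp l g : Sp (projT1 (exF l) g) := (projT2 (exF l)).1 g.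
have rsim l : mx_rsim (map_repr (iota l) (projT1 (exF l))) V := (projT2 (exF l)).2.
have rint g : exists q : {poly int},
    forall l, integral_poly (char_poly (projT1 (exF l) g)) q.
  have [q qE] := integral_char_poly (Vrat g); exists q => l.
  apply: (map_poly_inj (iota l)); rewrite map_char_poly.
  rewrite (char_poly_rsim (rsim l)) qE -map_poly_comp.
  by apply: eq_map_poly => x /=; rewrite rmorph_int.
exists (SymplecticFamily rSp rint); exact/(corresponds_rsim _ VE).
Qed.

End Bijection.

Section MatrixForm.
Variables (K : numFieldType) (n : nat) (J : 'M[K]_n).

Lemma mx_biscalar_alternating v : J^T = - J -> mx_biscalar J v v = 0.
Proof.
move=> Jalt; apply/eqP; rewrite -eqNr; apply/eqP; rewrite /mx_biscalar.
transitivity ((v^T *m J *m v)^T 0 0); last by rewrite mxE.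
by rewrite !trmx_mul trmxK Jalt mulNmx mulmxN mulmxA [RHS]mxE.
Qed.

Lemma mx_biscalar_nondegenerate v : J \in unitmx ->
  (forall w, mx_biscalar J v w = 0) -> v = 0.
Proof.
move=> Ju v0; apply: trmx_inj; rewrite trmx0 -[v^T](mulmxK Ju).
suff -> : v^T *m J = 0 by rewrite mul0mx.
apply/rowP=> j; rewrite [RHS]mxE -(v0 (delta_mx j 0)) /mx_biscalar.
by rewrite -colE [RHS]mxE.
Qed.

End MatrixForm.

Lemma exists_prime_neq p : inhabited (prime_neq p).
Proof.
have [p2|p2] := eqVneq 2%N p; last by split; exists 2%N.
by split; exists 3%N; rewrite -?p2.
Qed.

Section Equivalences.
Variables (p : nat) (gT : finGroupType) (a : nat) (C : numClosedFieldType).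
Variables (Ql : forall l : prime_neq p, padic_field l).
Variable iota : forall l : prime_neq p, {rmorphism Ql l -> C}.
Hypothesis ramG : ramification_group p gT.
Local Notation QG := (group_algebra gT).
Implicit Types (S : symplectic_realization gT C a) (F : symplectic_family gT a Ql).

Let Ql0 l : [pchar Ql l] =i pred0 := padic_pchar (prime_valP l) (Ql l).

Lemma family_character F : exists tau : gT -> rat,
  forall l g, \tr (map_repr (iota l) (F l) g) = ratr (tau g).
Proof.
have [l0] := exists_prime_neq p.
suff exq g : exists q : rat, forall l, \tr (map_repr (iota l) (F l) g) = ratr q.
  have [tau tauE] := @fin_all_exists _ (fun=> rat)
    (fun g q => forall l, \tr (map_repr (iota l) (F l) g) = ratr q) exq.
  by exists tau => l g; apply: tauE.
have [r rE] := fam_compatible F g.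
have CE l : char_poly (map_repr (iota l) (F l) g) = map_poly intr r.
  rewrite -map_char_poly rE -map_poly_comp.
  by apply: eq_map_poly => x /=; rewrite rmorph_int.
have [|q qE] := @rational_trace C _ (map_repr (iota l0) (F l0) g).
  exists (map_poly intr r); rewrite CE -map_poly_comp.
  by apply: eq_map_poly => x /=; rewrite ratr_int.
by exists q => l; rewrite -qE; apply: char_poly_trace_eq; rewrite !CE.
Qed.

(** The realization is built from one prime [l0]. For any other [l], the extensions to [C] of [F l]
    and [F l0] have the same rational character, so both are isomorphic to the extension of one
    representation over [Ql l]. *)
Lemma family_realization F : exists2 S, faithful_real S & corresponds iota S F.
Proof.
have [l0] := exists_prime_neq p; have [tau tauE] := family_character F.
pose r0 := map_repr (iota l0) (F l0).
have [psi psiE] := representation_qmx (idfun : {rmorphism C -> C}) r0.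
have [E [rho [rho_inj rhoE]]] := image_quotient psi.
have psi_of g : psi (ga_of g) = r0 g.
  rewrite psiE (bigD1 g) //= big1 => [|h hg].
    by rewrite ffunE eqxx rmorph1 scale1r addr0.
  by rewrite ffunE (negPf hg) rmorph0 scale0r.
have rat_rho : rational_repr rho.
  move=> y; have [x <-] := quot_surjP y; apply: char_poly_rational => k.
  rewrite rhoE -rmorphXn psiE raddf_sum; apply: is_rat_sum => g _.
  by rewrite /= mxtraceZ -/r0 tauE; apply: is_ratM; [exists ((x ^+ k) g) | exists (tau g)].
have pol_rho : polarized_repr rho.
  exists (mx_biscalar (symplectic_form C a)); split.
  - by move=> v; apply: mx_biscalar_alternating; apply: symplectic_formT.
  - by move=> v; apply: mx_biscalar_nondegenerate; apply: symplectic_form_unit.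
  move=> y v w; have [x <-] := quot_surjP y; rewrite quot_star_map !rhoE /= /mx_biscalar.
  rewrite trmx_mul -!mulmxA; congr ((_ *m _) 0 0); rewrite !mulmxA; congr (_ *m _).
  (* By linearity and the substitution of g^-1 for g, adjointness reduces to the relation (r0
     g^-1)^T J = J (r0 g) for the standard form J. *)
  rewrite !psiE (reindex_inj invg_inj) linear_sum mulmx_suml mulmx_sumr.
  apply: eq_bigr => g _; rewrite ffunE linearZ /= -scalemxAl -scalemxAr.
  congr (_ *: _).
  have formE : map_mx (iota l0) (symplectic_form _ a) = symplectic_form C a.
    by rewrite /symplectic_form map_block_mx map_mxN map_mx0 map_mx1.
  have rSp h : (r0 h)^T *m symplectic_form C a *m r0 h = symplectic_form C a.
    by have := congr1 (map_mx (iota l0)) (fam_Sp F l0 h); rewrite !map_mxM map_trmx formE.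
  have gV : r0 g^-1%g *m r0 g = 1%:M by rewrite -repr_mxM ?inE // mulVg repr_mx1.
  have := congr1 (mulmx^~ (r0 g)) (rSp g^-1%g).
  by rewrite -[_ *m _ *m _ *m r0 g]mulmxA gV mulmx1.
exists (SymplecticRealization rat_rho pol_rho); first exact: rho_inj.
apply/(@corresponds_rsim _ _ _ _ _ _ _ _ r0) => [g|l].
  by rewrite /= /quot_of rhoE psi_of.
have [m [rK rKP]] := realization_descent iota ramG (a + a) tau l.
exact: mx_rsim_trans (mx_rsim_sym (rKP _ (tauE l))) (rKP _ (tauE l0)).
Qed.

Lemma real_equivP S S' (V V' : mx_representation C [set: gT] (a + a)) :
    (forall g, V g = real_repr S (quot_of (real_alg S) g)) ->
    (forall g, V' g = real_repr S' (quot_of (real_alg S') g)) ->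
  real_equiv S S' <-> mx_rsim V' V.
Proof.
move=> VE VE'; rewrite mx_rsimP; split=> -[M Mu MV]; exists M => //.
  by move=> g; rewrite VE VE' MV.
move=> x; rewrite !(quotient_qmx (idfun : {rmorphism C -> C})).
by apply: intertwine_sum => g; rewrite -VE -VE'.
Qed.

(** Towards families this is Noether-Deuring at every [l]; towards realizations a single prime is
    enough. *)
Lemma real_equiv_family S S' F F' : corresponds iota S F -> corresponds iota S' F' ->
  real_equiv S S' <-> fam_equiv F F'.
Proof.
have [V VE] := quotient_representation (real_repr S).
have [V' VE'] := quotient_representation (real_repr S').
move=> /(corresponds_rsim _ _ VE) SF /(corresponds_rsim _ _ VE') SF'.
rewrite (real_equivP VE VE'); split=> [VV' l|FF'].
  apply: (mx_rsim_descent (iota := iota l) (Ql0 l)); apply: mx_rsim_trans (SF l) _.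
  exact: mx_rsim_trans (mx_rsim_sym VV') (mx_rsim_sym (SF' l)).
have [l] := exists_prime_neq p.
apply/mx_rsim_sym; apply: mx_rsim_trans (mx_rsim_sym (SF l)) _.
exact: mx_rsim_trans (mx_rsim_map _ (FF' l)) (SF' l).
Qed.

(** Faithfulness makes the kernel of Q[G] -> E the annihilator of V, so equivalent actions have
    equal kernels and the identity of Q[G] induces an isomorphism of the quotients. *)
Lemma faithful_real_equiv S S' : faithful_real S -> faithful_real S' ->
  real_equiv S S' <-> real_iso S S'.
Proof.
move=> Sinj Sinj'; split=> [[M Mu MS]|[f [_ fE] [M Mu MS]]]; last first.
  by exists M => // x; rewrite MS fE.
have Sker x : quot_map (real_alg S) x = 0 -> quot_map (real_alg S') x = 0.
  move=> x0; apply: Sinj'; rewrite rmorph0.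
  have := MS x; rewrite x0 rmorph0 mulmx0 => /esym MM0.
  by rewrite -[LHS](mulmxK Mu) MM0 mul0mx.
have Sker' x : quot_map (real_alg S') x = 0 -> quot_map (real_alg S) x = 0.
  move=> x0; apply: Sinj; rewrite rmorph0.
  have := MS x; rewrite x0 rmorph0 mul0mx => MM0.
  by rewrite -[LHS](mulKmx Mu) MM0 mulmx0.
have [f fE] := quotient_lift Sker; have [f' fE'] := quotient_lift Sker'.
exists f; last first.
  by exists M => // y; have [x <-] := quot_surjP y; rewrite fE MS.
split=> //; exists f' => y; have [x <-] := quot_surjP y.
  by rewrite fE fE'.
by rewrite fE' fE.
Qed.

End Equivalences.

Theorem mainTheorem5
    (p : nat) (p_prime : prime p)
    (a : nat)
    (gT : finGroupType) (ramG : ramification_group p gT)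
    (R : realType)
    (Ql : forall l : prime_neq p, padic_field l)
    (iota : forall l : prime_neq p, {rmorphism Ql l -> R[i]%C}) :
  [/\ forall S : symplectic_realization gT R[i]%C a,
        exists F : symplectic_family gT a Ql, corresponds iota S F,
      forall F : symplectic_family gT a Ql,
        exists2 S : symplectic_realization gT R[i]%C a,
          faithful_real S & corresponds iota S F,
      forall (S S' : symplectic_realization gT R[i]%C a)
             (F F' : symplectic_family gT a Ql),
        corresponds iota S F -> corresponds iota S' F' ->
        (real_equiv S S' <-> fam_equiv F F')
    & forall S S' : symplectic_realization gT R[i]%C a,
        faithful_real S -> faithful_real S' ->
        (real_equiv S S' <-> real_iso S S')].
Proof.
split.
- exact: realization_family.
- exact: family_realization.
- exact: real_equiv_family.
exact: faithful_real_equiv.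
Qed.
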